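(* A span $A\xleftarrow{p}J\xrightarrow{q}B$ of $2$-functors forms an internal split two-sided fibration in the sesquicategory $|\mathsf{2Cat}'_{\mathrm{lax}}|$ of large $2$-categories, $2$-functors and lax natural transformations if and only if: (f) $p$ is a split co-$2$-fibration, with cleavage say $\lambda(-,-)$; (o) $q$ is a split op-$2$-fibration, with cleavage say $\rho(-,-)$; (v) the cleavages are vertical with respect to the other leg: $q(\lambda(u,i))=\mathrm{id}_{qi}$, $q(\lambda(s,\alpha))=\mathrm{id}_{qs}$, $p(\rho(j,v))=\mathrm{id}_{pj}$ and $p(\rho(\beta,t))=\mathrm{id}_{pt}$; (cl) for $u\colon a\to pi$ in $A$ and $v\colon qi\to b$ in $B$: $v_!(u^*i)=u^*(v_!i)$ and $\rho(i,v)\circ\lambda(u,i)=\lambda(u,v_!i)\circ\rho(u^*i,v)$; (cc) given $s\colon i\to j$ in $J$, for $\alpha\colon ps\Rightarrow v$ in $A$ and $\beta\colon u\Rightarrow qs$ in $B$: $\alpha_!(\beta^*s)=\beta^*(\alpha_!s)$ and $\rho(\beta,s)\odot\lambda(s,\alpha)=\lambda(\beta^*s,\alpha)\odot\rho(\beta,\alpha_!s)$.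
   Context: $\odot$ denotes composition of cells along a morphism, in diagrammatic order; $\circ$ denotes composition of morphisms, horizontal composition and whiskering. **Internal split two-sided fibrations in $|\mathsf{2Cat}'_{\mathrm{lax}}|$.** For a (large) $2$-category $A$ the lax arrow $2$-category $A^{\mathbf 2}$ has objects $(a,u,b)$ with $u\colon a\to b$; morphisms $(s,\zeta,t)\colon(a_0,u_0,b_0)\to(a_1,u_1,b_1)$ with $s\colon a_0\to a_1$, $t\colon b_0\to b_1$, $\zeta\colon t\circ u_0\Rightarrow u_1\circ s$; cells $(\sigma,\tau)\colon(s_0,\zeta_0,t_0)\Rightarrow(s_1,\zeta_1,t_1)$ with $\sigma\colon s_0\Rightarrow s_1$, $\tau\colon t_0\Rightarrow t_1$, $\zeta_0\odot(u_1\circ\sigma)=(\tau\circ u_0)\odot\zeta_1$. Let $\mathrm{src},\mathrm{tgt}\colon A^{\mathbf 2}\to A$ be the projections. $A^{\mathbf 2}$ is an internal category (in the category of large $2$-categories and $2$-functors) with object of objects $A$, with unit $\tilde\alpha\colon A\to A^{\mathbf 2}$, $a\mapsto(a,\mathrm{id}_a,a)$, $s\mapsto(s,\mathrm{id}_s,s)$, $\sigma\mapsto(\sigma,\sigma)$, and composition $\bar\alpha\colon A^{\mathbf 2}\times_AA^{\mathbf 2}\to A^{\mathbf 2}$, $(a,u,b,v,c)\mapsto(a,v\circ u,c)$, $(r,\zeta,s,\eta,t)\mapsto(r,(\eta\circ u_0)\odot(v_1\circ\zeta),t)$, $(\rho,\sigma,\tau)\mapsto(\rho,\tau)$. An internal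 split two-sided fibration $A\nrightarrow B$ in $|\mathsf{2Cat}'_{\mathrm{lax}}|$ is an internal profunctor $A^{\mathbf 2}\nrightarrow B^{\mathbf 2}$: a span $A\xleftarrow{p}J\xrightarrow{q}B$ with $2$-functors $\lambda\colon A^{\mathbf 2}\times_AJ\to J$ (strict pullback of $\mathrm{tgt}$ and $p$) and $\rho\colon J\times_BB^{\mathbf 2}\to J$ (strict pullback of $q$ and $\mathrm{src}$) that are morphisms of spans $A\leftarrow\cdot\rightarrow B$ (where $A^{\mathbf 2}\times_A J$ has legs induced by $\mathrm{src}$ and $q$, and $J\times_BB^{\mathbf 2}$ has legs induced by $p$ and $\mathrm{tgt}$) satisfying $\lambda\circ(\bar\alpha\times\mathrm{id})=\lambda\circ(\mathrm{id}\times\lambda)$, $\lambda\circ(\tilde\alpha p,\mathrm{id}_J)=\mathrm{id}_J$, $\rho\circ(\mathrm{id}\times\bar\beta)=\rho\circ(\rho\times\mathrm{id})$, $\rho\circ(\mathrm{id}_J,\tilde\beta q)=\mathrm{id}_J$, $\rho\circ(\lambda\times\mathrm{id})=\lambda\circ(\mathrm{id}\times\rho)$. The cleavages of (f) and (o) are those corresponding to the actions $\lambda$ and $\rho$: $\rho(i,u)=\rho(\mathrm{id}_i,(\mathrm{id}_{qi},\mathrm{id}_u,u))\colon i=\rho(i,(qi,\mathrm{id},qi))\to\rho(i,(qi,u,b))$ and $\rho(\beta,s)=\rho(\mathrm{id}_s,(\mathrm{id}_{qs},\beta))\colon\rho(s,(qs,\beta,u))\Rightarrow\rho(s,(qs,\mathrm{id}_{qs},qs))=s$,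 and dually for $\lambda$. **Split op-/co-$2$-fibrations.** A split op-$2$-fibration is a $2$-functor $q\colon J\to B$ with a cleavage $\rho(-,-)$: for $i\in J$, $u\colon qi\to b$ a morphism $\rho(i,u)\colon i\to u_!i$ with $q\rho(i,u)=u$; for $s\colon i\to j$ in $J$ and a cell $\beta\colon u\Rightarrow qs$ a cell $\rho(\beta,s)\colon\beta^*s\Rightarrow s$ with $q\rho(\beta,s)=\beta$; such that $\rho(i,v\circ u)=\rho(u_!i,v)\circ\rho(i,u)$, $\rho(i,\mathrm{id})=\mathrm{id}_i$, $\rho(\gamma\odot\beta,s)=\rho(\gamma,\beta^*s)\odot\rho(\beta,s)$, $\rho(\delta\circ\beta,t\circ s)=\rho(\delta,t)\circ\rho(\beta,s)$, $\rho(\mathrm{id}_{qs},s)=\mathrm{id}_s$; and: (om1) if $s\colon i\to j$ and $v\colon b\to qj$ satisfy $v\circ u=qs$, there is a unique $\tilde v\colon u_!i\to j$ with $q\tilde v=v$, $\tilde v\circ\rho(i,u)=s$; (om2) if $\sigma\colon s\Rightarrow t\colon i\to j$ and $\beta\colon v\Rightarrow w\colon b\to qj$ satisfy $\beta\circ u=q\sigma$, there is a unique $\tilde\beta\colon\tilde v\Rightarrow\tilde w$ with $q\tilde\beta=\beta$, $\tilde\beta\circ\rho(i,u)=\sigma$; (cc) if $\sigma\colon r\Rightarrow s$ and $\alpha\colon qr\Rightarrow u$ satisfy $\alpha\odot\beta=q\sigma$ (with $\beta\colon u\Rightarrow qs$), there is a unique $\tilde\alpha\colon r\Rightarrow\beta^*s$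 with $q\tilde\alpha=\alpha$, $\tilde\alpha\odot\rho(\beta,s)=\sigma$. A split co-$2$-fibration is a $2$-functor $p\colon J\to A$ such that $p^{\mathrm{coop}}$ (morphisms and cells reversed) is a split op-$2$-fibration; its cleavage $\lambda(-,-)$ supplies $\lambda(u,i)\colon u^*i\to i$ over $u\colon a\to pi$ and $\lambda(s,\alpha)\colon s\Rightarrow\alpha_!s$ over $\alpha\colon ps\Rightarrow v$, with dual properties. *)

(* Defs.v *)
From Corelib Require Import ssreflect.
From Stdlib Require Import ProofIrrelevance ClassicalEpsilon.

Set Implicit Arguments.
Unset Strict Implicit.
Unset Printing Implicit Defensive.

(* A (large) strict 2-category, presented by its types of objects, morphisms
   and cells with boundary maps, so that strict equalities of objects,
   morphisms and cells are plain equalities.  [comp g f] and [hcomp t s] are in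
   applicative order ("g after f"); [vcomp s t] is in diagrammatic order ("s
   then t").  Whiskering is horizontal composition with an identity cell.
   The compositions take a proof of composability.  In equations these proofs
   are universally quantified; the boundary axioms always provide them. *)
Record two_category : Type := TwoCategory {
  ob : Type;
  mor : Type;
  cell : Type;
  dom : mor -> ob;
  cod : mor -> ob;
  src : cell -> mor;
  tgt : cell -> mor;
  dom_src : forall s, dom (src s) = dom (tgt s);
  cod_src : forall s, cod (src s) = cod (tgt s);

  idm : ob -> mor;
  comp : forall g f : mor, cod f = dom g -> mor;
  idc : mor -> cell;
  vcomp : forall s t : cell, tgt s = src t -> cell;
  hcomp : forall t s : cell, cod (src s) = dom (src t) -> cell;

  dom_idm : forall a, dom (idm a) = a;
  cod_idm : forall a, cod (idm a) = a;
  dom_comp : forall g f e, dom (@comp g f e) = dom f;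
  cod_comp : forall g f e, cod (@comp g f e) = cod g;
  src_idc : forall f, src (idc f) = f;
  tgt_idc : forall f, tgt (idc f) = f;
  src_vcomp : forall s t e, src (@vcomp s t e) = src s;
  tgt_vcomp : forall s t e, tgt (@vcomp s t e) = tgt t;
  src_hcomp : forall t s e e', src (@hcomp t s e) = @comp (src t) (src s) e';
  tgt_hcomp : forall t s e e', tgt (@hcomp t s e) = @comp (tgt t) (tgt s) e';

  comp_idl : forall b f e, @comp (idm b) f e = f;
  comp_idr : forall f a e, @comp f (idm a) e = f;
  comp_assoc : forall h g f e1 e2 e3 e4,
    @comp h (@comp g f e1) e2 = @comp (@comp h g e3) f e4;

  vcomp_idl : forall f s e, @vcomp (idc f) s e = s;
  vcomp_idr : forall s f e, @vcomp s (idc f) e = s;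
  vcomp_assoc : forall r s t e1 e2 e3 e4,
    @vcomp (@vcomp r s e1) t e2 = @vcomp r (@vcomp s t e3) e4;

  hcomp_idl : forall b s e, @hcomp (idc (idm b)) s e = s;
  hcomp_idr : forall s a e, @hcomp s (idc (idm a)) e = s;
  hcomp_assoc : forall t s r e1 e2 e3 e4,
    @hcomp t (@hcomp s r e1) e2 = @hcomp (@hcomp t s e3) r e4;
  hcomp_idc : forall g f e e',
    @hcomp (idc g) (idc f) e = idc (@comp g f e');
  interchange : forall t t' s s' e1 e2 e3 e4 e5 e6,
    @hcomp (@vcomp t t' e1) (@vcomp s s' e2) e3
    = @vcomp (@hcomp t s e4) (@hcomp t' s' e5) e6
}.

Arguments dom {_} _.
Arguments cod {_} _.
Arguments src {_} _.
Arguments tgt {_} _.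
Arguments idm {_} _.
Arguments comp {_} _ _ _.
Arguments idc {_} _.
Arguments vcomp {_} _ _ _.
Arguments hcomp {_} _ _ _.

Definition is_comp (C : two_category) (g f h : mor C) : Prop :=
  exists e, comp g f e = h.
Definition is_vcomp (C : two_category) (s t r : cell C) : Prop :=
  exists e, vcomp s t e = r.
Definition is_hcomp (C : two_category) (t s r : cell C) : Prop :=
  exists e, hcomp t s e = r.

Record two_functor (X Y : two_category) : Type := TwoFunctor {
  fo : ob X -> ob Y;
  fm : mor X -> mor Y;
  fc : cell X -> cell Y;
  fm_dom : forall f, dom (fm f) = fo (dom f);
  fm_cod : forall f, cod (fm f) = fo (cod f);
  fc_src : forall s, src (fc s) = fm (src s);
  fc_tgt : forall s, tgt (fc s) = fm (tgt s);
  fm_idm : forall a, fm (idm a) = idm (fo a);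
  fm_comp : forall g f e e', fm (comp g f e) = comp (fm g) (fm f) e';
  fc_idc : forall f, fc (idc f) = idc (fm f);
  fc_vcomp : forall s t e e', fc (vcomp s t e) = vcomp (fc s) (fc t) e';
  fc_hcomp : forall t s e e', fc (hcomp t s e) = hcomp (fc t) (fc s) e'
}.

Arguments fm_comp {X Y} _ {_ _} _ _.
Arguments fc_vcomp {X Y} _ {_ _} _ _.
Arguments fc_hcomp {X Y} _ {_ _} _ _.

Record two_functor_eq (X Y : two_category) (F G : two_functor X Y) : Prop :=
  TwoFunctorEq {
  eq_fo : forall a, fo F a = fo G a;
  eq_fm : forall f, fm F f = fm G f;
  eq_fc : forall s, fc F s = fc G s
}.

Notation "F =2f G" := (two_functor_eq F G) (at level 70, no associativity).

Section TwoFunctorOperations.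

Definition functor_id (X : two_category) : two_functor X X.
Proof.
refine (@TwoFunctor X X (fun a => a) (fun f => f) (fun s => s)
  _ _ _ _ _ _ _ _ _) => //.
- by move=> g f e e'; rewrite (proof_irrelevance _ e e').
- by move=> g f e e'; rewrite (proof_irrelevance _ e e').
- by move=> g f e e'; rewrite (proof_irrelevance _ e e').
Defined.

Definition functor_comp (X Y Z : two_category)
  (G : two_functor Y Z) (F : two_functor X Y) : two_functor X Z.
Proof.
refine (@TwoFunctor X Z (fun a => fo G (fo F a)) (fun f => fm G (fm F f))
  (fun s => fc G (fc F s)) _ _ _ _ _ _ _ _ _).
- by move=> f; rewrite !fm_dom.
- by move=> f; rewrite !fm_cod.
- by move=> f; rewrite !fc_src.
- by move=> f; rewrite !fc_tgt.
- by move=> f; rewrite !fm_idm.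
- move=> g f e e'; have e0 : cod (fm F f) = dom (fm F g).
    by rewrite fm_dom fm_cod e.
  by rewrite (fm_comp F e e0); apply: fm_comp.
- by move=> f; rewrite !fc_idc.
- move=> g f e e'; have e0 : tgt (fc F g) = src (fc F f).
    by rewrite fc_src fc_tgt e.
  by rewrite (fc_vcomp F e e0); apply: fc_vcomp.
- move=> g f e e'; have e0 : cod (src (fc F f)) = dom (src (fc F g)).
    by rewrite !fc_src fm_dom fm_cod e.
  by rewrite (fc_hcomp F e e0); apply: fc_hcomp.
Defined.

End TwoFunctorOperations.

Notation "G \of F" := (functor_comp G F) (at level 40, left associativity).

Section Coop.

Lemma coop_hcomp_subproof (C : two_category) (t s : cell C) :
  dom (tgt s) = cod (tgt t) -> cod (src t) = dom (src s).
Proof. by move=> e; rewrite cod_src -e dom_src. Qed.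

(* C with both morphisms and cells reversed. *)
Definition coop (C : two_category) : two_category.
Proof.
refine (@TwoCategory (ob C) (mor C) (cell C) cod dom tgt src _ _
  idm (fun g f e => comp f g (eq_sym e)) idc
  (fun s t e => vcomp t s (eq_sym e))
  (fun t s e => hcomp s t (coop_hcomp_subproof e))
  _ _ _ _ _ _ _ _ _ _ _ _ _ _ _ _ _ _ _ _ _).
- by move=> s; rewrite cod_src.
- by move=> s; rewrite dom_src.
- exact: cod_idm.
- exact: dom_idm.
- by move=> *; rewrite cod_comp.
- by move=> *; rewrite dom_comp.
- exact: tgt_idc.
- exact: src_idc.
- by move=> *; rewrite tgt_vcomp.
- by move=> *; rewrite src_vcomp.
- by move=> *; apply: tgt_hcomp.
- by move=> *; apply: src_hcomp.
- by move=> *; rewrite comp_idr.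
- by move=> *; rewrite comp_idl.
- by move=> *; symmetry; apply: comp_assoc.
- by move=> *; rewrite vcomp_idr.
- by move=> *; rewrite vcomp_idl.
- by move=> *; symmetry; apply: vcomp_assoc.
- by move=> *; rewrite hcomp_idr.
- by move=> *; rewrite hcomp_idl.
- by move=> *; symmetry; apply: hcomp_assoc.
- by move=> *; apply: hcomp_idc.
- by move=> *; apply: interchange.
Defined.

Definition functor_coop (X Y : two_category) (F : two_functor X Y) :
  two_functor (coop X) (coop Y).
Proof.
refine (@TwoFunctor (coop X) (coop Y) (fo F) (fm F) (fc F) _ _ _ _ _ _ _ _ _).
- exact (@fm_cod _ _ F).
- exact (@fm_dom _ _ F).
- exact (@fc_tgt _ _ F).
- exact (@fc_src _ _ F).
- exact (@fm_idm _ _ F).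
- exact (fun g f e e' => @fm_comp _ _ F f g _ _).
- exact (@fc_idc _ _ F).
- exact (fun s t e e' => @fc_vcomp _ _ F t s _ _).
- exact (fun t s e e' => @fc_hcomp _ _ F s t _ _).
Defined.

End Coop.

Section Pullback.
Variables (X Y Z : two_category) (F : two_functor X Z) (G : two_functor Y Z).

Definition pb_ob := {x : ob X * ob Y | fo F (fst x) = fo G (snd x)}.
Definition pb_mor := {x : mor X * mor Y | fm F (fst x) = fm G (snd x)}.
Definition pb_cell := {x : cell X * cell Y | fc F (fst x) = fc G (snd x)}.

Lemma pb_eq (S T U : Type) (f : S -> U) (g : T -> U)
  (x y : {x : S * T | f (fst x) = g (snd x)}) :
  fst (proj1_sig x) = fst (proj1_sig y) ->
  snd (proj1_sig x) = snd (proj1_sig y) -> x = y.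
Proof.
case: x y => [[x1 x2] ex] [[y1 y2] ey] /= e1 e2.
by move: ex ey; rewrite e1 e2 => ex ey; rewrite (proof_irrelevance _ ex ey).
Qed.

Lemma pb_fst (S T U : Type) (f : S -> U) (g : T -> U)
  (x y : {x : S * T | f (fst x) = g (snd x)}) :
  x = y -> fst (proj1_sig x) = fst (proj1_sig y).
Proof. by move=> ->. Qed.

Lemma pb_snd (S T U : Type) (f : S -> U) (g : T -> U)
  (x y : {x : S * T | f (fst x) = g (snd x)}) :
  x = y -> snd (proj1_sig x) = snd (proj1_sig y).
Proof. by move=> ->. Qed.

Lemma pb_dom_subproof (m : pb_mor) :
  fo F (dom (fst (proj1_sig m))) = fo G (dom (snd (proj1_sig m))).
Proof. by rewrite -!fm_dom (proj2_sig m). Qed.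

Lemma pb_cod_subproof (m : pb_mor) :
  fo F (cod (fst (proj1_sig m))) = fo G (cod (snd (proj1_sig m))).
Proof. by rewrite -!fm_cod (proj2_sig m). Qed.

Lemma pb_src_subproof (s : pb_cell) :
  fm F (src (fst (proj1_sig s))) = fm G (src (snd (proj1_sig s))).
Proof. by rewrite -!fc_src (proj2_sig s). Qed.

Lemma pb_tgt_subproof (s : pb_cell) :
  fm F (tgt (fst (proj1_sig s))) = fm G (tgt (snd (proj1_sig s))).
Proof. by rewrite -!fc_tgt (proj2_sig s). Qed.

Definition pb_dom (m : pb_mor) : pb_ob :=
  exist _ (dom (fst (proj1_sig m)), dom (snd (proj1_sig m)))
    (pb_dom_subproof m).
Definition pb_cod (m : pb_mor) : pb_ob :=
  exist _ (cod (fst (proj1_sig m)), cod (snd (proj1_sig m)))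
    (pb_cod_subproof m).
Definition pb_src (s : pb_cell) : pb_mor :=
  exist _ (src (fst (proj1_sig s)), src (snd (proj1_sig s)))
    (pb_src_subproof s).
Definition pb_tgt (s : pb_cell) : pb_mor :=
  exist _ (tgt (fst (proj1_sig s)), tgt (snd (proj1_sig s)))
    (pb_tgt_subproof s).

Lemma pb_idm_subproof (a : pb_ob) :
  fm F (idm (fst (proj1_sig a))) = fm G (idm (snd (proj1_sig a))).
Proof. by rewrite !fm_idm (proj2_sig a). Qed.
Definition pb_idm (a : pb_ob) : pb_mor :=
  exist _ (idm (fst (proj1_sig a)), idm (snd (proj1_sig a)))
    (pb_idm_subproof a).

Lemma pb_idc_subproof (f : pb_mor) :
  fc F (idc (fst (proj1_sig f))) = fc G (idc (snd (proj1_sig f))).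
Proof. by rewrite !fc_idc (proj2_sig f). Qed.
Definition pb_idc (f : pb_mor) : pb_cell :=
  exist _ (idc (fst (proj1_sig f)), idc (snd (proj1_sig f)))
    (pb_idc_subproof f).

Lemma comp_congr (C : two_category) (g g' f f' : mor C) e e' :
  g = g' -> f = f' -> comp g f e = comp g' f' e'.
Proof.
by move=> eg ef; move: e e'; rewrite eg ef => e e';
   rewrite (proof_irrelevance _ e e').
Qed.

Lemma vcomp_congr (C : two_category) (s s' t t' : cell C) e e' :
  s = s' -> t = t' -> vcomp s t e = vcomp s' t' e'.
Proof.
by move=> eg ef; move: e e'; rewrite eg ef => e e';
   rewrite (proof_irrelevance _ e e').
Qed.

Lemma hcomp_congr (C : two_category) (t t' s s' : cell C) e e' :
  t = t' -> s = s' -> hcomp t s e = hcomp t' s' e'.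
Proof.
by move=> eg ef; move: e e'; rewrite eg ef => e e';
   rewrite (proof_irrelevance _ e e').
Qed.

Lemma pb_comp_subproof (g f : pb_mor) (e : pb_cod f = pb_dom g) :
  fm F (comp (fst (proj1_sig g)) (fst (proj1_sig f)) (pb_fst e))
  = fm G (comp (snd (proj1_sig g)) (snd (proj1_sig f)) (pb_snd e)).
Proof.
have e1 : cod (fm F (fst (proj1_sig f))) = dom (fm F (fst (proj1_sig g))).
  by rewrite fm_cod fm_dom; congr (fo F _); exact: (pb_fst e).
have e2 : cod (fm G (snd (proj1_sig f))) = dom (fm G (snd (proj1_sig g))).
  by rewrite fm_cod fm_dom; congr (fo G _); exact: (pb_snd e).
rewrite (fm_comp F _ e1) (fm_comp G _ e2).
by apply: comp_congr; [exact: (proj2_sig g) | exact: (proj2_sig f)].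
Qed.
Definition pb_comp (g f : pb_mor) (e : pb_cod f = pb_dom g) : pb_mor :=
  exist _ (comp (fst (proj1_sig g)) (fst (proj1_sig f)) (pb_fst e),
           comp (snd (proj1_sig g)) (snd (proj1_sig f)) (pb_snd e))
    (pb_comp_subproof e).

Lemma pb_vcomp_subproof (s t : pb_cell) (e : pb_tgt s = pb_src t) :
  fc F (vcomp (fst (proj1_sig s)) (fst (proj1_sig t)) (pb_fst e))
  = fc G (vcomp (snd (proj1_sig s)) (snd (proj1_sig t)) (pb_snd e)).
Proof.
have e1 : tgt (fc F (fst (proj1_sig s))) = src (fc F (fst (proj1_sig t))).
  by rewrite fc_src fc_tgt; congr (fm F _); exact: (pb_fst e).
have e2 : tgt (fc G (snd (proj1_sig s))) = src (fc G (snd (proj1_sig t))).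
  by rewrite fc_src fc_tgt; congr (fm G _); exact: (pb_snd e).
rewrite (fc_vcomp F _ e1) (fc_vcomp G _ e2).
by apply: vcomp_congr; [exact: (proj2_sig s) | exact: (proj2_sig t)].
Qed.
Definition pb_vcomp (s t : pb_cell) (e : pb_tgt s = pb_src t) : pb_cell :=
  exist _ (vcomp (fst (proj1_sig s)) (fst (proj1_sig t)) (pb_fst e),
           vcomp (snd (proj1_sig s)) (snd (proj1_sig t)) (pb_snd e))
    (pb_vcomp_subproof e).

Lemma pb_hcomp_subproof (t s : pb_cell)
  (e : pb_cod (pb_src s) = pb_dom (pb_src t)) :
  fc F (hcomp (fst (proj1_sig t)) (fst (proj1_sig s)) (pb_fst e))
  = fc G (hcomp (snd (proj1_sig t)) (snd (proj1_sig s)) (pb_snd e)).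
Proof.
have e1 : cod (src (fc F (fst (proj1_sig s))))
          = dom (src (fc F (fst (proj1_sig t)))).
  by rewrite !fc_src fm_cod fm_dom; congr (fo F _); exact: (pb_fst e).
have e2 : cod (src (fc G (snd (proj1_sig s))))
          = dom (src (fc G (snd (proj1_sig t)))).
  by rewrite !fc_src fm_cod fm_dom; congr (fo G _); exact: (pb_snd e).
rewrite (fc_hcomp F _ e1) (fc_hcomp G _ e2).
by apply: hcomp_congr; [exact: (proj2_sig t) | exact: (proj2_sig s)].
Qed.
Definition pb_hcomp (t s : pb_cell)
    (e : pb_cod (pb_src s) = pb_dom (pb_src t)) : pb_cell :=
  exist _ (hcomp (fst (proj1_sig t)) (fst (proj1_sig s)) (pb_fst e),
           hcomp (snd (proj1_sig t)) (snd (proj1_sig s)) (pb_snd e))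
    (pb_hcomp_subproof e).

(* The strict pullback of F along G. *)
Definition pullback : two_category.
Proof.
refine (@TwoCategory pb_ob pb_mor pb_cell pb_dom pb_cod pb_src pb_tgt _ _
  pb_idm pb_comp pb_idc pb_vcomp pb_hcomp
  _ _ _ _ _ _ _ _ _ _ _ _ _ _ _ _ _ _ _ _ _).
- by move=> s; apply: pb_eq; apply: dom_src.
- by move=> s; apply: pb_eq; apply: cod_src.
- by move=> a; apply: pb_eq; apply: dom_idm.
- by move=> a; apply: pb_eq; apply: cod_idm.
- by move=> *; apply: pb_eq; apply: dom_comp.
- by move=> *; apply: pb_eq; apply: cod_comp.
- by move=> *; apply: pb_eq; apply: src_idc.
- by move=> *; apply: pb_eq; apply: tgt_idc.
- by move=> *; apply: pb_eq; apply: src_vcomp.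
- by move=> *; apply: pb_eq; apply: tgt_vcomp.
- by move=> *; apply: pb_eq; apply: src_hcomp.
- by move=> *; apply: pb_eq; apply: tgt_hcomp.
- by move=> *; apply: pb_eq; apply: comp_idl.
- by move=> *; apply: pb_eq; apply: comp_idr.
- by move=> *; apply: pb_eq; apply: comp_assoc.
- by move=> *; apply: pb_eq; apply: vcomp_idl.
- by move=> *; apply: pb_eq; apply: vcomp_idr.
- by move=> *; apply: pb_eq; apply: vcomp_assoc.
- by move=> *; apply: pb_eq; apply: hcomp_idl.
- by move=> *; apply: pb_eq; apply: hcomp_idr.
- by move=> *; apply: pb_eq; apply: hcomp_assoc.
- by move=> *; apply: pb_eq; apply: hcomp_idc.
- by move=> *; apply: pb_eq; apply: interchange.
Defined.

Definition pb_pr1 : two_functor pullback X.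
Proof.
refine (@TwoFunctor pullback X (fun a => fst (proj1_sig a))
  (fun f => fst (proj1_sig f)) (fun s => fst (proj1_sig s))
  _ _ _ _ _ _ _ _ _) => //.
- by move=> *; apply: comp_congr.
- by move=> *; apply: vcomp_congr.
- by move=> *; apply: hcomp_congr.
Defined.

Definition pb_pr2 : two_functor pullback Y.
Proof.
refine (@TwoFunctor pullback Y (fun a => snd (proj1_sig a))
  (fun f => snd (proj1_sig f)) (fun s => snd (proj1_sig s))
  _ _ _ _ _ _ _ _ _) => //.
- by move=> *; apply: comp_congr.
- by move=> *; apply: vcomp_congr.
- by move=> *; apply: hcomp_congr.
Defined.

Lemma pb_square : F \of pb_pr1 =2f G \of pb_pr2.
Proof. by split=> x; apply: (proj2_sig x). Qed.

Definition pb_pair (W : two_category) (H : two_functor W X)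
  (K : two_functor W Y) (e : F \of H =2f G \of K) : two_functor W pullback.
Proof.
refine (@TwoFunctor W pullback
  (fun a => exist _ (fo H a, fo K a) (eq_fo e a))
  (fun f => exist _ (fm H f, fm K f) (eq_fm e f))
  (fun s => exist _ (fc H s, fc K s) (eq_fc e s)) _ _ _ _ _ _ _ _ _).
- by move=> *; apply: pb_eq; apply: fm_dom.
- by move=> *; apply: pb_eq; apply: fm_cod.
- by move=> *; apply: pb_eq; apply: fc_src.
- by move=> *; apply: pb_eq; apply: fc_tgt.
- by move=> *; apply: pb_eq; apply: fm_idm.
- by move=> *; apply: pb_eq; apply: fm_comp.
- by move=> *; apply: pb_eq; apply: fc_idc.
- by move=> *; apply: pb_eq; apply: fc_vcomp.
- by move=> *; apply: pb_eq; apply: fc_hcomp.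
Defined.

End Pullback.

(* Total versions of the compositions, with an arbitrary value on
   non-composable arguments; they only serve to rewrite without carrying
   composability proofs inside terms. *)
Section TotalComposition.
Variable C : two_category.
Implicit Types (f g h : mor C) (r s t : cell C).

Definition cmp g f : mor C :=
  match excluded_middle_informative (cod f = dom g) with
  | left e => comp g f e
  | right _ => f
  end.
Definition vc s t : cell C :=
  match excluded_middle_informative (tgt s = src t) with
  | left e => vcomp s t e
  | right _ => s
  end.
Definition hc t s : cell C :=
  match excluded_middle_informative (cod (src s) = dom (src t)) with
  | left e => hcomp t s e
  | right _ => s
  end.

Lemma compE g f e : comp g f e = cmp g f.
Proof.
rewrite /cmp; case: excluded_middle_informative => [e'|//].
exact: comp_congr.
Qed.

Lemma vcompE s t e : vcomp s t e = vc s t.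
Proof.
rewrite /vc; case: excluded_middle_informative => [e'|//].
exact: vcomp_congr.
Qed.

Lemma hcompE t s e : hcomp t s e = hc t s.
Proof.
rewrite /hc; case: excluded_middle_informative => [e'|//].
exact: hcomp_congr.
Qed.

Lemma dom_cmp g f : cod f = dom g -> dom (cmp g f) = dom f.
Proof. by move=> e; rewrite -(compE e) dom_comp. Qed.
Lemma cod_cmp g f : cod f = dom g -> cod (cmp g f) = cod g.
Proof. by move=> e; rewrite -(compE e) cod_comp. Qed.
Lemma src_vc s t : tgt s = src t -> src (vc s t) = src s.
Proof. by move=> e; rewrite -(vcompE e) src_vcomp. Qed.
Lemma tgt_vc s t : tgt s = src t -> tgt (vc s t) = tgt t.
Proof. by move=> e; rewrite -(vcompE e) tgt_vcomp. Qed.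
Lemma src_hc t s :
  cod (src s) = dom (src t) -> src (hc t s) = cmp (src t) (src s).
Proof. by move=> e; rewrite -(hcompE e) (src_hcomp _ e) compE. Qed.
Lemma tgt_hc t s :
  cod (src s) = dom (src t) -> tgt (hc t s) = cmp (tgt t) (tgt s).
Proof.
move=> e; have e' : cod (tgt s) = dom (tgt t) by rewrite -cod_src -dom_src.
by rewrite -(hcompE e) (tgt_hcomp _ e') compE.
Qed.

Lemma cmp_idl f b : b = cod f -> cmp (idm b) f = f.
Proof.
move=> eb; have e : cod f = dom (idm b) by rewrite dom_idm.
by rewrite -(compE e) comp_idl.
Qed.
Lemma cmp_idr f a : a = dom f -> cmp f (idm a) = f.
Proof.
move=> eb; have e : cod (idm a) = dom f by rewrite cod_idm.
by rewrite -(compE e) comp_idr.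
Qed.
Lemma cmp_assoc h g f : cod f = dom g -> cod g = dom h ->
  cmp h (cmp g f) = cmp (cmp h g) f.
Proof.
move=> e1 e2; rewrite -(compE e1) -(compE e2).
have e3 : cod (comp g f e1) = dom h by rewrite cod_comp.
have e4 : cod f = dom (comp h g e2) by rewrite dom_comp.
by rewrite -(compE e3) -(compE e4); apply: comp_assoc.
Qed.

Lemma vc_idl f s : f = src s -> vc (idc f) s = s.
Proof.
move=> ef; have e : tgt (idc f) = src s by rewrite tgt_idc.
by rewrite -(vcompE e) vcomp_idl.
Qed.
Lemma vc_idr f s : f = tgt s -> vc s (idc f) = s.
Proof.
move=> ef; have e : tgt s = src (idc f) by rewrite src_idc.
by rewrite -(vcompE e) vcomp_idr.
Qed.
Lemma vc_assoc r s t : tgt r = src s -> tgt s = src t ->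
  vc (vc r s) t = vc r (vc s t).
Proof.
move=> e1 e2; rewrite -(vcompE e1) -(vcompE e2).
have e3 : tgt (vcomp r s e1) = src t by rewrite tgt_vcomp.
have e4 : tgt r = src (vcomp s t e2) by rewrite src_vcomp.
by rewrite -(vcompE e3) -(vcompE e4); apply: vcomp_assoc.
Qed.

Lemma hc_idl s b : b = cod (src s) -> hc (idc (idm b)) s = s.
Proof.
move=> eb; have e : cod (src s) = dom (src (idc (idm b))).
  by rewrite src_idc dom_idm.
by rewrite -(hcompE e) hcomp_idl.
Qed.
Lemma hc_idr s a : a = dom (src s) -> hc s (idc (idm a)) = s.
Proof.
move=> eb; have e : cod (src (idc (idm a))) = dom (src s).
  by rewrite src_idc cod_idm.
by rewrite -(hcompE e) hcomp_idr.
Qed.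
Lemma hc_assoc t s r :
  cod (src r) = dom (src s) -> cod (src s) = dom (src t) ->
  hc t (hc s r) = hc (hc t s) r.
Proof.
move=> e1 e2.
have e3 : cod (src (hc s r)) = dom (src t) by rewrite src_hc // cod_cmp.
have e4 : cod (src r) = dom (src (hc t s)) by rewrite src_hc // dom_cmp.
rewrite -(hcompE e3) -(hcompE e4); move: e3 e4.
rewrite -(hcompE e1) -(hcompE e2) => e3 e4; exact: hcomp_assoc.
Qed.
Lemma hc_idc g f : cod f = dom g -> hc (idc g) (idc f) = idc (cmp g f).
Proof.
move=> e; have e' : cod (src (idc f)) = dom (src (idc g)).
  by rewrite !src_idc.
by rewrite -(hcompE e') -(compE e); apply: hcomp_idc.
Qed.
Lemma vc_hc t t' s s' : tgt t = src t' -> tgt s = src s' ->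
  cod (src s) = dom (src t) ->
  hc (vc t t') (vc s s') = vc (hc t s) (hc t' s').
Proof.
move=> e1 e2 e.
have e3 : cod (src (vc s s')) = dom (src (vc t t')) by rewrite !src_vc.
have e4 : cod (src s') = dom (src t').
  by rewrite -e1 -e2 -cod_src -dom_src.
have e5 : tgt (hc t s) = src (hc t' s') by rewrite tgt_hc // src_hc // e1 e2.
rewrite -(hcompE e3) -(vcompE e5); move: e3 e5.
rewrite -(vcompE e1) -(vcompE e2) -(hcompE e) -(hcompE e4) => e3 e5.
exact: interchange.
Qed.

Lemma is_compP g f h :
  is_comp g f h -> cod f = dom g /\ h = cmp g f.
Proof. by case=> e <-; rewrite compE. Qed.
Lemma is_comp_cmp g f h : cod f = dom g -> cmp g f = h -> is_comp g f h.
Proof. by move=> e <-; exists e; rewrite compE. Qed.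

End TotalComposition.

Section TotalFunctor.
Variables (X Y : two_category) (F : two_functor X Y).

Lemma fm_cmp g f : cod f = dom g -> fm F (cmp g f) = cmp (fm F g) (fm F f).
Proof.
move=> e; have e' : cod (fm F f) = dom (fm F g) by rewrite fm_dom fm_cod e.
by rewrite -(compE e) -(compE e'); apply: fm_comp.
Qed.
Lemma fc_vc s t : tgt s = src t -> fc F (vc s t) = vc (fc F s) (fc F t).
Proof.
move=> e; have e' : tgt (fc F s) = src (fc F t) by rewrite fc_src fc_tgt e.
by rewrite -(vcompE e) -(vcompE e'); apply: fc_vcomp.
Qed.
Lemma fc_hc t s : cod (src s) = dom (src t) ->
  fc F (hc t s) = hc (fc F t) (fc F s).
Proof.
move=> e; have e' : cod (src (fc F s)) = dom (src (fc F t)).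
  by rewrite !fc_src fm_dom fm_cod e.
by rewrite -(hcompE e) -(hcompE e'); apply: fc_hcomp.
Qed.

End TotalFunctor.

Section LaxArrow.
Variable C : two_category.

(* A morphism (s, z, t) from u0 to u1 of the lax arrow 2-category, where
   z : t o u0 => u1 o s.  An object (a, u, b) is encoded by the morphism u.
   The conditions dom s = dom u0 and cod t = cod u1 follow from the axioms
   dom_src and cod_src for z (lemmas sq_dom_s and sq_cod_t). *)
Record lax_square : Type := LaxSquare {
  sq_dom : mor C;
  sq_cod : mor C;
  sq_s : mor C;
  sq_t : mor C;
  sq_cell : cell C;
  sq_src : is_comp sq_t sq_dom (src sq_cell);
  sq_tgt : is_comp sq_cod sq_s (tgt sq_cell)
}.

(* A cell (sigma, tau) : (s0, z0, t0) => (s1, z1, t1). *)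
Record lax_square_cell : Type := LaxSquareCell {
  lc_src : lax_square;
  lc_tgt : lax_square;
  lc_s : cell C;
  lc_t : cell C;
  lc_sq_dom : sq_dom lc_src = sq_dom lc_tgt;
  lc_sq_cod : sq_cod lc_src = sq_cod lc_tgt;
  lc_s_src : src lc_s = sq_s lc_src;
  lc_s_tgt : tgt lc_s = sq_s lc_tgt;
  lc_t_src : src lc_t = sq_t lc_src;
  lc_t_tgt : tgt lc_t = sq_t lc_tgt;
  lc_eq : exists e1 e2 e3 e4,
    vcomp (sq_cell lc_src) (hcomp (idc (sq_cod lc_src)) lc_s e1) e2
    = vcomp (hcomp lc_t (idc (sq_dom lc_src)) e3) (sq_cell lc_tgt) e4
}.

Lemma sq_ext m m' : sq_dom m = sq_dom m' -> sq_cod m = sq_cod m' ->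
  sq_s m = sq_s m' -> sq_t m = sq_t m' -> sq_cell m = sq_cell m' -> m = m'.
Proof.
case: m m' => [u0 u1 s t z p q] [u0' u1' s' t' z' p' q'] /= e1 e2 e3 e4 e5.
subst; by rewrite (proof_irrelevance _ p p') (proof_irrelevance _ q q').
Qed.

Lemma lc_ext x y : lc_src x = lc_src y -> lc_tgt x = lc_tgt y ->
  lc_s x = lc_s y -> lc_t x = lc_t y -> x = y.
Proof.
case: x y => [m n s t p1 p2 p3 p4 p5 p6 p7] [m' n' s' t' q1 q2 q3 q4 q5 q6 q7].
move=> /= e1 e2 e3 e4; subst.
by rewrite (proof_irrelevance _ p1 q1) (proof_irrelevance _ p2 q2)
  (proof_irrelevance _ p3 q3) (proof_irrelevance _ p4 q4)
  (proof_irrelevance _ p5 q5) (proof_irrelevance _ p6 q6)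
  (proof_irrelevance _ p7 q7).
Qed.

Lemma sq_srcE m : src (sq_cell m) = cmp (sq_t m) (sq_dom m).
Proof. by case: (is_compP (sq_src m)). Qed.
Lemma sq_tgtE m : tgt (sq_cell m) = cmp (sq_cod m) (sq_s m).
Proof. by case: (is_compP (sq_tgt m)). Qed.
Lemma sq_dom_t m : dom (sq_t m) = cod (sq_dom m).
Proof. by case: (is_compP (sq_src m)). Qed.
Lemma sq_cod_s m : cod (sq_s m) = dom (sq_cod m).
Proof. by case: (is_compP (sq_tgt m)). Qed.
Lemma sq_dom_s m : dom (sq_s m) = dom (sq_dom m).
Proof.
have := dom_src (sq_cell m).
by rewrite sq_srcE sq_tgtE !dom_cmp // ?sq_dom_t // ?sq_cod_s.
Qed.
Lemma sq_cod_t m : cod (sq_t m) = cod (sq_cod m).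
Proof.
have := cod_src (sq_cell m).
by rewrite sq_srcE sq_tgtE !cod_cmp // ?sq_dom_t // ?sq_cod_s.
Qed.

End LaxArrow.

(* Discharges boundary side conditions. *)
Ltac bd := idtac;
  rewrite ?src_idc ?tgt_idc ?dom_idm ?cod_idm ?lc_s_src ?lc_s_tgt ?lc_t_src
    ?lc_t_tgt ?sq_srcE ?sq_tgtE;
  first
  [ progress (repeat first
     [ rewrite -> src_vc by bd | rewrite -> tgt_vc by bd
     | rewrite -> src_hc by bd | rewrite -> tgt_hc by bd
     | rewrite -> dom_cmp by bd | rewrite -> cod_cmp by bd
     | rewrite -> cmp_assoc by bd ]); bd
  | rewrite ?src_idc ?tgt_idc ?dom_idm ?cod_idm ?sq_dom_s ?sq_dom_t ?sq_cod_s
      ?sq_cod_t; solve [ congruence ] ].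

Section LaxSquares.
Variable C : two_category.

Lemma lc_eqE (x : lax_square_cell C) :
  vc (sq_cell (lc_src x)) (hc (idc (sq_cod (lc_src x))) (lc_s x))
  = vc (hc (lc_t x) (idc (sq_dom (lc_src x)))) (sq_cell (lc_tgt x)).
Proof.
by case: (lc_eq x) => e1 [e2 [e3 [e4]]]; rewrite !vcompE !hcompE.
Qed.

Lemma lc_eq_intro (m n : lax_square C) (s t : cell C) :
  sq_dom m = sq_dom n -> sq_cod m = sq_cod n ->
  src s = sq_s m -> tgt s = sq_s n -> src t = sq_t m -> tgt t = sq_t n ->
  vc (sq_cell m) (hc (idc (sq_cod m)) s)
  = vc (hc t (idc (sq_dom m))) (sq_cell n) ->
  exists e1 e2 e3 e4,
    vcomp (sq_cell m) (hcomp (idc (sq_cod m)) s e1) e2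
    = vcomp (hcomp t (idc (sq_dom m)) e3) (sq_cell n) e4.
Proof.
move=> h1 h2 h3 h4 h5 h6 h.
have e1 : cod (src s) = dom (src (idc (sq_cod m))).
  by rewrite src_idc h3 sq_cod_s.
have e3 : cod (src (idc (sq_dom m))) = dom (src t).
  by rewrite src_idc h5 sq_dom_t.
have e2 : tgt (sq_cell m) = src (hcomp (idc (sq_cod m)) s e1).
  by rewrite hcompE sq_tgtE src_hc // src_idc h3.
have e4 : tgt (hcomp t (idc (sq_dom m)) e3) = src (sq_cell n).
  by rewrite hcompE sq_srcE tgt_hc // tgt_idc h6 h1.
by exists e1, e2, e3, e4; rewrite !vcompE !hcompE.
Qed.

Lemma sq_id_subproof1 (u : mor C) : is_comp (idm (cod u)) u (src (idc u)).
Proof. by apply: is_comp_cmp; rewrite ?src_idc ?cmp_idl ?dom_idm. Qed.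
Lemma sq_id_subproof2 (u : mor C) : is_comp u (idm (dom u)) (tgt (idc u)).
Proof. by apply: is_comp_cmp; rewrite ?tgt_idc ?cmp_idr ?cod_idm. Qed.
Definition sq_id (u : mor C) : lax_square C :=
  LaxSquare (sq_id_subproof1 u) (sq_id_subproof2 u).

Section SquareComp.
Variables (n m : lax_square C) (e : sq_cod m = sq_dom n).

Lemma sq_comp_s : cod (sq_s m) = dom (sq_s n).
Proof. bd. Qed.
Lemma sq_comp_t : cod (sq_t m) = dom (sq_t n).
Proof. bd. Qed.
Lemma sq_comp_l : cod (src (sq_cell m)) = dom (src (idc (sq_t n))).
Proof. bd. Qed.
Lemma sq_comp_r : cod (src (idc (sq_s m))) = dom (src (sq_cell n)).
Proof. bd. Qed.
Lemma sq_comp_v : tgt (hcomp (idc (sq_t n)) (sq_cell m) sq_comp_l)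
  = src (hcomp (sq_cell n) (idc (sq_s m)) sq_comp_r).
Proof.
rewrite !hcompE tgt_hc; first bd.
rewrite src_hc; first bd.
by rewrite src_idc tgt_idc sq_srcE sq_tgtE cmp_assoc ?e //; bd.
Qed.
End SquareComp.
End LaxSquares.

Section Whiskering.
Variable C : two_category.
Implicit Types (f g : mor C) (s t : cell C).

Lemma wl_vc g s t : tgt s = src t -> cod (src s) = dom g ->
  hc (idc g) (vc s t) = vc (hc (idc g) s) (hc (idc g) t).
Proof.
move=> e1 e2; rewrite -vc_hc ?src_idc ?tgt_idc //.
by rewrite vc_idl ?src_idc.
Qed.
Lemma wr_vc f s t : tgt s = src t -> cod f = dom (src s) ->
  hc (vc s t) (idc f) = vc (hc s (idc f)) (hc t (idc f)).
Proof.
move=> e1 e2; rewrite -vc_hc ?src_idc ?tgt_idc //.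
by rewrite vc_idl ?src_idc.
Qed.
Lemma wl_cmp g f s : cod f = dom g -> cod (src s) = dom f ->
  hc (idc (cmp g f)) s = hc (idc g) (hc (idc f) s).
Proof. by move=> e1 e2; rewrite hc_assoc ?src_idc // hc_idc. Qed.
Lemma wr_cmp g f s : cod f = dom g -> cod g = dom (src s) ->
  hc s (idc (cmp g f)) = hc (hc s (idc g)) (idc f).
Proof. by move=> e1 e2; rewrite -hc_assoc ?src_idc // hc_idc. Qed.
Lemma hc_split s t : cod (src s) = dom (src t) ->
  hc t s = vc (hc t (idc (src s))) (hc (idc (tgt t)) s).
Proof.
by move=> e; rewrite -vc_hc ?src_idc ?tgt_idc // vc_idl // vc_idr.
Qed.
Lemma hc_split' s t : cod (src s) = dom (src t) ->
  hc t s = vc (hc (idc (src t)) s) (hc t (idc (tgt s))).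
Proof.
by move=> e; rewrite -vc_hc ?src_idc ?tgt_idc // vc_idl // vc_idr.
Qed.
End Whiskering.

Section LaxSquareComposition.
Variable C : two_category.

Lemma sq_comp_src_subproof (n m : lax_square C) (e : sq_cod m = sq_dom n) :
  is_comp (comp (sq_t n) (sq_t m) (sq_comp_t e)) (sq_dom m)
    (src (vcomp (hcomp (idc (sq_t n)) (sq_cell m) (sq_comp_l e))
                (hcomp (sq_cell n) (idc (sq_s m)) (sq_comp_r e))
                (sq_comp_v e))).
Proof.
rewrite src_vcomp hcompE compE src_hc; first bd.
by apply: is_comp_cmp; rewrite ?src_idc ?sq_srcE -?cmp_assoc //; bd.
Qed.

Lemma sq_comp_tgt_subproof (n m : lax_square C) (e : sq_cod m = sq_dom n) :
  is_comp (sq_cod n) (comp (sq_s n) (sq_s m) (sq_comp_s e))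
    (tgt (vcomp (hcomp (idc (sq_t n)) (sq_cell m) (sq_comp_l e))
                (hcomp (sq_cell n) (idc (sq_s m)) (sq_comp_r e))
                (sq_comp_v e))).
Proof.
rewrite tgt_vcomp hcompE compE tgt_hc; first bd.
by apply: is_comp_cmp; rewrite ?tgt_idc ?sq_tgtE ?cmp_assoc //; bd.
Qed.

(* (s', z', t') o (s, z, t) = (s' o s, (t' o z) ; (z' o s), t' o t). *)
Definition sq_comp (n m : lax_square C) (e : sq_cod m = sq_dom n) :
  lax_square C :=
  LaxSquare (sq_comp_src_subproof e) (sq_comp_tgt_subproof e).

Definition lc_idc (m : lax_square C) : lax_square_cell C.
Proof.
refine (@LaxSquareCell C m m (idc (sq_s m)) (idc (sq_t m))
  eq_refl eq_refl (src_idc _) (tgt_idc _) (src_idc _) (tgt_idc _) _).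
apply: lc_eq_intro; rewrite ?src_idc ?tgt_idc //.
by rewrite !hc_idc ?vc_idl ?vc_idr //; bd.
Defined.

Lemma lc_vcomp_s (x y : lax_square_cell C) (e : lc_tgt x = lc_src y) :
  tgt (lc_s x) = src (lc_s y).
Proof. by rewrite lc_s_src lc_s_tgt e. Qed.
Lemma lc_vcomp_t (x y : lax_square_cell C) (e : lc_tgt x = lc_src y) :
  tgt (lc_t x) = src (lc_t y).
Proof. by rewrite lc_t_src lc_t_tgt e. Qed.

Definition lc_vcomp (x y : lax_square_cell C) (e : lc_tgt x = lc_src y) :
  lax_square_cell C.
Proof.
refine (@LaxSquareCell C (lc_src x) (lc_tgt y)
  (vcomp (lc_s x) (lc_s y) (lc_vcomp_s e))
  (vcomp (lc_t x) (lc_t y) (lc_vcomp_t e)) _ _ _ _ _ _ _).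
- by rewrite lc_sq_dom e lc_sq_dom.
- by rewrite lc_sq_cod e lc_sq_cod.
- by rewrite src_vcomp lc_s_src.
- by rewrite tgt_vcomp lc_s_tgt.
- by rewrite src_vcomp lc_t_src.
- by rewrite tgt_vcomp lc_t_tgt.
- have ex := lc_eqE x; have ey := lc_eqE y.
have es := lc_vcomp_s e; have et := lc_vcomp_t e.
have d1 := lc_sq_dom x; have d2 := lc_sq_dom y.
have c1 := lc_sq_cod x; have c2 := lc_sq_cod y.
apply: lc_eq_intro; rewrite ?src_vcomp ?tgt_vcomp ?lc_s_src ?lc_s_tgt
  ?lc_t_src ?lc_t_tgt //; try congruence.
rewrite !vcompE wl_vc ?wr_vc //; [bd|bd|].
rewrite -vc_assoc; [bd|bd|].
rewrite ex vc_assoc; [bd|bd|].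
rewrite e c1 e ey -vc_assoc; [bd|bd|].
by rewrite d1 e.
Defined.

Section LcHcomp.
Variables (y x : lax_square_cell C).
Hypothesis e : sq_cod (lc_src x) = sq_dom (lc_src y).

Lemma lc_hcomp_s : cod (src (lc_s x)) = dom (src (lc_s y)).
Proof. bd. Qed.
Lemma lc_hcomp_t : cod (src (lc_t x)) = dom (src (lc_t y)).
Proof. bd. Qed.
Lemma lc_hcomp_tgt : sq_cod (lc_tgt x) = sq_dom (lc_tgt y).
Proof. by rewrite -lc_sq_cod -lc_sq_dom. Qed.

Definition lc_hcomp : lax_square_cell C.
Proof.
refine (@LaxSquareCell C (sq_comp e) (sq_comp lc_hcomp_tgt)
  (hcomp (lc_s y) (lc_s x) lc_hcomp_s)
  (hcomp (lc_t y) (lc_t x) lc_hcomp_t) _ _ _ _ _ _ _);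
  have e' := lc_hcomp_tgt; have ex := lc_eqE x; have ey := lc_eqE y;
  have d1 := lc_sq_dom x; have d2 := lc_sq_dom y;
  have c1 := lc_sq_cod x; have c2 := lc_sq_cod y.
- exact: d1.
- exact: c2.
- by rewrite hcompE /= compE src_hc ?lc_s_src //; bd.
- by rewrite hcompE /= compE tgt_hc ?lc_s_tgt //; bd.
- by rewrite hcompE /= compE src_hc ?lc_t_src //; bd.
- by rewrite hcompE /= compE tgt_hc ?lc_t_tgt //; bd.
- apply: lc_eq_intro.
+ exact: d1.
+ exact: c2.
+ by rewrite hcompE /= compE src_hc ?lc_s_src //; bd.
+ by rewrite hcompE /= compE tgt_hc ?lc_s_tgt //; bd.
+ by rewrite hcompE /= compE src_hc ?lc_t_src //; bd.
+ by rewrite hcompE /= compE tgt_hc ?lc_t_tgt //; bd.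
+ rewrite /= !vcompE !hcompE vc_assoc; [bd|bd|].
rewrite (hc_assoc (t := idc (sq_cod (lc_src y)))); [bd|bd|].
rewrite -(vc_hc (t := sq_cell (lc_src y))); [bd|bd|bd|].
rewrite ey vc_idl; first bd.
rewrite -{1}(vc_idr (f := sq_s (lc_tgt x)) (s := lc_s x)); first bd.
rewrite vc_hc; [bd|bd|bd|].
rewrite -vc_assoc; [bd|bd|].
rewrite -(hc_assoc (t := lc_t y)); [bd|bd|].
rewrite -(vc_hc (s := sq_cell (lc_src x))); [bd|bd|bd|].
rewrite -e ex vc_idl; first bd.
rewrite -{1}(vc_idr (f := sq_t (lc_tgt y)) (s := lc_t y)); first bd.
rewrite vc_hc; [bd|bd|bd|].
rewrite vc_assoc; [bd|bd|].
by rewrite hc_assoc //; bd.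
Defined.
End LcHcomp.

End LaxSquareComposition.

Section LaxArrowCategory.
Variable C : two_category.

Lemma sq_cell_comp (n m : lax_square C) (e : sq_cod m = sq_dom n) :
  sq_cell (sq_comp e)
  = vc (hc (idc (sq_t n)) (sq_cell m)) (hc (sq_cell n) (idc (sq_s m))).
Proof. by rewrite /= vcompE !hcompE. Qed.

Lemma sq_comp_congr (n m n' m' : lax_square C) (e : sq_cod m = sq_dom n)
  (e' : sq_cod m' = sq_dom n') : n = n' -> m = m' -> sq_comp e = sq_comp e'.
Proof.
by move=> en em; move: e e'; rewrite en em => e e';
   rewrite (proof_irrelevance _ e e').
Qed.

Lemma sq_comp_idl (b : mor C) (f : lax_square C)
  (e : sq_cod f = sq_dom (sq_id b)) : sq_comp e = f.
Proof.
have eb : sq_cod f = b := e.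
apply: sq_ext; rewrite ?sq_cell_comp /=; first by [].
- by symmetry.
- by rewrite compE cmp_idl //; bd.
- by rewrite compE cmp_idl //; bd.
- rewrite hc_idl; first bd.
  by rewrite hc_idc; [bd | rewrite vc_idr //; bd].
Qed.

Lemma sq_comp_idr (f : lax_square C) (b : mor C)
  (e : sq_cod (sq_id b) = sq_dom f) : sq_comp e = f.
Proof.
have eb : b = sq_dom f := e.
apply: sq_ext; rewrite ?sq_cell_comp /=; [by []|by []|..].
- by rewrite compE cmp_idr //; bd.
- by rewrite compE cmp_idr //; bd.
- rewrite hc_idr; first bd.
  by rewrite hc_idc; [bd | rewrite vc_idl //; bd].
Qed.

Lemma sq_comp_assoc (p n m : lax_square C) (e1 : sq_cod m = sq_dom n)
  (e3 : sq_cod n = sq_dom p) (e2 : sq_cod (sq_comp e1) = sq_dom p)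
  (e4 : sq_cod m = sq_dom (sq_comp e3)) : sq_comp e2 = sq_comp e4.
Proof.
have h1 : sq_cod m = sq_dom n := e1.
have h2 : sq_cod n = sq_dom p := e2.
apply: sq_ext => //; rewrite ?sq_cell_comp /= ?vcompE ?hcompE ?compE.
- by rewrite cmp_assoc //; bd.
- by rewrite cmp_assoc //; bd.
- rewrite wl_vc; [bd|bd|].
  rewrite wr_vc; [bd|bd|].
  rewrite wl_cmp; [bd|bd|].
  rewrite wr_cmp; [bd|bd|].
  rewrite vc_assoc; [bd|bd|].
  by rewrite (hc_assoc (t := idc (sq_t p)) (s := sq_cell n)) //; bd.
Qed.

(* The lax arrow 2-category C^2. *)
Definition arrow : two_category.
Proof.
refine (@TwoCategory (mor C) (lax_square C) (lax_square_cell C)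
  (@sq_dom C) (@sq_cod C) (@lc_src C) (@lc_tgt C) _ _
  (@sq_id C) (@sq_comp C) (@lc_idc C) (@lc_vcomp C)
  (fun y x e => @lc_hcomp C y x e)
  _ _ _ _ _ _ _ _ _ _ _ _ _ _ _ _ _ _ _ _ _).
- exact: lc_sq_dom.
- exact: lc_sq_cod.
- by [].
- by [].
- by [].
- by [].
- by [].
- by [].
- by [].
- by [].
- by move=> y x e e'; apply: sq_comp_congr.
- by move=> y x e e'; apply: sq_comp_congr.
- exact: sq_comp_idl.
- exact: sq_comp_idr.
- by move=> *; apply: sq_comp_assoc.
- by move=> f s e; apply: lc_ext => //=; rewrite ?vcomp_idl.
- by move=> s f e; apply: lc_ext => //=; rewrite ?vcomp_idr.
- by move=> r s t e1 e2 e3 e4; apply: lc_ext => //=; apply: vcomp_assoc.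
- move=> b s e; apply: lc_ext => /=; try exact: sq_comp_idl.
  + by rewrite hcomp_idl.
  + by rewrite hcomp_idl.
- move=> s b e; apply: lc_ext => /=; try exact: sq_comp_idr.
  + by rewrite hcomp_idr.
  + by rewrite hcomp_idr.
- move=> t s r e1 e2 e3 e4; apply: lc_ext => /=; try exact: sq_comp_assoc.
  + exact: hcomp_assoc.
  + exact: hcomp_assoc.
- move=> g f e e'; apply: lc_ext => /=; try exact: sq_comp_congr.
  + exact: hcomp_idc.
  + exact: hcomp_idc.
- move=> t t' s s' e1 e2 e3 e4 e5 e6; apply: lc_ext => /=;
    try exact: sq_comp_congr.
  + exact: interchange.
  + exact: interchange.
Defined.

Definition arrow_src : two_functor arrow C.
Proof.
refine (@TwoFunctor arrow C dom (@sq_s C) (@lc_s C) _ _ _ _ _ _ _ _ _).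
- exact: sq_dom_s.
- exact: sq_cod_s.
- exact: lc_s_src.
- exact: lc_s_tgt.
- by [].
- by move=> *; apply: comp_congr.
- by [].
- by move=> *; apply: vcomp_congr.
- by move=> *; apply: hcomp_congr.
Defined.

Definition arrow_tgt : two_functor arrow C.
Proof.
refine (@TwoFunctor arrow C cod (@sq_t C) (@lc_t C) _ _ _ _ _ _ _ _ _).
- exact: sq_dom_t.
- exact: sq_cod_t.
- exact: lc_t_src.
- exact: lc_t_tgt.
- by [].
- by move=> *; apply: comp_congr.
- by [].
- by move=> *; apply: vcomp_congr.
- by move=> *; apply: hcomp_congr.
Defined.

Lemma unit_sq_src_subproof (s : mor C) :
  is_comp s (idm (dom s)) (src (idc s)).
Proof. by apply: is_comp_cmp; rewrite ?cod_idm // src_idc cmp_idr. Qed.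
Lemma unit_sq_tgt_subproof (s : mor C) :
  is_comp (idm (cod s)) s (tgt (idc s)).
Proof. by apply: is_comp_cmp; rewrite ?dom_idm // tgt_idc cmp_idl. Qed.
Definition unit_sq (s : mor C) : lax_square C :=
  LaxSquare (unit_sq_src_subproof s) (unit_sq_tgt_subproof s).

Definition unit_cell (s : cell C) : lax_square_cell C.
Proof.
refine (@LaxSquareCell C (unit_sq (src s)) (unit_sq (tgt s)) s s
  _ _ _ _ _ _ _) => //=.
- by rewrite dom_src.
- by rewrite cod_src.
- apply: (@lc_eq_intro C (unit_sq (src s)) (unit_sq (tgt s))) => //=;
    rewrite ?dom_src ?cod_src //.
  rewrite -cod_src -dom_src hc_idl // hc_idr // vc_idl //.
  by rewrite vc_idr.
Defined.

Lemma unit_sq_comp (g f : mor C) (e : cod f = dom g)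
  (e' : sq_cod (unit_sq f) = sq_dom (unit_sq g)) :
  unit_sq (comp g f e) = sq_comp e'.
Proof.
apply: sq_ext; rewrite /= ?dom_comp ?cod_comp //; try exact: comp_congr.
by rewrite vcompE !hcompE compE !hc_idc ?vc_idl ?src_idc.
Qed.

(* The unit a |-> (a, id_a, a) of the internal category C^2. *)
Definition arrow_unit : two_functor C arrow.
Proof.
refine (@TwoFunctor C arrow idm unit_sq unit_cell _ _ _ _ _ _ _ _ _) => //.
- by move=> a; apply: sq_ext; rewrite /= ?dom_idm ?cod_idm.
- by move=> g f e e'; apply: unit_sq_comp.
- by move=> f; apply: lc_ext; rewrite /= ?src_idc ?tgt_idc.
- move=> s t e e'; apply: lc_ext; rewrite /= ?src_vcomp ?tgt_vcomp //;
    exact: vcomp_congr.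
- move=> t s e e'; apply: lc_ext => /=; try exact: hcomp_congr.
  + have e1 : cod (src s) = dom (src t) := e.
    by rewrite (src_hcomp _ e1); apply: unit_sq_comp.
  + have e1 : cod (tgt s) = dom (tgt t) by rewrite -cod_src -dom_src.
    by rewrite (tgt_hcomp _ e1); apply: unit_sq_comp.
Defined.

Section ArrowComp.

Definition composable_arrows : two_category := pullback arrow_tgt arrow_src.

Definition ca_ob (x : ob composable_arrows) : mor C :=
  comp (snd (proj1_sig x)) (fst (proj1_sig x)) (proj2_sig x).

Section Pasting.
(* m = (r, z, s) : u0 -> u1 and n = (s, y, t) : v0 -> v1. *)
Variables (m n : lax_square C) (e : sq_t m = sq_s n).

Lemma paste_dom : cod (sq_dom m) = dom (sq_dom n).
Proof. by rewrite -sq_dom_t -sq_dom_s e. Qed.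
Lemma paste_cod : cod (sq_cod m) = dom (sq_cod n).
Proof. by rewrite -sq_cod_t -sq_cod_s e. Qed.
Lemma paste_l : cod (src (idc (sq_dom m))) = dom (src (sq_cell n)).
Proof. have := paste_dom; bd. Qed.
Lemma paste_r : cod (src (sq_cell m)) = dom (src (idc (sq_cod n))).
Proof. have := paste_cod; bd. Qed.
Lemma paste_v : tgt (hcomp (sq_cell n) (idc (sq_dom m)) paste_l)
  = src (hcomp (idc (sq_cod n)) (sq_cell m) paste_r).
Proof. have h1 := paste_dom; have h2 := paste_cod; rewrite !hcompE; bd. Qed.

Definition paste_cell : cell C :=
  vcomp (hcomp (sq_cell n) (idc (sq_dom m)) paste_l)
        (hcomp (idc (sq_cod n)) (sq_cell m) paste_r) paste_v.

Lemma paste_cellE : paste_cell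
  = vc (hc (sq_cell n) (idc (sq_dom m))) (hc (idc (sq_cod n)) (sq_cell m)).
Proof. by rewrite /paste_cell vcompE !hcompE. Qed.

Lemma paste_src_subproof :
  is_comp (sq_t n) (comp (sq_dom n) (sq_dom m) paste_dom) (src paste_cell).
Proof.
have h1 := paste_dom; have h2 := paste_cod.
by rewrite paste_cellE compE; apply: is_comp_cmp; bd.
Qed.
Lemma paste_tgt_subproof :
  is_comp (comp (sq_cod n) (sq_cod m) paste_cod) (sq_s m) (tgt paste_cell).
Proof.
have h1 := paste_dom; have h2 := paste_cod.
by rewrite paste_cellE compE; apply: is_comp_cmp; bd.
Qed.

(* (r, (y o u0) ; (v1 o z), t). *)
Definition paste : lax_square C :=
  LaxSquare paste_src_subproof paste_tgt_subproof.
End Pasting.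

Lemma paste_congr (m n m' n' : lax_square C) (e : sq_t m = sq_s n)
  (e' : sq_t m' = sq_s n') : m = m' -> n = n' -> paste e = paste e'.
Proof.
by move=> em en; move: e e'; rewrite en em => e e';
   rewrite (proof_irrelevance _ e e').
Qed.

Lemma paste_sq_id (u v : mor C) (e : sq_t (sq_id u) = sq_s (sq_id v))
  (e' : cod u = dom v) : paste e = sq_id (comp v u e').
Proof.
apply: sq_ext; rewrite /= ?dom_comp ?cod_comp //; try exact: comp_congr.
by rewrite paste_cellE /= !hc_idc // vc_idl ?src_idc // compE.
Qed.

Lemma paste_sq_comp (m m' n n' : lax_square C)
  (em : sq_cod m = sq_dom m') (en : sq_cod n = sq_dom n')
  (e : sq_t m = sq_s n) (e' : sq_t m' = sq_s n')
  (ec : sq_t (sq_comp em) = sq_s (sq_comp en))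
  (ep : sq_cod (paste e) = sq_dom (paste e')) :
  paste ec = sq_comp ep.
Proof.
have h1 := paste_dom e; have h2 := paste_cod e.
have h3 := paste_dom e'; have h4 := paste_cod e'.
apply: sq_ext; rewrite ?sq_cell_comp /=; try exact: comp_congr.
rewrite !paste_cellE /= !vcompE !hcompE.
rewrite (wr_vc (f := sq_dom m)); [bd|bd|].
rewrite (wl_vc (g := sq_cod n')); [bd|bd|].
rewrite (wl_vc (g := sq_t n')); [bd|bd|].
rewrite (wr_vc (f := sq_s m)); [bd|bd|].
rewrite !vc_assoc; [bd|bd|bd|bd|].
rewrite -(hc_assoc (t := idc (sq_t n')) (s := sq_cell n)); [bd|bd|].
rewrite (hc_assoc (t := idc (sq_cod n')) (s := sq_cell m')); [bd|bd|].
congr (vc _ _); rewrite -!vc_assoc; [bd|bd|bd|bd|].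
congr (vc _ _).
have ez : cod (src (sq_cell m)) = dom (src (sq_cell n')) by bd.
transitivity (hc (sq_cell n') (sq_cell m)).
- rewrite (hc_split ez) sq_srcE sq_tgtE wl_cmp; [bd|bd|].
  by rewrite wr_cmp; [bd|bd|]; rewrite e e'.
- rewrite (hc_split' ez) sq_srcE sq_tgtE wl_cmp; [bd|bd|].
  by rewrite wr_cmp; [bd|bd|]; rewrite em en.
Qed.

Section PasteCell.
Variables (x y : lax_square_cell C) (e : lc_t x = lc_s y).

Lemma paste_lc_src : sq_t (lc_src x) = sq_s (lc_src y).
Proof. by rewrite -lc_t_src -lc_s_src e. Qed.
Lemma paste_lc_tgt : sq_t (lc_tgt x) = sq_s (lc_tgt y).
Proof. by rewrite -lc_t_tgt -lc_s_tgt e. Qed.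

Definition paste_lc : lax_square_cell C.
Proof.
refine (@LaxSquareCell C (paste paste_lc_src) (paste paste_lc_tgt)
  (lc_s x) (lc_t y) _ _ _ _ _ _ _).
- by apply: comp_congr; apply: lc_sq_dom.
- by apply: comp_congr; apply: lc_sq_cod.
- exact: lc_s_src.
- exact: lc_s_tgt.
- exact: lc_t_src.
- exact: lc_t_tgt.
- apply: lc_eq_intro.
  + by apply: comp_congr; apply: lc_sq_dom.
  + by apply: comp_congr; apply: lc_sq_cod.
  + exact: lc_s_src.
  + exact: lc_s_tgt.
  + exact: lc_t_src.
  + exact: lc_t_tgt.
  + have h0 := paste_lc_src; have h1 := paste_lc_tgt.
    have h2 := paste_dom h0; have h3 := paste_cod h0.
    have h4 := paste_dom h1; have h5 := paste_cod h1.
    have d1 := lc_sq_dom x; have d2 := lc_sq_dom y.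
    have c1 := lc_sq_cod x; have c2 := lc_sq_cod y.
    have ex := lc_eqE x; have ey := lc_eqE y.
    rewrite /= !paste_cellE !compE wl_cmp; [bd|bd|].
    rewrite wr_cmp; [bd|bd|].
    rewrite vc_assoc; [bd|bd|].
    rewrite -(wl_vc (s := sq_cell (lc_src x))); [bd|bd|].
    rewrite ex wl_vc; [bd|bd|].
    rewrite -d1 -c2 e -vc_assoc; [bd|bd|].
    rewrite hc_assoc; [bd|bd|].
    rewrite -wr_vc; [bd|bd|].
    rewrite ey wr_vc; [bd|bd|].
    by rewrite vc_assoc //; bd.
Defined.
End PasteCell.

Lemma paste_lc_congr (m n m' n' : lax_square_cell C) (e : lc_t m = lc_s n)
  (e' : lc_t m' = lc_s n') : m = m' -> n = n' -> paste_lc e = paste_lc e'.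
Proof.
by move=> em en; move: e e'; rewrite em en => e e';
   rewrite (proof_irrelevance _ e e').
Qed.

(* The composition (a, u, b, v, c) |-> (a, v o u, c) of the internal
   category C^2, defined on the pullback C^2 x_C C^2. *)
Definition arrow_comp : two_functor composable_arrows arrow.
Proof.
refine (@TwoFunctor composable_arrows arrow ca_ob
  (fun x => paste (proj2_sig x)) (fun x => paste_lc (proj2_sig x))
  _ _ _ _ _ _ _ _ _).
- by move=> f; apply: comp_congr.
- by move=> f; apply: comp_congr.
- by move=> s; apply: paste_congr.
- by move=> s; apply: paste_congr.
- by move=> a; apply: paste_sq_id.
- by move=> g f e e'; apply: paste_sq_comp.
- by move=> f; apply: lc_ext => //=; apply: paste_congr.
- by move=> s t e e'; apply: lc_ext => /=;
    [apply: paste_congr | apply: paste_congr | apply: vcomp_congr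
    | apply: vcomp_congr].
- by move=> t s e e'; apply: lc_ext => /=;
    [apply: paste_sq_comp | apply: paste_sq_comp | apply: hcomp_congr
    | apply: hcomp_congr].
Defined.
End ArrowComp.
End LaxArrowCategory.

Section PullbackMaps.

Lemma functor_comp_id (X Y : two_category) (F : two_functor X Y) :
  F \of functor_id X =2f F.
Proof. by split. Qed.

Section Map.
Variables (X Y Z X' Y' : two_category)
  (F : two_functor X Z) (G : two_functor Y Z)
  (F' : two_functor X' Z) (G' : two_functor Y' Z)
  (H : two_functor X X') (K : two_functor Y Y')
  (eH : F' \of H =2f F) (eK : G' \of K =2f G).

Lemma pb_map_subproof :
  F' \of (H \of pb_pr1 F G) =2f G' \of (K \of pb_pr2 F G).
Proof.
split=> x.
- exact: (eq_trans (eq_fo eH _)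
    (eq_trans (proj2_sig x) (eq_sym (eq_fo eK _)))).
- exact: (eq_trans (eq_fm eH _)
    (eq_trans (proj2_sig x) (eq_sym (eq_fm eK _)))).
- exact: (eq_trans (eq_fc eH _)
    (eq_trans (proj2_sig x) (eq_sym (eq_fc eK _)))).
Qed.

Definition pb_map : two_functor (pullback F G) (pullback F' G') :=
  pb_pair pb_map_subproof.

End Map.

Section Assoc.
Variables (X Y V Z W : two_category)
  (F : two_functor X Z) (G : two_functor Y Z)
  (H : two_functor Y W) (K : two_functor V W).

Lemma pb_assoc_subproof1 :
  H \of (pb_pr2 F G \of pb_pr1 (H \of pb_pr2 F G) K)
  =2f K \of pb_pr2 (H \of pb_pr2 F G) K.
Proof. by split=> x; apply: (proj2_sig x). Qed.

Lemma pb_assoc_subproof2 :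
  F \of (pb_pr1 F G \of pb_pr1 (H \of pb_pr2 F G) K)
  =2f (G \of pb_pr1 H K) \of pb_pair pb_assoc_subproof1.
Proof. by split=> x; apply: (proj2_sig (fst (proj1_sig x))). Qed.

(* The isomorphism (X x_Z Y) x_W V -> X x_Z (Y x_W V). *)
Definition pb_assoc :
  two_functor (pullback (H \of pb_pr2 F G) K)
              (pullback F (G \of pb_pr1 H K)) :=
  pb_pair pb_assoc_subproof2.

End Assoc.

End PullbackMaps.

Section Cleavages.

(* The data of a cleavage of q: [cl_mor R e] is rho(i, u) : i -> u_! i for
   e : q i = dom u, and [cl_cell R e] is rho(b, s) : b^* s => s for
   e : tgt b = q s. *)
Record cleavage (J B : two_category) (q : two_functor J B) : Type := Cleavage {
  cl_mor : forall (i : ob J) (u : mor B), fo q i = dom u -> mor J;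
  cl_cell : forall (b : cell B) (s : mor J), tgt b = fm q s -> cell J
}.

Section Op2Fibration.
Variables (J B : two_category) (q : two_functor J B) (R : cleavage q).

Definition push i u (e : fo q i = dom u) : ob J := cod (cl_mor R e).
Definition pull b s (e : tgt b = fm q s) : mor J := src (cl_cell R e).

Definition om_lift i u (e : fo q i = dom u) (s : mor J) (v : mor B)
    (w : mor J) : Prop :=
  dom w = push e /\ cod w = cod s /\ fm q w = v /\ is_comp w (cl_mor R e) s.

Record split_op2fibration : Prop := SplitOp2Fibration {
  cl_mor_dom : forall i u (e : fo q i = dom u), dom (cl_mor R e) = i;
  cl_mor_over : forall i u (e : fo q i = dom u), fm q (cl_mor R e) = u;
  cl_cell_tgt : forall b s (e : tgt b = fm q s), tgt (cl_cell R e) = s;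
  cl_cell_over : forall b s (e : tgt b = fm q s), fc q (cl_cell R e) = b;

  cl_mor_comp : forall i u v (e : fo q i = dom u) (e' : cod u = dom v)
      (e1 : fo q i = dom (comp v u e')) (e2 : fo q (push e) = dom v) e3,
    cl_mor R e1 = comp (cl_mor R e2) (cl_mor R e) e3;
  cl_mor_id : forall i (e : fo q i = dom (idm (fo q i))),
    cl_mor R e = idm i;
  cl_cell_vcomp : forall b c s (e : tgt b = fm q s) (e' : tgt c = src b)
      (e1 : tgt (vcomp c b e') = fm q s) (e2 : tgt c = fm q (pull e)) e3,
    cl_cell R e1 = vcomp (cl_cell R e2) (cl_cell R e) e3;
  cl_cell_hcomp : forall b d s t (eb : tgt b = fm q s) (ed : tgt d = fm q t)
      (e : cod s = dom t) (e' : cod (src b) = dom (src d))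
      (e1 : tgt (hcomp d b e') = fm q (comp t s e)) e2,
    cl_cell R e1 = hcomp (cl_cell R ed) (cl_cell R eb) e2;
  cl_cell_id : forall s (e : tgt (idc (fm q s)) = fm q s),
    cl_cell R e = idc s;

  cl_om1 : forall i u (e : fo q i = dom u) (s : mor J) (v : mor B),
    dom s = i -> is_comp v u (fm q s) -> exists! w, om_lift e s v w;
  cl_om2 : forall i u (e : fo q i = dom u) (x : cell J) (b : cell B),
    dom (src x) = i -> is_hcomp b (idc u) (fc q x) ->
    forall v w, om_lift e (src x) (src b) v -> om_lift e (tgt x) (tgt b) w ->
    exists! y, src y = v /\ tgt y = w /\ fc q y = b
      /\ is_hcomp y (idc (cl_mor R e)) x;
  cl_cc : forall b s (e : tgt b = fm q s) (x : cell J) (a : cell B),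
    tgt x = s -> is_vcomp a b (fc q x) ->
    exists! y, src y = src x /\ tgt y = pull e /\ fc q y = a
      /\ is_vcomp y (cl_cell R e) x
}.

End Op2Fibration.

Section Co2Fibration.
Variables (J A : two_category) (p : two_functor J A).

Definition co_cleavage : Type := cleavage (functor_coop p).

Definition split_co2fibration (L : co_cleavage) : Prop := split_op2fibration L.

Variable L : co_cleavage.

(* lambda(u, i) : u^* i -> i and lambda(s, a) : s => a_! s. *)
Definition co_mor u i (e : fo p i = cod u) : mor J :=
  @cl_mor _ _ (functor_coop p) L i u e.
Definition co_cell s a (e : src a = fm p s) : cell J :=
  @cl_cell _ _ (functor_coop p) L a s e.
Definition co_pull u i (e : fo p i = cod u) : ob J := dom (co_mor e).
Definition co_push s a (e : src a = fm p s) : mor J := tgt (co_cell e).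

End Co2Fibration.

Section TwoSided.
Variables (A B J : two_category) (p : two_functor J A) (q : two_functor J B).

(* In ts_cl and ts_cc the equations giving meaning to the iterated lifts hold
   by verticality. *)
Record two_sided_cleavage (L : co_cleavage p) (R : cleavage q) : Prop :=
  TwoSidedCleavage {
  ts_f : split_co2fibration L;
  ts_o : split_op2fibration R;
  ts_v_lmor : forall i u (e : fo p i = cod u),
    fm q (co_mor L e) = idm (fo q i);
  ts_v_lcell : forall s a (e : src a = fm p s),
    fc q (co_cell L e) = idc (fm q s);
  ts_v_rmor : forall j v (e : fo q j = dom v),
    fm p (cl_mor R e) = idm (fo p j);
  ts_v_rcell : forall t b (e : tgt b = fm q t),
    fc p (cl_cell R e) = idc (fm p t);
  ts_cl : forall i u v (eu : fo p i = cod u) (ev : fo q i = dom v)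
      (ev' : fo q (co_pull L eu) = dom v) (eu' : fo p (push R ev) = cod u),
    push R ev' = co_pull L eu'
    /\ exists e1 e2, comp (cl_mor R ev) (co_mor L eu) e1
                     = comp (co_mor L eu') (cl_mor R ev') e2;
  ts_cc : forall s a b (ea : src a = fm p s) (eb : tgt b = fm q s)
      (ea' : src a = fm p (pull R eb)) (eb' : tgt b = fm q (co_push L ea)),
    co_push L ea' = pull R eb'
    /\ exists e1 e2, vcomp (cl_cell R eb) (co_cell L ea) e1
                     = vcomp (co_cell L ea') (cl_cell R eb') e2
}.

End TwoSided.

End Cleavages.

Section Internal.
Variables (A B J : two_category) (p : two_functor J A) (q : two_functor J B).

Lemma arrow_comp_tgt (C : two_category) :
  arrow_tgt C \of arrow_comp C
  =2f arrow_tgt C \of pb_pr2 (arrow_tgt C) (arrow_src C).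
Proof. by split=> x //=; apply: cod_comp. Qed.

Lemma arrow_comp_src (C : two_category) :
  arrow_src C \of arrow_comp C
  =2f arrow_src C \of pb_pr1 (arrow_tgt C) (arrow_src C).
Proof. by split=> x //=; apply: dom_comp. Qed.

Lemma unit_left_subproof :
  arrow_tgt A \of (arrow_unit A \of p) =2f p \of functor_id J.
Proof. by split=> x //=; apply: cod_idm. Qed.

Lemma unit_right_subproof :
  q \of functor_id J =2f arrow_src B \of (arrow_unit B \of q).
Proof. by split=> x //=; rewrite dom_idm. Qed.

(* The 2-categories A^2 x_A J and J x_B B^2. *)
Definition left_pb : two_category := pullback (arrow_tgt A) p.
Definition right_pb : two_category := pullback q (arrow_src B).

Record internal_two_sided_fibration
    (lam : two_functor left_pb J) (rho : two_functor right_pb J) : Prop :=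
  InternalTwoSidedFibration {
  lam_src : p \of lam =2f arrow_src A \of pb_pr1 (arrow_tgt A) p;
  lam_q : q \of lam =2f q \of pb_pr2 (arrow_tgt A) p;
  rho_p : p \of rho =2f p \of pb_pr1 q (arrow_src B);
  rho_tgt : q \of rho =2f arrow_tgt B \of pb_pr2 q (arrow_src B);

  lam_assoc :
    lam \of pb_map (arrow_comp_tgt A) (functor_comp_id p)
    =2f lam \of pb_map (functor_comp_id (arrow_tgt A)) lam_src
          \of pb_assoc (arrow_tgt A) (arrow_src A) (arrow_tgt A) p;
  lam_unit : lam \of pb_pair unit_left_subproof =2f functor_id J;

  rho_assoc :
    rho \of pb_map (functor_comp_id q) (arrow_comp_src B)
        \of pb_assoc q (arrow_src B) (arrow_tgt B) (arrow_src B)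
    =2f rho \of pb_map rho_tgt (functor_comp_id (arrow_src B));
  rho_unit : rho \of pb_pair unit_right_subproof =2f functor_id J;

  lam_rho :
    rho \of pb_map lam_q (functor_comp_id (arrow_src B))
    =2f lam \of pb_map (functor_comp_id (arrow_tgt A)) rho_p
          \of pb_assoc (arrow_tgt A) p q (arrow_src B)
}.

End Internal.

Section InducedCleavages.

Section Squares.
Variable C : two_category.

(* For u : a -> b, the squares (id_a, id_u, u) : id_a -> u and
   (u, id_u, id_b) : u -> id_b. *)
Lemma from_id_src_subproof (u : mor C) :
  is_comp u (idm (dom u)) (src (idc u)).
Proof. by apply: is_comp_cmp; rewrite ?cod_idm // src_idc cmp_idr. Qed.
Lemma from_id_tgt_subproof (u : mor C) :
  is_comp u (idm (dom u)) (tgt (idc u)).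
Proof. by rewrite tgt_idc -{3}(src_idc u); apply: from_id_src_subproof. Qed.
Definition from_id (u : mor C) : lax_square C :=
  LaxSquare (from_id_src_subproof u) (from_id_tgt_subproof u).

Lemma to_id_tgt_subproof (u : mor C) :
  is_comp (idm (cod u)) u (tgt (idc u)).
Proof. by apply: is_comp_cmp; rewrite ?dom_idm // tgt_idc cmp_idl. Qed.
Lemma to_id_src_subproof (u : mor C) :
  is_comp (idm (cod u)) u (src (idc u)).
Proof. by rewrite src_idc -{3}(tgt_idc u); apply: to_id_tgt_subproof. Qed.
Definition to_id (u : mor C) : lax_square C :=
  LaxSquare (to_id_src_subproof u) (to_id_tgt_subproof u).

(* For b : t => s, the square (s, b, t) between identities. *)
Lemma cell_sq_src_subproof (b : cell C) :
  is_comp (src b) (idm (dom (src b))) (src b).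
Proof. by apply: is_comp_cmp; rewrite ?cod_idm // cmp_idr. Qed.
Lemma cell_sq_tgt_subproof (b : cell C) :
  is_comp (idm (cod (src b))) (tgt b) (tgt b).
Proof. by rewrite cod_src; apply: is_comp_cmp; rewrite ?dom_idm // cmp_idl. Qed.
Definition cell_sq (b : cell C) : lax_square C :=
  LaxSquare (cell_sq_src_subproof b) (cell_sq_tgt_subproof b).

(* (id_s, b) : (s, b, t) => (s, id_s, s). *)
Definition to_unit_cell (b : cell C) : lax_square_cell C.
Proof.
refine (@LaxSquareCell C (cell_sq b) (unit_sq (tgt b)) (idc (tgt b)) b
  _ _ _ _ _ _ _); rewrite /= ?dom_src ?cod_src ?src_idc ?tgt_idc //.
apply: (@lc_eq_intro C (cell_sq b) (unit_sq (tgt b)));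
  rewrite /= ?dom_src ?cod_src ?src_idc ?tgt_idc //.
rewrite hc_idl ?src_idc // -dom_src hc_idr //.
Defined.

(* (b, id_t) : (t, id_t, t) => (s, b, t). *)
Definition from_unit_cell (b : cell C) : lax_square_cell C.
Proof.
refine (@LaxSquareCell C (unit_sq (src b)) (cell_sq b) b (idc (src b))
  _ _ _ _ _ _ _); rewrite /= ?src_idc ?tgt_idc //.
apply: (@lc_eq_intro C (unit_sq (src b)) (cell_sq b));
  rewrite /= ?src_idc ?tgt_idc //.
by rewrite hc_idl // hc_idr // src_idc.
Defined.

End Squares.

Variables (A B J : two_category) (p : two_functor J A) (q : two_functor J B).

Lemma right_mor_subproof i (u : mor B) :
  fo q i = dom u -> fm q (idm i) = fm (arrow_src B) (from_id u).
Proof. by move=> e; rewrite fm_idm e. Qed.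
Lemma right_cell_subproof (b : cell B) s :
  tgt b = fm q s -> fc q (idc s) = fc (arrow_src B) (to_unit_cell b).
Proof. by move=> e; rewrite fc_idc -e. Qed.

(* rho(i, u) := rho(id_i, (id_{q i}, id_u, u)) and
   rho(b, s) := rho(id_s, (id_{q s}, b)). *)
Definition right_cleavage (rho : two_functor (right_pb q) J) : cleavage q :=
  @Cleavage J B q
    (fun i u e => fm rho (exist _ (idm i, from_id u) (right_mor_subproof e)))
    (fun b s e =>
       fc rho (exist _ (idc s, to_unit_cell b) (right_cell_subproof e))).

Lemma left_mor_subproof i (u : mor A) :
  fo p i = cod u -> fm (arrow_tgt A) (to_id u) = fm p (idm i).
Proof. by move=> e; rewrite fm_idm e. Qed.
Lemma left_cell_subproof (a : cell A) s :
  src a = fm p s -> fc (arrow_tgt A) (from_unit_cell a) = fc p (idc s).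
Proof. by move=> e; rewrite fc_idc -e. Qed.

(* lambda(u, i) := lambda((u, id_u, id_{p i}), id_i) and
   lambda(s, a) := lambda((a, id_{p s}), id_s). *)
Definition left_cleavage (lam : two_functor (left_pb p) J) : co_cleavage p :=
  @Cleavage (coop J) (coop A) (functor_coop p)
    (fun (i : ob J) (u : mor A) (e : fo p i = cod u) =>
       fm lam (exist _ (to_id u, idm i) (left_mor_subproof e)))
    (fun (a : cell A) (s : mor J) (e : src a = fm p s) =>
       fc lam (exist _ (from_unit_cell a, idc s) (left_cell_subproof e))).

End InducedCleavages.

Definition cleavage_eq (J B : two_category) (q : two_functor J B)
    (R R' : cleavage q) : Prop :=
  (forall i u (e : fo q i = dom u), cl_mor R e = cl_mor R' e)
  /\ (forall b s (e : tgt b = fm q s), cl_cell R e = cl_cell R' e).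

(* Main.v *)
From Corelib Require Import ssreflect.
From Stdlib Require Import ProofIrrelevance ClassicalEpsilon.
From Stdlib Require Import FunctionalExtensionality.
Require Import Defs.

(**
  A right action rho of the lax arrow 2-category of B is the same thing as a
  coherent choice of lifts, that is, a split op-2-fibration.

  From the action to the lifts, the lift of u at i is the value of rho at
  id_i and the degenerate square (id, id_u, u), and cell lifts are defined in
  the same way.  Their universal properties come from the associativity and
  unit laws.  The degenerate squares (id, id_u, u) and (u, id_u, id) paste to
  an identity, so that rho takes the lift of u together with (u, id_u, id) to
  an identity ([rho_lift_mor_to_id]).  A morphism w out of u_! i is therefore
  recovered from its composite with the lift by applying rho, which is the
  uniqueness in (om1) and (om2); evaluating rho at the same squares gives the
  existence.  Condition (cc) is obtained in the same way from
  [rho_lift_cell_from_unit].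

  From the lifts to the action, the value at f : i0 -> i1 and a square
  (q f, z, t) from u0 to u1 is forced: it is the morphism over t whose
  composite with the lift of u0 is the pullback along z of the composite of f
  with the lift of u1.  It exists by (om1), and cells are treated by (cc)
  followed by (om2).  As values are characterized by an equation ([act_morE],
  [act_cellE]), each law of an action reduces to checking this equation, and
  this follows from the compatibility of the cleavage with compositions.

  The left action reduces to the right action.  Reversing morphisms and cells
  turns the lax arrow 2-category of A into that of the reversed A, with the
  source and target projections exchanged ([co_sq], [co_lc]), so a left action
  for p is a right action for the reversed p.  Verticality of the cleavages
  says that each action is a map of spans.

  It remains to see that the two actions commute exactly when the lifts for p
  and for q do, that is, when (cl) and its analogue for cell lifts hold.
    If they commute, both sides of (cl) are the value of rho at a lift
  for p and a degenerate square, computed from the two trivial factorizations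
  of that square ([actions_cl], [actions_cc]).  Conversely, to identify
  rho(lam(m, f), n) with lam(m, rho(f, n)) one checks that the former satisfies
  the equation that characterizes values of lam.  Lifts for q can be
  cancelled, and after composing with them the equation compares the two ways
  of lifting one morphism successively for p and for q, which agree by
  hypothesis ([cross_square], [act_coact_mor]); for cells the same comparison
  appears on two faces of a cube ([cube], [act_coact_cell]).
*)

Set Implicit Arguments.
Unset Strict Implicit.
Unset Printing Implicit Defensive.

(** * Lifts as total functions *)

Section Composability.
Variable C : two_category.
Implicit Types s t r : cell C.

Lemma is_vcompP s t r :
  is_vcomp s t r -> tgt s = src t /\ r = vc s t.
Proof. by case=> e <-; rewrite vcompE. Qed.
Lemma is_vcomp_vc s t r :
  tgt s = src t -> vc s t = r -> is_vcomp s t r.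
Proof. by move=> e <-; exists e; rewrite vcompE. Qed.
Lemma is_hcompP t s r :
  is_hcomp t s r -> cod (src s) = dom (src t) /\ r = hc t s.
Proof. by case=> e <-; rewrite hcompE. Qed.
Lemma is_hcomp_hc t s r :
  cod (src s) = dom (src t) -> hc t s = r -> is_hcomp t s r.
Proof. by move=> e <-; exists e; rewrite hcompE. Qed.
End Composability.

Section TotalCleavage.
Variables (J B : two_category) (q : two_functor J B) (R : cleavage q).

(** Total versions of the lifts: the value off the domain of the cleavage
    is arbitrary, so that a lift can be rewritten without carrying the
    proof that it is defined. *)
Definition lift_mor (i : ob J) (u : mor B) : mor J :=
  match excluded_middle_informative (fo q i = dom u) with
  | left e => cl_mor R e
  | right _ => idm i
  end.
Definition lift_cell (b : cell B) (s : mor J) : cell J :=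
  match excluded_middle_informative (tgt b = fm q s) with
  | left e => cl_cell R e
  | right _ => idc s
  end.

Lemma lift_morE i u (e : fo q i = dom u) : cl_mor R e = lift_mor i u.
Proof.
rewrite /lift_mor; case: excluded_middle_informative => [e'|//].
by rewrite (proof_irrelevance _ e e').
Qed.
Lemma lift_cellE b s (e : tgt b = fm q s) : cl_cell R e = lift_cell b s.
Proof.
rewrite /lift_cell; case: excluded_middle_informative => [e'|//].
by rewrite (proof_irrelevance _ e e').
Qed.

Hypothesis H : split_op2fibration R.

Lemma dom_lift_mor i u : fo q i = dom u -> dom (lift_mor i u) = i.
Proof. by move=> e; rewrite -(lift_morE e) cl_mor_dom. Qed.
Lemma fm_lift_mor i u : fo q i = dom u -> fm q (lift_mor i u) = u.
Proof. by move=> e; rewrite -(lift_morE e) cl_mor_over. Qed.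
Lemma fo_cod_lift_mor i u : fo q i = dom u -> fo q (cod (lift_mor i u)) = cod u.
Proof. by move=> e; rewrite -fm_cod fm_lift_mor. Qed.
Lemma tgt_lift_cell b s : tgt b = fm q s -> tgt (lift_cell b s) = s.
Proof. by move=> e; rewrite -(lift_cellE e) cl_cell_tgt. Qed.
Lemma fc_lift_cell b s : tgt b = fm q s -> fc q (lift_cell b s) = b.
Proof. by move=> e; rewrite -(lift_cellE e) cl_cell_over. Qed.
Lemma dom_src_lift_cell b s : tgt b = fm q s ->
  dom (src (lift_cell b s)) = dom s.
Proof. by move=> e; rewrite dom_src tgt_lift_cell. Qed.
Lemma cod_src_lift_cell b s : tgt b = fm q s ->
  cod (src (lift_cell b s)) = cod s.
Proof. by move=> e; rewrite cod_src tgt_lift_cell. Qed.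
Lemma fm_src_lift_cell b s : tgt b = fm q s ->
  fm q (src (lift_cell b s)) = src b.
Proof. by move=> e; rewrite -fc_src fc_lift_cell. Qed.

Lemma lift_mor_cmp i u v : fo q i = dom u -> cod u = dom v ->
  lift_mor i (cmp v u) = cmp (lift_mor (cod (lift_mor i u)) v) (lift_mor i u).
Proof.
move=> e e'.
have e1 : fo q i = dom (comp v u e') by rewrite dom_comp.
have e2 : fo q (push R e) = dom v.
  by rewrite /push lift_morE fo_cod_lift_mor.
have e3 : cod (cl_mor R e) = dom (cl_mor R e2) by rewrite cl_mor_dom.
have := cl_mor_comp H e1 e3.
by rewrite (compE e3) !lift_morE (compE e') /push lift_morE.
Qed.
Lemma lift_mor_id i a : a = fo q i -> lift_mor i (idm a) = idm i.
Proof.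
move=> ->; have e : fo q i = dom (idm (fo q i)) by rewrite dom_idm.
by rewrite -(lift_morE e) cl_mor_id.
Qed.
Lemma lift_cell_vc b c s : tgt b = fm q s -> tgt c = src b ->
  lift_cell (vc c b) s = vc (lift_cell c (src (lift_cell b s))) (lift_cell b s).
Proof.
move=> e e'.
have e1 : tgt (vcomp c b e') = fm q s by rewrite tgt_vcomp.
have e2 : tgt c = fm q (pull R e).
  by rewrite /pull lift_cellE fm_src_lift_cell.
have e3 : tgt (cl_cell R e2) = src (cl_cell R e) by rewrite cl_cell_tgt.
have := cl_cell_vcomp H e1 e3.
by rewrite (vcompE e3) !lift_cellE (vcompE e') /pull lift_cellE.
Qed.
Lemma lift_cell_hc b d s t : tgt b = fm q s -> tgt d = fm q t ->
  cod s = dom t ->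
  lift_cell (hc d b) (cmp t s) = hc (lift_cell d t) (lift_cell b s).
Proof.
move=> eb ed e.
have e' : cod (src b) = dom (src d).
  by rewrite cod_src dom_src eb ed fm_cod fm_dom e.
have e1 : tgt (hcomp d b e') = fm q (comp t s e).
  by rewrite hcompE tgt_hc // compE fm_cmp // eb ed.
have e2 : cod (src (cl_cell R eb)) = dom (src (cl_cell R ed)).
  by rewrite cod_src dom_src !cl_cell_tgt.
have := cl_cell_hcomp H e1 e2.
by rewrite (hcompE e2) !lift_cellE (hcompE e') (compE e).
Qed.
Lemma lift_cell_id s f : f = fm q s -> lift_cell (idc f) s = idc s.
Proof.
move=> ->; have e : tgt (idc (fm q s)) = fm q s by rewrite tgt_idc.
by rewrite -(lift_cellE e) cl_cell_id.
Qed.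
Lemma lift_cell_wl b s t f : tgt b = fm q s -> f = fm q t -> cod s = dom t ->
  hc (idc t) (lift_cell b s) = lift_cell (hc (idc f) b) (cmp t s).
Proof.
move=> eb -> e; rewrite lift_cell_hc ?tgt_idc // lift_cell_id //.
Qed.
Lemma lift_cell_wr d s t f : tgt d = fm q t -> f = fm q s -> cod s = dom t ->
  hc (lift_cell d t) (idc s) = lift_cell (hc d (idc f)) (cmp t s).
Proof.
move=> eb -> e; rewrite lift_cell_hc ?tgt_idc // lift_cell_id //.
Qed.

Lemma om1_ex i u s v : fo q i = dom u -> dom s = i -> cod u = dom v ->
  cmp v u = fm q s ->
  exists w, dom w = cod (lift_mor i u) /\ cod w = cod s /\ fm q w = v
    /\ cmp w (lift_mor i u) = s.
Proof.
move=> e ds e1 e2.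
case: (cl_om1 H e ds (is_comp_cmp e1 e2)) => w [[h1 [h2 [h3 h4]]] _].
rewrite /push lift_morE in h1; case: (is_compP h4) => _.
by rewrite lift_morE => es; exists w.
Qed.
(** The two morphisms are lifts of the same factorization of the image of
    [cmp w (lift_mor i u)], so (om1) identifies them. *)
Lemma om1_inj i u w w' : fo q i = dom u ->
  dom w = cod (lift_mor i u) -> dom w' = cod (lift_mor i u) ->
  cod w = cod w' -> fm q w = fm q w' ->
  cmp w (lift_mor i u) = cmp w' (lift_mor i u) -> w = w'.
Proof.
move=> e d d' c eq ec.
have hd : dom (cmp w (lift_mor i u)) = i by rewrite dom_cmp // dom_lift_mor.
have hc : is_comp (fm q w) u (fm q (cmp w (lift_mor i u))).
  apply: is_comp_cmp; last by rewrite fm_cmp // fm_lift_mor.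
  by rewrite fm_dom d fo_cod_lift_mor.
have hl : forall x, dom x = cod (lift_mor i u) -> cod x = cod w ->
    fm q x = fm q w -> cmp x (lift_mor i u) = cmp w (lift_mor i u) ->
    om_lift R e (cmp w (lift_mor i u)) (fm q w) x.
  move=> x dx cx qx ex; split; first by rewrite /push lift_morE.
  split; first by rewrite cod_cmp.
  by split=> //; rewrite lift_morE; apply: is_comp_cmp.
case: (cl_om1 H e hd hc) => z [_ uz].
by transitivity z; [symmetry|]; apply: uz; apply: hl.
Qed.

Lemma om2_hyp i u x b : fo q i = dom u -> dom (src x) = i ->
  cod u = dom (src b) -> hc b (idc u) = fc q x ->
  is_hcomp b (idc u) (fc q x).
Proof. by move=> *; apply: is_hcomp_hc; rewrite ?src_idc. Qed.
Lemma om2_ex i u x b v w : fo q i = dom u -> dom (src x) = i ->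
  cod u = dom (src b) -> hc b (idc u) = fc q x ->
  dom v = cod (lift_mor i u) -> cod v = cod (src x) -> fm q v = src b ->
  cmp v (lift_mor i u) = src x ->
  dom w = cod (lift_mor i u) -> cod w = cod (src x) -> fm q w = tgt b ->
  cmp w (lift_mor i u) = tgt x ->
  exists y, src y = v /\ tgt y = w /\ fc q y = b
    /\ hc y (idc (lift_mor i u)) = x.
Proof.
move=> e e1 e2 e3 v1 v2 v3 v4 w1 w2 w3 w4.
case: (cl_om2 H (e := e) e1 (om2_hyp e e1 e2 e3) (v := v) (w := w)).
- split; first by rewrite /push lift_morE.
  by split=> //; split=> //; rewrite lift_morE; apply: is_comp_cmp.
- split; first by rewrite /push lift_morE.
  split; first by rewrite -cod_src.
  by split=> //; rewrite lift_morE; apply: is_comp_cmp.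
- move=> y [[h1 [h2 [h3 h4]]] _]; exists y; split=> //; split=> //; split=> //.
  by case: (is_hcompP h4) => _ ->; rewrite lift_morE.
Qed.
Lemma om2_inj i u y y' : fo q i = dom u -> src y = src y' -> tgt y = tgt y' ->
  fc q y = fc q y' -> dom (src y) = cod (lift_mor i u) ->
  hc y (idc (lift_mor i u)) = hc y' (idc (lift_mor i u)) -> y = y'.
Proof.
move=> e es et eq d eh.
set l := lift_mor i u in d eh.
have dl : dom l = i by apply: dom_lift_mor.
have ql : fm q l = u by apply: fm_lift_mor.
have c : cod (src (idc l)) = dom (src y) by rewrite src_idc.
have c' : cod l = dom (tgt y) by rewrite -d dom_src.
set x := hc y (idc l).
have sx : src x = cmp (src y) l by rewrite /x src_hc // src_idc.
have tx : tgt x = cmp (tgt y) l by rewrite /x tgt_hc // tgt_idc.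
have e1 : dom (src x) = i by rewrite sx dom_cmp.
have e2 : is_hcomp (fc q y) (idc u) (fc q x).
  apply: is_hcomp_hc.
    by rewrite src_idc fc_src fm_dom d /l fo_cod_lift_mor.
  by rewrite /x fc_hc // fc_idc ql.
have hv : om_lift R e (src x) (src (fc q y)) (src y).
  split; first by rewrite /push lift_morE.
  split; first by rewrite sx cod_cmp.
  split; first by rewrite fc_src.
  by rewrite lift_morE; apply: is_comp_cmp.
have hw : om_lift R e (tgt x) (tgt (fc q y)) (tgt y).
  split; first by rewrite /push lift_morE -dom_src.
  split; first by rewrite tx cod_cmp.
  split; first by rewrite fc_tgt.
  by rewrite lift_morE; apply: is_comp_cmp.
case: (cl_om2 H e1 e2 hv hw) => z [_ uz].
transitivity z; [symmetry|]; apply: uz.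
- split=> //; split=> //; split=> //.
  by rewrite lift_morE; apply: is_hcomp_hc.
- split=> //; split=> //; split=> //.
  rewrite lift_morE; apply: is_hcomp_hc; first by rewrite src_idc -es.
  by rewrite -eh.
Qed.

Lemma cc_ex b s x a : tgt b = fm q s -> tgt x = s -> tgt a = src b ->
  vc a b = fc q x ->
  exists y, src y = src x /\ tgt y = src (lift_cell b s) /\ fc q y = a
    /\ vc y (lift_cell b s) = x.
Proof.
move=> e e1 e2 e3.
case: (cl_cc H e e1 (is_vcomp_vc e2 e3)) => y [[h1 [h2 [h3 h4]]] _].
exists y; rewrite /pull lift_cellE in h2; split=> //; split=> //; split=> //.
by case: (is_vcompP h4) => _ ->; rewrite lift_cellE.
Qed.
Lemma cc_inj b s y y' : tgt b = fm q s -> src y = src y' ->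
  tgt y = src (lift_cell b s) -> tgt y' = src (lift_cell b s) ->
  fc q y = fc q y' -> vc y (lift_cell b s) = vc y' (lift_cell b s) -> y = y'.
Proof.
move=> e es et et' eq ev.
have e1 : tgt (vc y (lift_cell b s)) = s by rewrite tgt_vc // tgt_lift_cell.
have e2 : is_vcomp (fc q y) b (fc q (vc y (lift_cell b s))).
  apply: is_vcomp_vc; first by rewrite fc_tgt et fm_src_lift_cell.
  by rewrite fc_vc // fc_lift_cell.
have sv : src (vc y (lift_cell b s)) = src y by rewrite src_vc.
case: (cl_cc H e e1 e2) => z [_ uz].
transitivity z; [symmetry|]; apply: uz; rewrite sv /pull lift_cellE.
- by split=> //; split=> //; split=> //; apply: is_vcomp_vc.
- by split=> //; split=> //; split=> //; apply: is_vcomp_vc.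
Qed.

End TotalCleavage.

(** * The values of the action of a cleavage *)

Section ActionOfCleavage.
Variables (J B : two_category) (q : two_functor J B) (R : cleavage q).
Hypothesis H : split_op2fibration R.

Notation rho1 := (lift_mor R).
Notation rho2 := (lift_cell R).

(** The composite of f with the lift at its codomain lies over the target
    of the cell of m; this is the morphism that gets pulled back along that
    cell. *)
Definition comp_lift (f : mor J) (m : lax_square B) : mor J :=
  cmp (rho1 (cod f) (sq_cod m)) f.

(** The only possible value at (q f, z, t) of an action with this cleavage.
    Its composite with the lift of u0 is the value at the square (q f, z, t
    o u0) from an identity to u1, and an action computes that one as the
    pullback along z of f followed by the lift of u1. *)
Definition act_mor_spec (f : mor J) (m : lax_square B) (w : mor J) : Prop :=
  dom w = cod (rho1 (dom f) (sq_dom m))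
  /\ cod w = cod (rho1 (cod f) (sq_cod m))
  /\ fm q w = sq_t m
  /\ cmp w (rho1 (dom f) (sq_dom m)) = src (rho2 (sq_cell m) (comp_lift f m)).

Definition act_mor f m : mor J := epsilon (inhabits f) (act_mor_spec f m).

Section Mor.
Variables (f : mor J) (m : lax_square B).
Hypothesis e : fm q f = sq_s m.

Lemma over_dom : fo q (dom f) = dom (sq_dom m).
Proof. by rewrite -fm_dom e sq_dom_s. Qed.
Lemma over_cod : fo q (cod f) = dom (sq_cod m).
Proof. by rewrite -fm_cod e sq_cod_s. Qed.
Lemma comp_lift_composable : cod f = dom (rho1 (cod f) (sq_cod m)).
Proof. by rewrite (dom_lift_mor H over_cod). Qed.
Lemma dom_comp_lift : dom (comp_lift f m) = dom f.
Proof. by rewrite dom_cmp // -comp_lift_composable. Qed.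
Lemma cod_comp_lift : cod (comp_lift f m) = cod (rho1 (cod f) (sq_cod m)).
Proof. by rewrite cod_cmp // -comp_lift_composable. Qed.
Lemma fm_comp_lift : tgt (sq_cell m) = fm q (comp_lift f m).
Proof.
by rewrite sq_tgtE fm_cmp -?comp_lift_composable // (fm_lift_mor H over_cod) e.
Qed.

(** Pulling back along the cell of m gives a morphism over t o u0, which
    (om1) factors through the lift over u0. *)
Lemma act_mor_ex : exists w, act_mor_spec f m w.
Proof.
have eo := over_dom; have ec := over_cod; have ea := fm_comp_lift.
case: (om1_ex H (s := src (rho2 (sq_cell m) (comp_lift f m))) (v := sq_t m) eo).
- by rewrite (dom_src_lift_cell H ea) dom_comp_lift.
- by rewrite sq_dom_t.
- by rewrite (fm_src_lift_cell H ea) sq_srcE.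
- move=> w [h1 [h2 [h3 h4]]]; exists w; split=> //; split=> //.
  by rewrite h2 (cod_src_lift_cell H ea) cod_comp_lift.
Qed.

Lemma act_mor_uniq w w' : act_mor_spec f m w -> act_mor_spec f m w' -> w = w'.
Proof.
move=> [h1 [h2 [h3 h4]]] [k1 [k2 [k3 k4]]].
by apply: (om1_inj H over_dom) => //; congruence.
Qed.

Lemma act_morP : act_mor_spec f m (act_mor f m).
Proof. exact: epsilon_spec act_mor_ex. Qed.

Lemma act_morE w : act_mor_spec f m w -> w = act_mor f m.
Proof. by move=> h; apply: act_mor_uniq h act_morP. Qed.

Lemma dom_act_mor : dom (act_mor f m) = cod (rho1 (dom f) (sq_dom m)).
Proof. by case: act_morP. Qed.
Lemma cod_act_mor : cod (act_mor f m) = cod (rho1 (cod f) (sq_cod m)).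
Proof. by case: act_morP => _ []. Qed.
Lemma fm_act_mor : fm q (act_mor f m) = sq_t m.
Proof. by case: act_morP => _ [_ []]. Qed.
Lemma act_mor_lift : cmp (act_mor f m) (rho1 (dom f) (sq_dom m))
  = src (rho2 (sq_cell m) (comp_lift f m)).
Proof. by case: act_morP => _ [_ []]. Qed.
Lemma act_mor_lift_composable : cod (rho1 (dom f) (sq_dom m))
  = dom (act_mor f m).
Proof. by rewrite dom_act_mor. Qed.
End Mor.

(** Naturality of the lifts of the cells of squares: the equation that ties
    the value at (q s, t) to its boundary squares. *)
Definition act_cell_spec (s : cell J) (x : lax_square_cell B) (y : cell J) :
    Prop :=
  src y = act_mor (src s) (lc_src x)
  /\ tgt y = act_mor (tgt s) (lc_tgt x)
  /\ fc q y = lc_t x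
  /\ vc (hc y (idc (rho1 (dom (src s)) (sq_dom (lc_src x)))))
        (rho2 (sq_cell (lc_tgt x)) (comp_lift (tgt s) (lc_tgt x)))
     = vc (rho2 (sq_cell (lc_src x)) (comp_lift (src s) (lc_src x)))
          (hc (idc (rho1 (cod (src s)) (sq_cod (lc_src x)))) s).

Definition act_cell s x : cell J := epsilon (inhabits s) (act_cell_spec s x).

Section Cell.
Variables (s : cell J) (x : lax_square_cell B).
Hypothesis e : fc q s = lc_s x.

Lemma over_src : fm q (src s) = sq_s (lc_src x).
Proof. by rewrite -fc_src e lc_s_src. Qed.
Lemma over_tgt : fm q (tgt s) = sq_s (lc_tgt x).
Proof. by rewrite -fc_tgt e lc_s_tgt. Qed.

Let l0 := rho1 (dom (src s)) (sq_dom (lc_src x)).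
Let l1 := rho1 (cod (src s)) (sq_cod (lc_src x)).

(** The lift of the first cell followed by s lies over z0 ; (u1 o q s) = (t
    o u0) ; z1, so (cc) factors it through the lift of z1, and (om2)
    factors the result through the lift over u0. *)
Lemma act_cell_ex : exists y, act_cell_spec s x y.
Proof.
have e0 := over_src; have e1 := over_tgt.
have dl1 : dom l1 = cod (src s) by rewrite /l1 -comp_lift_composable.
have cs : cod (src s) = dom (src (idc l1)) by rewrite src_idc.
have a0 : comp_lift (src s) (lc_src x) = cmp l1 (src s) by [].
have a1 : comp_lift (tgt s) (lc_tgt x) = cmp l1 (tgt s).
  by rewrite /comp_lift /l1 -cod_src -lc_sq_cod.
have d0 : dom (src s) = dom (tgt s) by apply: dom_src.
set z0 := rho2 (sq_cell (lc_src x)) (comp_lift (src s) (lc_src x)).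
set z1 := rho2 (sq_cell (lc_tgt x)) (comp_lift (tgt s) (lc_tgt x)).
have tz0 : tgt z0 = cmp l1 (src s)
  by rewrite (tgt_lift_cell H (fm_comp_lift e0)).
have sh : src (hc (idc l1) s) = cmp l1 (src s) by rewrite src_hc // src_idc.
have th : tgt (hc (idc l1) s) = cmp l1 (tgt s) by rewrite tgt_hc // tgt_idc.
have ql1 : fm q l1 = sq_cod (lc_src x) by apply: (fm_lift_mor H (over_cod e0)).
have ql0 : fo q (dom (src s)) = dom (sq_dom (lc_src x)) := over_dom e0.
have dom0 : dom (src (lc_t x)) = cod (sq_dom (lc_src x)).
  by rewrite lc_t_src sq_dom_t.
have sw : tgt (hc (lc_t x) (idc (sq_dom (lc_src x))))
  = src (sq_cell (lc_tgt x)).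
  by rewrite tgt_hc ?src_idc ?tgt_idc // lc_t_tgt sq_srcE lc_sq_dom.
case: (cc_ex H (x := vc z0 (hc (idc l1) s))
   (a := hc (lc_t x) (idc (sq_dom (lc_src x)))) (fm_comp_lift e1)) => //.
- by rewrite tgt_vc ?sh // th a1.
- rewrite fc_vc ?sh // (fc_lift_cell H (fm_comp_lift e0)).
  by rewrite fc_hc // fc_idc ql1 e lc_eqE.
- move=> y [h1 [h2 [h3 h4]]].
rewrite src_vc ?sh // in h1.
have h2' : tgt y = cmp (act_mor (tgt s) (lc_tgt x)) l0.
  by rewrite h2 -act_mor_lift // /l0 d0 lc_sq_dom.
have h1' : src y = cmp (act_mor (src s) (lc_src x)) l0.
  by rewrite h1 /z0 -act_mor_lift.
have cy : cod (src y) = cod (act_mor (src s) (lc_src x)).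
  by rewrite h1' cod_cmp // act_mor_lift_composable.
case: (om2_ex H (x := y) (b := lc_t x) (v := act_mor (src s) (lc_src x))
  (w := act_mor (tgt s) (lc_tgt x)) ql0).
+ by rewrite h1 (dom_src_lift_cell H (fm_comp_lift e0)) dom_comp_lift.
+ by rewrite dom0.
+ by [].
+ by rewrite dom_act_mor.
+ by [].
+ by rewrite fm_act_mor // lc_t_src.
+ by rewrite h1'.
+ by rewrite dom_act_mor // -d0 lc_sq_dom.
+ by rewrite cy !cod_act_mor // cod_src lc_sq_cod.
+ by rewrite fm_act_mor // lc_t_tgt.
+ by rewrite h2'.
+ move=> w [k1 [k2 [k3 k4]]]; exists w.
by split=> //; split=> //; split=> //; rewrite k4.
Qed.

(** Existence read backwards: (om2) cancels the lift of u0, then (cc)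
    cancels the lift of z1. *)
Lemma act_cell_uniq y y' : act_cell_spec s x y -> act_cell_spec s x y' ->
  y = y'.
Proof.
move=> [h1 [h2 [h3 h4]]] [k1 [k2 [k3 k4]]].
have e0 := over_src; have e1 := over_tgt.
have d0 : dom (src s) = dom (tgt s) by apply: dom_src.
have dy : cod l0 = dom (src y) by rewrite h1 act_mor_lift_composable.
have dy' : cod l0 = dom (src y') by rewrite k1 act_mor_lift_composable.
have tc : cmp (act_mor (tgt s) (lc_tgt x)) l0
    = src (rho2 (sq_cell (lc_tgt x)) (comp_lift (tgt s) (lc_tgt x))).
  by rewrite -act_mor_lift // /l0 d0 lc_sq_dom.
apply: (om2_inj H (over_dom e0));
  [congruence|congruence|congruence|by rewrite -dy|].
apply: (cc_inj H (fm_comp_lift e1)).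
- by rewrite !src_hc ?src_idc // h1 k1.
- by rewrite tgt_hc ?src_idc // h2 tgt_idc.
- by rewrite tgt_hc ?src_idc // k2 tgt_idc.
- by rewrite !fc_hc ?src_idc // h3 k3.
- by rewrite h4 k4.
Qed.

Lemma act_cellP : act_cell_spec s x (act_cell s x).
Proof. exact: epsilon_spec act_cell_ex. Qed.
Lemma act_cellE y : act_cell_spec s x y -> y = act_cell s x.
Proof. by move=> h; apply: act_cell_uniq h act_cellP. Qed.
Lemma src_act_cell : src (act_cell s x) = act_mor (src s) (lc_src x).
Proof. by case: act_cellP. Qed.
Lemma tgt_act_cell : tgt (act_cell s x) = act_mor (tgt s) (lc_tgt x).
Proof. by case: act_cellP => _ []. Qed.
Lemma fc_act_cell : fc q (act_cell s x) = lc_t x.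
Proof. by case: act_cellP => _ [_ []]. Qed.
Lemma act_cell_lift :
  vc (hc (act_cell s x) (idc (rho1 (dom (src s)) (sq_dom (lc_src x)))))
     (rho2 (sq_cell (lc_tgt x)) (comp_lift (tgt s) (lc_tgt x)))
  = vc (rho2 (sq_cell (lc_src x)) (comp_lift (src s) (lc_src x)))
       (hc (idc (rho1 (cod (src s)) (sq_cod (lc_src x)))) s).
Proof. by case: act_cellP => _ [_ []]. Qed.
End Cell.

End ActionOfCleavage.

(** * Functoriality of the action of a cleavage *)

(** Discharges boundary side conditions, also unfolding the boundaries that
    hypotheses give as composites. *)
Ltac bnd := idtac;
  rewrite ?src_idc ?tgt_idc ?dom_idm ?cod_idm;
  first
  [ solve [ congruence ]
  | progress (repeat first
     [ match goal with
       | h : src ?z = cmp _ _ |- context [src ?z] => rewrite h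
       | h : tgt ?z = cmp _ _ |- context [tgt ?z] => rewrite h
       end
     | rewrite -> src_vc by bnd | rewrite -> tgt_vc by bnd
     | rewrite -> src_hc by bnd | rewrite -> tgt_hc by bnd
     | rewrite -> dom_cmp by bnd | rewrite -> cod_cmp by bnd
     | rewrite -> cmp_assoc by bnd ]); bnd ].

Section SquareHcomp.
Variable C : two_category.

(** Two naturality squares of cells, y from z0 to z1 over s and y' from z0'
    to z1' over s', combine horizontally: slide y' past the first square,
    then s past the second. *)
Lemma square_hcomp (y y' s s' z0 z1 z0' z1' : cell C) (l0 l1 l2 : mor C) :
  cod l0 = dom (src y) -> cod l1 = dom (src y') ->
  cod (src s) = dom l1 -> cod (src s') = dom l2 ->
  cod (src s) = dom (src s') -> cod (src y) = dom (src y') ->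
  src z0 = cmp (src y) l0 -> tgt z0 = cmp l1 (src s) ->
  src z1 = cmp (tgt y) l0 -> tgt z1 = cmp l1 (tgt s) ->
  src z0' = cmp (src y') l1 -> tgt z0' = cmp l2 (src s') ->
  src z1' = cmp (tgt y') l1 -> tgt z1' = cmp l2 (tgt s') ->
  vc (hc y (idc l0)) z1 = vc z0 (hc (idc l1) s) ->
  vc (hc y' (idc l1)) z1' = vc z0' (hc (idc l2) s') ->
  vc (hc (hc y' y) (idc l0))
    (vc (hc (idc (tgt y')) z1) (hc z1' (idc (tgt s))))
  = vc (vc (hc (idc (src y')) z0) (hc z0' (idc (src s))))
      (hc (idc l2) (hc s' s)).
Proof.
move=> k0 k0' k1 k1' es ey sz0 tz0 sz1 tz1 sz0' tz0' sz1' tz1' A A'.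
have h1 := dom_src y; have h2 := cod_src y.
have h3 := dom_src y'; have h4 := cod_src y'.
have h5 := dom_src s; have h6 := cod_src s.
have h7 := dom_src s'; have h8 := cod_src s'.
rewrite -hc_assoc ?src_idc //.
rewrite -vc_assoc; [bnd|bnd|].
rewrite -(vc_hc (t := y')); [bnd|bnd|bnd|].
rewrite A vc_idr //.
rewrite -{1}(vc_idl (f := src y') (s := y')) //.
rewrite vc_hc; [bnd|bnd|bnd|].
rewrite vc_assoc; [bnd|bnd|].
rewrite (hc_assoc (t := y')); [bnd|bnd|].
rewrite -(vc_hc (t := hc y' (idc l1))); [bnd|bnd|bnd|].
rewrite A' vc_idr //.
rewrite -{1}(vc_idl (f := src s) (s := s)) //.
rewrite vc_hc; [bnd|bnd|bnd|].
rewrite vc_assoc; [bnd|bnd|].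
by rewrite -hc_assoc //; bnd.
Qed.

Lemma square_vcomp (y y' s s' z0 z1 z2 : cell C) (l0 l1 : mor C) :
  cod l0 = dom (src y) -> cod (src s) = dom l1 ->
  tgt y = src y' -> tgt s = src s' ->
  tgt z0 = cmp l1 (src s) ->
  src z1 = cmp (tgt y) l0 -> tgt z1 = cmp l1 (tgt s) ->
  src z2 = cmp (tgt y') l0 ->
  vc (hc y (idc l0)) z1 = vc z0 (hc (idc l1) s) ->
  vc (hc y' (idc l0)) z2 = vc z1 (hc (idc l1) s') ->
  vc (hc (vc y y') (idc l0)) z2 = vc z0 (hc (idc l1) (vc s s')).
Proof.
move=> k0 k1 ey es tz0 sz1 tz1 sz2 A A'.
have h1 := dom_src y; have h2 := cod_src y.
have h3 := dom_src y'; have h4 := cod_src y'.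
have h5 := dom_src s; have h6 := cod_src s.
have h7 := dom_src s'; have h8 := cod_src s'.
rewrite wr_vc // vc_assoc; [bnd|bnd|].
rewrite A' -vc_assoc; [bnd|bnd|].
rewrite A vc_assoc; [bnd|bnd|].
by rewrite wl_vc.
Qed.
End SquareHcomp.

Section ActionFunctor.
Variables (J B : two_category) (q : two_functor J B) (R : cleavage q).
Hypothesis H : split_op2fibration R.

Notation rho1 := (lift_mor R).
Notation rho2 := (lift_cell R).
Notation am := (act_mor R).
Notation ac := (act_cell R).

Lemma act_mor_id i u : fo q i = dom u ->
  am (idm i) (sq_id u) = idm (cod (rho1 i u)).
Proof.
move=> e; have e' : fm q (idm i) = sq_s (sq_id u) by rewrite fm_idm e.
symmetry; apply: (act_morE H e').
split; first by rewrite !dom_idm.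
split; first by rewrite !cod_idm.
split; first by rewrite fm_idm (fo_cod_lift_mor H).
rewrite /comp_lift /= dom_idm cod_idm cmp_idl // cmp_idr ?(dom_lift_mor H) //.
by rewrite (lift_cell_id H) ?(fm_lift_mor H) // src_idc.
Qed.

Section Comp.
Variables (f f' : mor J) (m m' : lax_square B).
Hypotheses (e : fm q f = sq_s m) (e' : fm q f' = sq_s m').
Hypotheses (ef : cod f = dom f') (ec : sq_cod m = sq_dom m').

Lemma act_mor_composable : cod (am f m) = dom (am f' m').
Proof. by rewrite (cod_act_mor H e) (dom_act_mor H e') ef ec. Qed.

Lemma comp_lift_cmp : comp_lift R (cmp f' f) (sq_comp ec)
  = cmp (comp_lift R f' m') f.
Proof.
by rewrite /comp_lift cod_cmp //= cmp_assoc // (dom_lift_mor H) //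
  (over_cod e').
Qed.

Lemma act_mor_comp_lift : cmp (src (rho2 (sq_cell m') (comp_lift R f' m'))) f
  = cmp (am f' m') (comp_lift R f m).
Proof.
rewrite -(act_mor_lift H e') /comp_lift ef ec cmp_assoc //.
- by rewrite (dom_lift_mor H) // (over_dom e').
- exact: (act_mor_lift_composable H e').
Qed.

(** The cell of a composite square is a vertical composite of two
    whiskerings, and the cleavage respects vertical composition and
    whiskering; the middle boundary is identified by the property that
    characterizes [act_mor]. *)
Lemma lift_cell_sq_comp :
  rho2 (sq_cell (sq_comp ec)) (comp_lift R (cmp f' f) (sq_comp ec))
  = vc (hc (idc (am f' m')) (rho2 (sq_cell m) (comp_lift R f m)))
       (hc (rho2 (sq_cell m') (comp_lift R f' m')) (idc f)).
Proof.
have a := fm_comp_lift H e; have a' := fm_comp_lift H e'.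
have cf : cod f = dom (comp_lift R f' m') by rewrite (dom_comp_lift H e').
have ca : cod (comp_lift R f m) = dom (am f' m').
  by rewrite (cod_comp_lift H e) (dom_act_mor H e') ef ec.
have eq : hc (rho2 (sq_cell m') (comp_lift R f' m')) (idc f)
  = rho2 (hc (sq_cell m') (idc (sq_s m))) (cmp (comp_lift R f' m') f).
  by apply: (lift_cell_wr H).
have c2 : cod (src (idc f)) = dom (src (rho2 (sq_cell m') (comp_lift R f' m'))).
  by rewrite src_idc (dom_src_lift_cell H a').
have d1 : cod (src (idc (sq_s m))) = dom (src (sq_cell m')).
  by bd.
rewrite sq_cell_comp comp_lift_cmp (lift_cell_vc H).
- by rewrite tgt_hc // tgt_idc a' fm_cmp // e.
- by bd.
- rewrite -eq; congr (vc _ _).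
  rewrite src_hc // src_idc act_mor_comp_lift; symmetry; apply:
    (lift_cell_wl H) => //.
  by rewrite (fm_act_mor H e').
Qed.

Lemma act_mor_cmp : am (cmp f' f) (sq_comp ec) = cmp (am f' m') (am f m).
Proof.
have a := fm_comp_lift H e; have a' := fm_comp_lift H e'.
have cw := act_mor_composable.
have eq : fm q (cmp f' f) = sq_s (sq_comp ec).
  by rewrite fm_cmp // e e' /= compE.
symmetry; apply: (act_morE H eq); split.
  by rewrite dom_cmp // (dom_act_mor H e) dom_cmp.
split; first by rewrite cod_cmp // (cod_act_mor H e') cod_cmp.
split; first by rewrite fm_cmp // (fm_act_mor H e) (fm_act_mor H e') /= compE.
have ca : cod (comp_lift R f m) = dom (am f' m').
  by rewrite (cod_comp_lift H e) (dom_act_mor H e') ef ec.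
have c1 : cod (src (rho2 (sq_cell m) (comp_lift R f m))) = dom (am f' m').
  by rewrite (cod_src_lift_cell H a).
rewrite lift_cell_sq_comp src_vc.
- rewrite tgt_hc ?src_idc // tgt_idc (tgt_lift_cell H a).
  rewrite src_hc; last by rewrite src_idc act_mor_comp_lift.
  by rewrite src_idc (dom_src_lift_cell H a') (dom_comp_lift H e').
- rewrite src_hc ?src_idc // dom_cmp // -cmp_assoc ?(act_mor_lift H e) //.
  exact: (act_mor_lift_composable H e).
Qed.
End Comp.

Lemma act_cell_id f m : fm q f = sq_s m ->
  ac (idc f) (lc_idc m) = idc (am f m).
Proof.
move=> e; have e' : fc q (idc f) = lc_s (lc_idc m) by rewrite fc_idc e.
symmetry; apply: (act_cellE H e').
split; first by rewrite !src_idc.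
split; first by rewrite !tgt_idc.
split; first by rewrite fc_idc (fm_act_mor H e).
rewrite /= src_idc tgt_idc !hc_idc.
- exact: (act_mor_lift_composable H e).
- exact: (comp_lift_composable H e).
- rewrite vc_idl ?(act_mor_lift H e) // vc_idr // (tgt_lift_cell H) //.
  exact: (fm_comp_lift H e).
Qed.

Lemma act_cell_vc s s' x x' (ex : lc_tgt x = lc_src x') :
  fc q s = lc_s x -> fc q s' = lc_s x' -> tgt s = src s' ->
  ac (vc s s') (lc_vcomp ex) = vc (ac s x) (ac s' x').
Proof.
move=> e e' es.
have ee : fc q (vc s s') = lc_s (lc_vcomp ex).
  by rewrite fc_vc // e e' /= vcompE.
have e0 := over_src e; have e1 := over_tgt e.
have e0' := over_src e'; have e1' := over_tgt e'.
have cy : tgt (ac s x) = src (ac s' x').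
  by rewrite (tgt_act_cell H e) (src_act_cell H e') es ex.
symmetry; apply: (act_cellE H ee).
rewrite /act_cell_spec (src_vc es) (tgt_vc es).
split; first by rewrite src_vc // (src_act_cell H e).
split; first by rewrite tgt_vc // (tgt_act_cell H e').
split; first by rewrite fc_vc // (fc_act_cell H e) (fc_act_cell H e') /= vcompE.
rewrite /=.
have d : dom (src s') = dom (src s) by rewrite -es -dom_src.
have c : cod (src s') = cod (src s) by rewrite -es -cod_src.
have dq : sq_dom (lc_src x') = sq_dom (lc_src x) by rewrite -ex lc_sq_dom.
have cq : sq_cod (lc_src x') = sq_cod (lc_src x) by rewrite -ex lc_sq_cod.
set l0 := rho1 (dom (src s)) (sq_dom (lc_src x)).
set l1 := rho1 (cod (src s)) (sq_cod (lc_src x)).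
have k0 : cod l0 = dom (src (ac s x)).
  by rewrite (src_act_cell H e) (act_mor_lift_composable H e0).
have k0' : cod l0 = dom (src (ac s' x')) by rewrite -cy -dom_src.
have k1 : cod (src s) = dom l1 := comp_lift_composable H e0.
have A := act_cell_lift H e; have A' := act_cell_lift H e'.
rewrite -/l0 -/l1 in A; rewrite d c dq cq -/l0 -/l1 in A'.
have mid : rho2 (sq_cell (lc_src x')) (comp_lift R (src s') (lc_src x'))
    = rho2 (sq_cell (lc_tgt x)) (comp_lift R (tgt s) (lc_tgt x)).
  by rewrite es ex.
rewrite mid in A'.
apply: square_vcomp A A' => //.
- by rewrite (tgt_lift_cell H (fm_comp_lift H e0)).
- rewrite -(act_mor_lift H e1) (tgt_act_cell H e) -dom_src.
  by rewrite -lc_sq_dom.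
- by rewrite (tgt_lift_cell H (fm_comp_lift H e1)) /comp_lift -cod_src
  -lc_sq_cod.
- rewrite -(act_mor_lift H e1') (tgt_act_cell H e') -dom_src d.
  by rewrite -lc_sq_dom dq.
Qed.

Lemma act_cell_hc s s' x x' (ex : sq_cod (lc_src x) = sq_dom (lc_src x')) :
  fc q s = lc_s x -> fc q s' = lc_s x' -> cod (src s) = dom (src s') ->
  ac (hc s' s) (lc_hcomp ex) = hc (ac s' x') (ac s x).
Proof.
move=> e e' es.
have ee : fc q (hc s' s) = lc_s (lc_hcomp ex).
  by rewrite fc_hc // e e' /= hcompE.
have e0 := over_src e; have e1 := over_tgt e.
have e0' := over_src e'; have e1' := over_tgt e'.
have es1 : cod (tgt s) = dom (tgt s') by rewrite -cod_src -dom_src.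
have ex1 := lc_hcomp_tgt ex.
have cy : cod (src (ac s x)) = dom (src (ac s' x')).
  rewrite (src_act_cell H e) (src_act_cell H e').
  exact: (act_mor_composable e0 e0').
have eh := src_hc es; have et := tgt_hc es.
symmetry; apply: (act_cellE H ee); rewrite /act_cell_spec eh et.
split.
  by rewrite src_hc // (src_act_cell H e) (src_act_cell H e')
    (act_mor_cmp e0 e0').
split.
  by rewrite tgt_hc // (tgt_act_cell H e) (tgt_act_cell H e')
    (act_mor_cmp e1 e1').
split; first by rewrite fc_hc // (fc_act_cell H e) (fc_act_cell H e') /= hcompE.
rewrite [lc_tgt _]/= [lc_src _]/= dom_cmp // cod_cmp //.
rewrite (lift_cell_sq_comp e0 e0') // (lift_cell_sq_comp e1 e1') //.
rewrite [sq_dom _]/= [sq_cod _]/=.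
set l0 := rho1 (dom (src s)) (sq_dom (lc_src x)).
set l2 := rho1 (cod (src s')) (sq_cod (lc_src x')).
set l1 := rho1 (cod (src s)) (sq_cod (lc_src x)).
have l1E : l1 = rho1 (dom (src s')) (sq_dom (lc_src x')) by rewrite /l1 es ex.
have A := act_cell_lift H e; have A' := act_cell_lift H e'.
rewrite -/l0 -/l1 in A; rewrite -l1E -/l2 in A'.
set z0 := rho2 (sq_cell (lc_src x)) _ in A *.
set z1 := rho2 (sq_cell (lc_tgt x)) _ in A *.
set z0' := rho2 (sq_cell (lc_src x')) _ in A' *.
set z1' := rho2 (sq_cell (lc_tgt x')) _ in A' *.
set y := ac s x in A cy *; set y' := ac s' x' in A' cy *.
rewrite -(src_act_cell H e') -(tgt_act_cell H e') -/y'.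
have k0 : cod l0 = dom (src y).
  by rewrite (src_act_cell H e) (act_mor_lift_composable H e0).
have k0' : cod l1 = dom (src y').
  by rewrite l1E (src_act_cell H e') (act_mor_lift_composable H e0').
have k1 : cod (src s) = dom l1 := comp_lift_composable H e0.
have k1' : cod (src s') = dom l2 := comp_lift_composable H e0'.
have tz0 : tgt z0 = cmp l1 (src s).
  by rewrite (tgt_lift_cell H (fm_comp_lift H e0)).
have tz0' : tgt z0' = cmp l2 (src s').
  by rewrite (tgt_lift_cell H (fm_comp_lift H e0')).
have sz1 : src z1 = cmp (tgt y) l0.
  rewrite -(act_mor_lift H e1) (tgt_act_cell H e) -dom_src.
  by rewrite -lc_sq_dom.
have sz1' : src z1' = cmp (tgt y') l1.
  rewrite -(act_mor_lift H e1') (tgt_act_cell H e') -dom_src.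
  by rewrite -lc_sq_dom l1E.
have sz0 : src z0 = cmp (src y) l0.
  by rewrite -(act_mor_lift H e0) (src_act_cell H e).
have sz0' : src z0' = cmp (src y') l1.
  by rewrite -(act_mor_lift H e0') (src_act_cell H e') -l1E.
have tz1 : tgt z1 = cmp l1 (tgt s).
  by rewrite (tgt_lift_cell H (fm_comp_lift H e1)) /comp_lift -cod_src
    -lc_sq_cod.
have tz1' : tgt z1' = cmp l2 (tgt s').
  by rewrite (tgt_lift_cell H (fm_comp_lift H e1')) /comp_lift -cod_src
    -lc_sq_cod.
apply: square_hcomp A A' => //.
Qed.
End ActionFunctor.

(** * Associativity, unit and verticality of the action of a cleavage *)

Section SquarePaste.
Variable C : two_category.

(** Naturality squares combine along a shared side w: whisker the one for y
    by l0 and the one for w by k1. *)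
Lemma square_paste (y w s z0 z1 z0' z1' : cell C) (l0 l1 m0 k1 : mor C) :
  cod l0 = dom (src w) -> cod (src s) = dom l1 ->
  cod l0 = dom m0 -> cod m0 = dom (src y) -> cod l1 = dom k1 ->
  cod (src w) = dom k1 ->
  src z0 = cmp (src w) l0 -> tgt z0 = cmp l1 (src s) ->
  src z1 = cmp (tgt w) l0 -> tgt z1 = cmp l1 (tgt s) ->
  src z0' = cmp (src y) m0 -> tgt z0' = cmp k1 (src w) ->
  src z1' = cmp (tgt y) m0 -> tgt z1' = cmp k1 (tgt w) ->
  vc (hc w (idc l0)) z1 = vc z0 (hc (idc l1) s) ->
  vc (hc y (idc m0)) z1' = vc z0' (hc (idc k1) w) ->
  vc (hc y (idc (cmp m0 l0)))
    (vc (hc z1' (idc l0)) (hc (idc k1) z1))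
  = vc (vc (hc z0' (idc l0)) (hc (idc k1) z0)) (hc (idc (cmp k1 l1)) s).
Proof.
move=> c1 c2 c3 c4 c5 c6 sz0 tz0 sz1 tz1 sz0' tz0' sz1' tz1' A A'.
have h1 := dom_src y; have h2 := cod_src y.
have h3 := dom_src w; have h4 := cod_src w.
have h5 := dom_src s; have h6 := cod_src s.
rewrite wr_cmp // wl_cmp; [bnd|bnd|].
rewrite -vc_assoc; [bnd|bnd|].
rewrite -wr_vc; [bnd|bnd|].
rewrite A' wr_vc; [bnd|bnd|].
rewrite !vc_assoc; [bnd|bnd|bnd|bnd|].
rewrite -(hc_assoc (t := idc k1) (s := w)); [bnd|bnd|].
rewrite -!wl_vc; [bnd|bnd|bnd|bnd|].
by rewrite A.
Qed.
End SquarePaste.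

Section RightAction.
Variables (J B : two_category) (q : two_functor J B).

(** The part of the structure of an internal two-sided fibration that
    concerns q alone. *)
Record right_action (rho : two_functor (right_pb q) J) : Prop := RightAction {
  ra_tgt : q \of rho =2f arrow_tgt B \of pb_pr2 q (arrow_src B);
  ra_assoc : rho \of pb_map (functor_comp_id q) (arrow_comp_src B)
        \of pb_assoc q (arrow_src B) (arrow_tgt B) (arrow_src B)
    =2f rho \of pb_map ra_tgt (functor_comp_id (arrow_src B));
  ra_unit : rho \of pb_pair (unit_right_subproof q) =2f functor_id J
}.

Variable R : cleavage q.
Hypothesis H : split_op2fibration R.

Notation rho1 := (lift_mor R).
Notation rho2 := (lift_cell R).
Notation am := (act_mor R).
Notation ac := (act_cell R).

Definition action : two_functor (right_pb q) J.
Proof.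
refine (@TwoFunctor (right_pb q) J
  (fun x => cod (rho1 (fst (proj1_sig x)) (snd (proj1_sig x))))
  (fun x => am (fst (proj1_sig x)) (snd (proj1_sig x)))
  (fun x => ac (fst (proj1_sig x)) (snd (proj1_sig x)))
  _ _ _ _ _ _ _ _ _).
- by move=> f; apply: (dom_act_mor H (proj2_sig f)).
- by move=> f; apply: (cod_act_mor H (proj2_sig f)).
- by move=> s; apply: (src_act_cell H (proj2_sig s)).
- by move=> s; apply: (tgt_act_cell H (proj2_sig s)).
- by move=> a; apply: (act_mor_id H (proj2_sig a)).
- move=> g f e e'; rewrite (compE e') /= (compE (pb_fst e)).
  exact: (act_mor_cmp H (proj2_sig f) (proj2_sig g) (pb_fst e) (pb_snd e)).
- by move=> f; apply: (act_cell_id H (proj2_sig f)).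
- move=> s t e e'; rewrite (vcompE e') /= (vcompE (pb_fst e)).
  exact: (act_cell_vc H (pb_snd e) (proj2_sig s) (proj2_sig t) (pb_fst e)).
- move=> t s e e'; rewrite (hcompE e') /= (hcompE (pb_fst e)).
  exact: (act_cell_hc H (pb_snd e) (proj2_sig s) (proj2_sig t) (pb_fst e)).
Defined.

Section Paste.
Variables (f : mor J) (m n : lax_square B).
Hypotheses (e : fm q f = sq_s m) (emn : sq_t m = sq_s n).

Let over2 : fm q (am f m) = sq_s n.
Proof. by rewrite (fm_act_mor H e). Qed.

(** The lift over v0 o u0 is the lift over v0 after the lift over u0, and
    the object reached in between is a boundary of [am f m]. The next
    lemmas use this to reduce everything about pasted squares to two
    successive squares. *)
Lemma lift_mor_paste_dom : rho1 (dom f) (sq_dom (paste emn))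
  = cmp (rho1 (dom (am f m)) (sq_dom n)) (rho1 (dom f) (sq_dom m)).
Proof.
rewrite /= compE (lift_mor_cmp H) ?(dom_act_mor H e) //.
  exact: (over_dom e).
exact: (paste_dom emn).
Qed.

Lemma lift_mor_paste_cod : rho1 (cod f) (sq_cod (paste emn))
  = cmp (rho1 (cod (am f m)) (sq_cod n)) (rho1 (cod f) (sq_cod m)).
Proof.
rewrite /= compE (lift_mor_cmp H) ?(cod_act_mor H e) //.
  exact: (over_cod e).
exact: (paste_cod emn).
Qed.

Lemma lift_mor_paste_comp : cod (rho1 (dom f) (sq_dom m))
  = dom (rho1 (dom (am f m)) (sq_dom n)).
Proof. by rewrite (dom_lift_mor H (over_dom over2)) (dom_act_mor H e). Qed.

Lemma lift_mor_paste_comp' : cod (rho1 (cod f) (sq_cod m))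
  = dom (rho1 (cod (am f m)) (sq_cod n)).
Proof. by rewrite (dom_lift_mor H (over_cod over2)) (cod_act_mor H e). Qed.

Lemma comp_lift_paste : comp_lift R f (paste emn)
  = cmp (rho1 (cod (am f m)) (sq_cod n)) (comp_lift R f m).
Proof.
rewrite /comp_lift lift_mor_paste_cod cmp_assoc //.
  exact: (comp_lift_composable H e).
exact: lift_mor_paste_comp'.
Qed.

(** The cell of a pasted square is (y o u0) ; (v1 o z). The lift of the
    first factor ends where the action on m prescribes, so it is the lift
    for n at [am f m] whiskered by a lift. *)
Lemma lift_cell_paste :
  rho2 (sq_cell (paste emn)) (comp_lift R f (paste emn))
  = vc (hc (rho2 (sq_cell n) (comp_lift R (am f m) n))
           (idc (rho1 (dom f) (sq_dom m))))
       (hc (idc (rho1 (cod (am f m)) (sq_cod n)))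
           (rho2 (sq_cell m) (comp_lift R f m))).
Proof.
have a := fm_comp_lift H e; have a2 := fm_comp_lift H over2.
have od := over_dom e; have oc := over_cod e.
have c1 : cod (comp_lift R f m) = dom (rho1 (cod (am f m)) (sq_cod n)).
  by rewrite (cod_comp_lift H e) lift_mor_paste_comp'.
have c2 : cod (rho1 (dom f) (sq_dom m)) = dom (comp_lift R (am f m) n).
  by rewrite (dom_comp_lift H over2) (dom_act_mor H e).
have eq2 : fm q (rho1 (cod (am f m)) (sq_cod n)) = sq_cod n.
  by rewrite (fm_lift_mor H) // (over_cod over2).
have pd := paste_dom emn; have pc := paste_cod emn.
rewrite (lift_cell_wl H a (f := sq_cod n)) //.
rewrite (lift_cell_wr H a2 (f := sq_dom m)) ?(fm_lift_mor H od) //.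
rewrite comp_lift_paste [sq_cell _]paste_cellE (lift_cell_vc H).
- rewrite tgt_hc ?src_idc ?tgt_idc; first by bd.
  by rewrite fm_cmp // eq2 a.
- bd.
- congr (vc (rho2 _ _) _).
  rewrite -(lift_cell_wl H a (f := sq_cod n)) // src_hc.
    by rewrite src_idc (cod_src_lift_cell H a).
  rewrite src_idc -(act_mor_lift H e) /comp_lift cmp_assoc //.
    exact: (act_mor_lift_composable H e).
  exact: (comp_lift_composable H over2).
Qed.

Lemma act_mor_paste : am f (paste emn) = am (am f m) n.
Proof.
have e' : fm q f = sq_s (paste emn) by [].
have a := fm_comp_lift H e; have a2 := fm_comp_lift H over2.
have lc := lift_mor_paste_comp; have lc' := lift_mor_paste_comp'.
have W := act_mor_lift_composable H over2.
have ml := act_mor_lift H over2.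
symmetry; apply: (act_morE H e'); rewrite /act_mor_spec.
rewrite lift_cell_paste lift_mor_paste_dom lift_mor_paste_cod !cod_cmp //.
split; first exact: (dom_act_mor H over2).
split; first exact: (cod_act_mor H over2).
split; first exact: (fm_act_mor H over2).
have c2 : cod (src (idc (rho1 (dom f) (sq_dom m))))
    = dom (src (rho2 (sq_cell n) (comp_lift R (am f m) n))).
  by rewrite src_idc (dom_src_lift_cell H a2) (dom_comp_lift H over2)
    (dom_act_mor H e).
have c3 : cod (src (rho2 (sq_cell m) (comp_lift R f m)))
    = dom (src (idc (rho1 (cod (am f m)) (sq_cod n)))).
  by rewrite src_idc (cod_src_lift_cell H a) (cod_comp_lift H e).
rewrite src_vc.
  rewrite tgt_hc // src_hc // src_idc tgt_idc (tgt_lift_cell H a2).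
  rewrite -(act_mor_lift H e) /comp_lift cmp_assoc //.
    exact: (act_mor_lift_composable H e).
  exact: (comp_lift_composable H over2).
by rewrite src_hc // src_idc -ml cmp_assoc.
Qed.
End Paste.

Lemma act_cell_paste s x y (exy : lc_t x = lc_s y) : fc q s = lc_s x ->
  ac s (paste_lc exy) = ac (ac s x) y.
Proof.
move=> e; have e' : fc q s = lc_s (paste_lc exy) by [].
have e2 : fc q (ac s x) = lc_s y by rewrite (fc_act_cell H e).
have es := over_src e; have et := over_tgt e.
have es2 := over_src e2; have et2 := over_tgt e2.
pose xs := paste_lc_src exy; pose xt := paste_lc_tgt exy.
have sw := src_act_cell H e; have tw := tgt_act_cell H e.
symmetry; apply: (act_cellE H e'); rewrite /act_cell_spec.
rewrite [lc_src (paste_lc _)]/= [lc_tgt (paste_lc _)]/= -/xs -/xt.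
split; first by rewrite (src_act_cell H e2) sw (act_mor_paste es xs).
split; first by rewrite (tgt_act_cell H e2) tw (act_mor_paste et xt).
split; first by rewrite (fc_act_cell H e2).
have A := act_cell_lift H e; have A2 := act_cell_lift H e2.
rewrite (lift_mor_paste_dom es xs) (lift_mor_paste_cod es xs).
rewrite (lift_cell_paste es xs) (lift_cell_paste et xt).
have d0 : rho1 (dom (tgt s)) (sq_dom (lc_tgt x))
    = rho1 (dom (src s)) (sq_dom (lc_src x)) by rewrite dom_src lc_sq_dom.
have k0 : rho1 (cod (am (tgt s) (lc_tgt x))) (sq_cod (lc_tgt y))
    = rho1 (cod (am (src s) (lc_src x))) (sq_cod (lc_src y)).
  by rewrite -sw -tw cod_src lc_sq_cod.
rewrite d0 k0; rewrite sw tw in A2.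
apply: square_paste A A2.
- by rewrite sw (act_mor_lift_composable H es).
- exact: (comp_lift_composable H es).
- exact: lift_mor_paste_comp.
- by rewrite (src_act_cell H e2) sw; apply: (act_mor_lift_composable H _);
  rewrite -sw.
- exact: lift_mor_paste_comp'.
- by rewrite sw; apply: (comp_lift_composable H _); rewrite -sw.
- by rewrite -(act_mor_lift H es) sw.
- exact: (tgt_lift_cell H (fm_comp_lift H es)).
- by rewrite -(act_mor_lift H et) tw d0.
- by rewrite (tgt_lift_cell H (fm_comp_lift H et)) /comp_lift -cod_src
  -lc_sq_cod.
- by rewrite -sw -(act_mor_lift H es2) (src_act_cell H e2).
- by rewrite -sw (tgt_lift_cell H (fm_comp_lift H es2)).
- by rewrite -tw -(act_mor_lift H et2) (tgt_act_cell H e2) -dom_src -lc_sq_dom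
  sw.
- by rewrite -tw (tgt_lift_cell H (fm_comp_lift H et2)) /comp_lift tw k0.
Qed.

Lemma act_mor_unit f : am f (unit_sq (fm q f)) = f.
Proof.
have e : fm q f = sq_s (unit_sq (fm q f)) by [].
symmetry; apply: (act_morE H e).
have d : rho1 (dom f) (idm (dom (fm q f))) = idm (dom f).
  by apply: (lift_mor_id H); rewrite fm_dom.
have c : rho1 (cod f) (idm (cod (fm q f))) = idm (cod f).
  by apply: (lift_mor_id H); rewrite fm_cod.
rewrite /act_mor_spec /comp_lift /= c d !cod_idm.
split=> //; split=> //; split=> //.
by rewrite cmp_idr // cmp_idl // (lift_cell_id H) // src_idc.
Qed.

Lemma act_cell_unit s : ac s (unit_cell (fc q s)) = s.
Proof.
have e : fc q s = lc_s (unit_cell (fc q s)) by [].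
have d : forall f, rho1 (dom f) (idm (dom (fm q f))) = idm (dom f).
  by move=> f; apply: (lift_mor_id H); rewrite fm_dom.
have c : forall f, rho1 (cod f) (idm (cod (fm q f))) = idm (cod f).
  by move=> f; apply: (lift_mor_id H); rewrite fm_cod.
symmetry; apply: (act_cellE H e).
rewrite /act_cell_spec /comp_lift /= fc_src fc_tgt !act_mor_unit !c !d.
split=> //; split=> //; split=> //.
rewrite !cmp_idl // !(lift_cell_id H) // hc_idr // hc_idl //.
by rewrite vc_idl // vc_idr.
Qed.

Lemma action_right_action : right_action action.
Proof.
have ht : q \of action =2f arrow_tgt B \of pb_pr2 q (arrow_src B).
  split=> x.
    exact: (fo_cod_lift_mor H (proj2_sig x)).
    exact: (fm_act_mor H (proj2_sig x)).
  exact: (fc_act_cell H (proj2_sig x)).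
apply: (RightAction (ra_tgt := ht)).
- split=> x.
  + have e := proj2_sig (fst (proj1_sig x)).
    have e2 := proj2_sig x; rewrite /= in e e2.
    rewrite /= /ca_ob /= compE (lift_mor_cmp H) // cod_cmp // (dom_lift_mor H)
      //.
    by rewrite (fo_cod_lift_mor H).
  + apply: act_mor_paste; exact: (proj2_sig (fst (proj1_sig x))).
  + apply: act_cell_paste; exact: (proj2_sig (fst (proj1_sig x))).
- split=> x.
  + by rewrite /= (lift_mor_id H) // cod_idm.
  + exact: act_mor_unit.
  + exact: act_cell_unit.
Qed.

Lemma act_mor_from_id i u : fo q i = dom u -> am (idm i) (from_id u) = rho1 i u.
Proof.
move=> e; have e' : fm q (idm i) = sq_s (from_id u) by rewrite fm_idm e.
symmetry; apply: (act_morE H e').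
rewrite /act_mor_spec /comp_lift /= dom_idm cod_idm (dom_lift_mor H) //.
rewrite (lift_mor_id H) // cod_idm cmp_idr ?(dom_lift_mor H) //.
split=> //; split=> //; split; first exact: (fm_lift_mor H).
by rewrite (lift_cell_id H) ?(fm_lift_mor H) // src_idc.
Qed.

Lemma act_cell_to_unit b s : tgt b = fm q s ->
  ac (idc s) (to_unit_cell b) = rho2 b s.
Proof.
move=> e.
have e' : fc q (idc s) = lc_s (to_unit_cell b) by rewrite fc_idc -e.
have d : rho1 (dom s) (idm (dom (src b))) = idm (dom s).
  by apply: (lift_mor_id H); rewrite dom_src e fm_dom.
have c : rho1 (cod s) (idm (cod (src b))) = idm (cod s).
  by apply: (lift_mor_id H); rewrite cod_src e fm_cod.
have aE : comp_lift R s (cell_sq b) = s by rewrite /comp_lift /= c cmp_idl.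
have uE : comp_lift R s (unit_sq (tgt b)) = s.
  by rewrite /comp_lift /= -cod_src c cmp_idl.
have es : fm q s = sq_s (cell_sq b) by rewrite /= e.
symmetry; apply: (act_cellE H e').
rewrite /act_cell_spec src_idc tgt_idc.
split.
  apply: (act_morE H es).
  rewrite /act_mor_spec aE /= c d !cod_idm (dom_src_lift_cell H e).
  rewrite (cod_src_lift_cell H e) (fm_src_lift_cell H e).
  by split=> //; split=> //; split=> //;
    rewrite cmp_idr // (dom_src_lift_cell H e).
split; first by rewrite (tgt_lift_cell H e) /= e act_mor_unit.
split; first exact: (fc_lift_cell H e).
rewrite aE uE /= d c e (lift_cell_id H) // hc_idr ?(dom_src_lift_cell H e) //.
rewrite vc_idr ?(tgt_lift_cell H e) // hc_idl ?src_idc // vc_idr //.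
by rewrite (tgt_lift_cell H e).
Qed.

(** At the degenerate squares all but one of the lifts in the
    characterizing equation are identities. *)
Lemma right_cleavage_action : cleavage_eq (right_cleavage action) R.
Proof.
split=> [i u e|b s e].
- by rewrite (lift_morE R); apply: act_mor_from_id.
- by rewrite (lift_cellE R); apply: act_cell_to_unit.
Qed.

(** Applying p to the characterizing equations turns all lifts into
    identities, leaving p of the value on one side and p of the argument on
    the other. *)
Lemma action_vertical (A : two_category) (p : two_functor J A) :
  (forall i u (e : fo q i = dom u), fm p (cl_mor R e) = idm (fo p i)) ->
  (forall b s (e : tgt b = fm q s), fc p (cl_cell R e) = idc (fm p s)) ->
  p \of action =2f p \of pb_pr1 q (arrow_src B).
Proof.
move=> v1' v2'.
have v1 : forall i u, fo q i = dom u -> fm p (rho1 i u) = idm (fo p i).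
  by move=> i u e; rewrite -(lift_morE R e).
have v2 : forall b s, tgt b = fm q s -> fc p (rho2 b s) = idc (fm p s).
  by move=> b s e; rewrite -(lift_cellE R e).
have va : forall f m, fm q f = sq_s m -> fm p (comp_lift R f m) = fm p f.
  move=> f m e; have := over_cod e; have := comp_lift_composable H e => h1 h2.
  by rewrite fm_cmp // v1 // cmp_idl ?fm_cod.
have vm : forall f m, fm q f = sq_s m -> fm p (am f m) = fm p f.
  move=> f m e; have := act_mor_lift H e; move/(f_equal (fm p)).
  have ed := over_dom e; have ea := act_mor_lift_composable H e; have ez :=
    fm_comp_lift H e.
  rewrite -(fc_src p) v2 // src_idc va // fm_cmp // v1 // cmp_idr //.
  by rewrite fm_dom -ea -fm_cod v1 // cod_idm.
have vo : forall i u, fo q i = dom u -> fo p (cod (rho1 i u)) = fo p i.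
  by move=> i u e; rewrite -fm_cod v1 // cod_idm.
split=> x /=.
- exact: (vo _ _ (proj2_sig x)).
- exact: (vm _ _ (proj2_sig x)).
- have e := proj2_sig x; rewrite /= in e.
  move: e; set s := fst _; set y := snd _ => e.
  have := act_cell_lift H e; move/(f_equal (fc p)).
  have es := over_src e; have et := over_tgt e.
  have es1 : cod (rho1 (dom (src s)) (sq_dom (lc_src y))) = dom (src (ac s y)).
    by rewrite (src_act_cell H e) (act_mor_lift_composable H es).
  have et1 : tgt (hc (ac s y) (idc (rho1 (dom (src s)) (sq_dom (lc_src y)))))
    = src (rho2 (sq_cell (lc_tgt y)) (comp_lift R (tgt s) (lc_tgt y))).
    rewrite tgt_hc ?src_idc ?tgt_idc // -(act_mor_lift H et) (tgt_act_cell H e).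
    by rewrite -dom_src -lc_sq_dom.
  have ac := comp_lift_composable H es.
  have ez0 := fm_comp_lift H es; have ez1 := fm_comp_lift H et.
  have ed := over_dom es; have ec := over_cod es.
  have ev : tgt (rho2 (sq_cell (lc_src y)) (comp_lift R (src s) (lc_src y)))
    = src (hc (idc (rho1 (cod (src s)) (sq_cod (lc_src y)))) s).
    by rewrite (tgt_lift_cell H ez0) src_hc ?src_idc.
  rewrite !fc_vc // !v2 // !fc_hc ?src_idc // !fc_idc !v1 // !va //.
  have ep : src (fc p (act_cell R s y)) = fm p (src s).
    by rewrite fc_src (src_act_cell H e) vm.
  have ep' : tgt (fc p (act_cell R s y)) = fm p (tgt s).
    by rewrite fc_tgt (tgt_act_cell H e) vm.
  rewrite hc_idr ?ep ?fm_dom // hc_idl ?fc_src ?fm_cod //.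
  by rewrite vc_idr // vc_idl // fc_src.
Qed.
End RightAction.

(** * Degenerate squares and their pastings *)

Section Squares.
Variable C : two_category.
Implicit Types (u v : mor C) (a b c d : cell C).

Lemma from_id_idm x : from_id (idm x) = sq_id (idm x) :> lax_square C.
Proof. by apply: sq_ext; rewrite /= ?dom_idm ?cod_idm. Qed.

(** The first of the two factors is the degenerate square over u; the
    second is a degenerate square over v precomposed with u, which an
    action evaluates at an already lifted object. Hence the rule for the
    lift over a composite. *)
Lemma from_id_comp u v (e1 : sq_t (sq_id u) = sq_s (from_id v))
  (e2 : sq_cod (from_id u) = sq_dom (paste e1)) : cod u = dom v ->
  sq_comp e2 = from_id (cmp v u).
Proof.
move=> e; apply: sq_ext; rewrite ?sq_cell_comp /= ?paste_cellE /= ?compE.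
- by rewrite dom_cmp.
- by [].
- by rewrite dom_cmp // cmp_idl // cod_idm.
- by [].
- by rewrite !hc_idc ?vc_idl ?hc_idr ?src_idc //= ?dom_cmp.
Qed.

(** The composite of (u, id, id) and the unit square of v is the square at
    which an action produces the factorization of a morphism over v o u
    through the lift over u; this equation is the triangle of (om1). *)
Lemma lower_sq_from_id u v (e : sq_cod (to_id u) = sq_dom (unit_sq v))
  (e2 : sq_cod (from_id u) = sq_dom (sq_comp e)) : cod u = dom v ->
  sq_comp e2 = unit_sq (cmp v u).
Proof.
move=> h; apply: sq_ext; rewrite ?sq_cell_comp /= ?vcompE ?hcompE ?compE.
- by rewrite dom_cmp.
- by rewrite cod_cmp.
- by rewrite cmp_idr // dom_cmp.
- by rewrite h cmp_idr.
- have h0 : cmp v (idm (cod u)) = v by rewrite h cmp_idr.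
  rewrite h0 !hc_idc ?cod_idm ?dom_idm //.
  by rewrite vc_idl ?src_idc // hc_idr ?vc_idl ?src_idc ?dom_cmp.
Qed.

(** The triangle identity relating the two degenerate squares of u. It
    makes the factorizations of (om1) and (om2) unique. *)
Lemma paste_from_to_id u (e : sq_t (from_id u) = sq_s (to_id u)) :
  paste e = sq_id u.
Proof.
apply: sq_ext; rewrite /= ?paste_cellE /= ?compE ?cmp_idl ?cmp_idr //.
by rewrite hc_idr ?src_idc // hc_idl ?src_idc // vc_idl // src_idc.
Qed.

Lemma cell_sq_idc u : cell_sq (idc u) = unit_sq u.
Proof. by apply: sq_ext; rewrite /= ?src_idc ?tgt_idc. Qed.

Lemma to_unit_idc u : to_unit_cell (idc u) = lc_idc (unit_sq u).
Proof.
by apply: lc_ext; rewrite /= ?src_idc ?tgt_idc ?cell_sq_idc.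
Qed.

Lemma cell_sq_paste b c (e : sq_t (cell_sq b) = sq_s (cell_sq c)) :
  tgt c = src b -> paste e = cell_sq (vc c b).
Proof.
move=> h.
have hd : dom (src c) = dom (src b) by rewrite dom_src h.
have hc' : cod (src c) = cod (src b) by rewrite cod_src h.
apply: sq_ext; rewrite /= ?paste_cellE /= ?compE ?src_vc ?tgt_vc //.
- by rewrite hd cmp_idl ?cod_idm.
- by rewrite hc' cmp_idl ?cod_idm.
- by rewrite hc_idr // ?hd // hc_idl // hc'.
Qed.

Lemma paste_cell_unit b u (e : sq_t (cell_sq b) = sq_s (unit_sq u)) :
  paste e = cell_sq b.
Proof.
have h : src b = u := e.
apply: sq_ext; rewrite /= ?paste_cellE /= ?compE -?h //.
- by rewrite cmp_idl ?cod_idm.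
- by rewrite cmp_idl ?cod_idm.
- by rewrite hc_idr ?src_idc // hc_idl // vc_idl.
Qed.
Lemma paste_unit_cell b u (e : sq_t (unit_sq u) = sq_s (cell_sq b)) :
  paste e = cell_sq b.
Proof.
have h : u = tgt b := e.
apply: sq_ext; rewrite /= ?paste_cellE /= ?compE ?h -?dom_src -?cod_src //.
- by rewrite cmp_idl ?cod_idm.
- by rewrite cmp_idl ?cod_idm.
- by rewrite hc_idr ?src_idc // hc_idl ?src_idc ?cod_src // vc_idr.
Qed.

(** The analogous triangle identity for a cell, which makes the
    factorizations of (cc) unique. *)
Lemma paste_to_from_unit b
  (e : lc_t (to_unit_cell b) = lc_s (from_unit_cell b)) :
  paste_lc e = lc_idc (cell_sq b).
Proof.
by apply: lc_ext; rewrite //= ?paste_cell_unit ?paste_unit_cell.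
Qed.

Lemma to_unit_vc b c (e1 : lc_t (lc_idc (cell_sq b)) = lc_s (to_unit_cell c))
  (e2 : lc_tgt (paste_lc e1) = lc_src (to_unit_cell b)) : tgt c = src b ->
  lc_vcomp e2 = to_unit_cell (vc c b).
Proof.
move=> h; apply: lc_ext; rewrite /= ?cell_sq_paste ?tgt_vc // vcompE //.
by rewrite vc_idl // src_idc.
Qed.

Lemma cell_sq_comp b d (e : sq_cod (cell_sq b) = sq_dom (cell_sq d)) :
  cod (src b) = dom (src d) -> sq_comp e = cell_sq (hc d b).
Proof.
move=> h; apply: sq_ext; rewrite ?sq_cell_comp /= ?compE ?src_hc ?tgt_hc //.
- by rewrite dom_cmp.
- by rewrite cod_cmp.
- by rewrite -hc_split'.
Qed.

Lemma to_unit_hc b d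
  (e : sq_cod (lc_src (to_unit_cell b)) = sq_dom (lc_src (to_unit_cell d))) :
  cod (src b) = dom (src d) -> lc_hcomp e = to_unit_cell (hc d b).
Proof.
move=> h; have h' : cod (tgt b) = dom (tgt d) by rewrite -cod_src -dom_src.
apply: lc_ext => /=.
- exact: cell_sq_comp.
- rewrite tgt_hc // -(compE h'); symmetry; exact: unit_sq_comp.
- by rewrite hcompE hc_idc // tgt_hc.
- by rewrite hcompE.
Qed.

Lemma lower_lc_from_id u b
  (e : sq_cod (lc_src (lc_idc (to_id u))) = sq_dom (lc_src (unit_cell b)))
  (e2 : sq_cod (lc_src (lc_idc (from_id u))) = sq_dom (lc_src (lc_hcomp e))) :
  cod u = dom (src b) -> lc_hcomp e2 = unit_cell (hc b (idc u)).
Proof.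
move=> h; have h' : cod u = dom (tgt b) by rewrite -dom_src.
apply: lc_ext => /=.
- by rewrite lower_sq_from_id // src_hc ?src_idc.
- by rewrite lower_sq_from_id // tgt_hc ?src_idc ?tgt_idc.
- rewrite !hcompE hc_idr // src_hc ?src_idc // dom_cmp //.
- by rewrite !hcompE h hc_idr.
Qed.

(** The equation that the factorization in (cc) has to satisfy, at the
    level of squares. *)
Lemma raise_to_unit a b (e : lc_tgt (unit_cell a) = lc_src (from_unit_cell b))
  (e2 : lc_tgt (lc_vcomp e) = lc_src (to_unit_cell b)) : tgt a = src b ->
  lc_vcomp e2 = unit_cell (vc a b).
Proof.
move=> h; apply: lc_ext; rewrite /= ?src_vc ?tgt_vc // !vcompE.
- by rewrite vc_idr // tgt_vc.
- by rewrite -h vc_idr.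
Qed.

End Squares.

(** * Elementwise form of the laws of a right action *)

Section CleavageOfAction.
Variables (J B : two_category) (q : two_functor J B).
Variable rho : two_functor (right_pb q) J.

(** Total versions of the values of rho, arbitrary on arguments that do not
    match. *)
Definition rho_ob (i : ob J) (u : mor B) : ob J :=
  match excluded_middle_informative (fo q i = dom u) with
  | left e => fo rho (exist _ (i, u) e)
  | right _ => i
  end.
Definition rho_mor (f : mor J) (m : lax_square B) : mor J :=
  match excluded_middle_informative (fm q f = sq_s m) with
  | left e => fm rho (exist _ (f, m) e)
  | right _ => f
  end.
Definition rho_cell (s : cell J) (x : lax_square_cell B) : cell J :=
  match excluded_middle_informative (fc q s = lc_s x) with
  | left e => fc rho (exist _ (s, x) e)
  | right _ => s
  end.

Lemma rho_obE (x : ob (right_pb q)) :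
  fo rho x = rho_ob (fst (proj1_sig x)) (snd (proj1_sig x)).
Proof.
rewrite /rho_ob; case: excluded_middle_informative => [e|]; last by case: x.
by congr (fo rho _); apply: pb_eq.
Qed.
Lemma rho_morE (x : mor (right_pb q)) :
  fm rho x = rho_mor (fst (proj1_sig x)) (snd (proj1_sig x)).
Proof.
rewrite /rho_mor; case: excluded_middle_informative => [e|]; last by case: x.
by congr (fm rho _); apply: pb_eq.
Qed.
Lemma rho_cellE (x : cell (right_pb q)) :
  fc rho x = rho_cell (fst (proj1_sig x)) (snd (proj1_sig x)).
Proof.
rewrite /rho_cell; case: excluded_middle_informative => [e|]; last by case: x.
by congr (fc rho _); apply: pb_eq.
Qed.

Definition right_ob i u (e : fo q i = dom u) : ob (right_pb q) :=
  exist _ (i, u) e.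
Definition right_mor f m (e : fm q f = sq_s m) : mor (right_pb q) :=
  exist _ (f, m) e.
Definition right_cell s x (e : fc q s = lc_s x) : cell (right_pb q) :=
  exist _ (s, x) e.

Lemma dom_rho_mor f m : fm q f = sq_s m ->
  dom (rho_mor f m) = rho_ob (dom f) (sq_dom m).
Proof. by move=> e; rewrite -(rho_morE (right_mor e)) fm_dom rho_obE. Qed.
Lemma cod_rho_mor f m : fm q f = sq_s m ->
  cod (rho_mor f m) = rho_ob (cod f) (sq_cod m).
Proof. by move=> e; rewrite -(rho_morE (right_mor e)) fm_cod rho_obE. Qed.
Lemma src_rho_cell s x : fc q s = lc_s x ->
  src (rho_cell s x) = rho_mor (src s) (lc_src x).
Proof. by move=> e; rewrite -(rho_cellE (right_cell e)) fc_src rho_morE. Qed.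
Lemma tgt_rho_cell s x : fc q s = lc_s x ->
  tgt (rho_cell s x) = rho_mor (tgt s) (lc_tgt x).
Proof. by move=> e; rewrite -(rho_cellE (right_cell e)) fc_tgt rho_morE. Qed.
Lemma rho_mor_id i u : fo q i = dom u ->
  rho_mor (idm i) (sq_id u) = idm (rho_ob i u).
Proof. by move=> e; rewrite -(rho_obE (right_ob e)) -fm_idm rho_morE. Qed.
Lemma rho_cell_idc f m : fm q f = sq_s m ->
  rho_cell (idc f) (lc_idc m) = idc (rho_mor f m).
Proof. by move=> e; rewrite -(rho_morE (right_mor e)) -fc_idc rho_cellE. Qed.
Lemma rho_mor_cmp f f' m m' (ec : sq_cod m = sq_dom m') :
  fm q f = sq_s m -> fm q f' = sq_s m' -> cod f = dom f' ->
  rho_mor (cmp f' f) (sq_comp ec) = cmp (rho_mor f' m') (rho_mor f m).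
Proof.
move=> e e' ef; rewrite -(rho_morE (right_mor e)) -(rho_morE (right_mor e')).
have c : cod (right_mor e) = dom (right_mor e') by apply: pb_eq.
rewrite -fm_cmp // -(compE c) rho_morE /= compE; congr (rho_mor _ _).
exact: sq_comp_congr.
Qed.
Lemma rho_cell_vc s s' x x' (ex : lc_tgt x = lc_src x') :
  fc q s = lc_s x -> fc q s' = lc_s x' -> tgt s = src s' ->
  rho_cell (vc s s') (lc_vcomp ex) = vc (rho_cell s x) (rho_cell s' x').
Proof.
move=> e e' ef; rewrite -(rho_cellE (right_cell e))
  -(rho_cellE (right_cell e')).
have c : tgt (right_cell e) = src (right_cell e') by apply: pb_eq.
rewrite -fc_vc // -(vcompE c) rho_cellE /= vcompE; congr (rho_cell _ _).
by congr lc_vcomp; apply: proof_irrelevance.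
Qed.
Lemma rho_cell_hc s s' x x' (ex : sq_cod (lc_src x) = sq_dom (lc_src x')) :
  fc q s = lc_s x -> fc q s' = lc_s x' -> cod (src s) = dom (src s') ->
  rho_cell (hc s' s) (lc_hcomp ex) = hc (rho_cell s' x') (rho_cell s x).
Proof.
move=> e e' ef; rewrite -(rho_cellE (right_cell e))
  -(rho_cellE (right_cell e')).
have c : cod (src (right_cell e)) = dom (src (right_cell e')) by apply: pb_eq.
rewrite -fc_hc // -(hcompE c) rho_cellE /= hcompE; congr (rho_cell _ _).
by congr lc_hcomp; apply: proof_irrelevance.
Qed.

Hypothesis H : right_action rho.

Lemma fm_rho_mor f m : fm q f = sq_s m -> fm q (rho_mor f m) = sq_t m.
Proof. by move=> e; rewrite -(rho_morE (right_mor e)); apply: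
  (eq_fm (ra_tgt H)). Qed.
Lemma fc_rho_cell s x : fc q s = lc_s x -> fc q (rho_cell s x) = lc_t x.
Proof. by move=> e; rewrite -(rho_cellE (right_cell e)); apply:
  (eq_fc (ra_tgt H)). Qed.

Lemma rho_ob_unit i a : a = fo q i -> rho_ob i (idm a) = i.
Proof. by move=> ->; have := eq_fo (ra_unit H) i; rewrite /= rho_obE. Qed.
Lemma rho_mor_unit f g : g = fm q f -> rho_mor f (unit_sq g) = f.
Proof. by move=> ->; have := eq_fm (ra_unit H) f; rewrite /= rho_morE. Qed.
Lemma rho_cell_unit s b : b = fc q s -> rho_cell s (unit_cell b) = s.
Proof. by move=> ->; have := eq_fc (ra_unit H) s; rewrite /= rho_cellE. Qed.

Lemma rho_assoc_ob x :
  fo rho (fo (pb_map (functor_comp_id q) (arrow_comp_src B))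
    (fo (pb_assoc q (arrow_src B) (arrow_tgt B) (arrow_src B)) x))
  = fo rho (fo (pb_map (ra_tgt H) (functor_comp_id (arrow_src B))) x).
Proof. exact: (eq_fo (ra_assoc H) x). Qed.
Lemma rho_assoc_mor x :
  fm rho (fm (pb_map (functor_comp_id q) (arrow_comp_src B))
    (fm (pb_assoc q (arrow_src B) (arrow_tgt B) (arrow_src B)) x))
  = fm rho (fm (pb_map (ra_tgt H) (functor_comp_id (arrow_src B))) x).
Proof. exact: (eq_fm (ra_assoc H) x). Qed.
Lemma rho_assoc_cell x :
  fc rho (fc (pb_map (functor_comp_id q) (arrow_comp_src B))
    (fc (pb_assoc q (arrow_src B) (arrow_tgt B) (arrow_src B)) x))
  = fc rho (fc (pb_map (ra_tgt H) (functor_comp_id (arrow_src B))) x).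
Proof. exact: (eq_fc (ra_assoc H) x). Qed.

Lemma rho_ob_paste i u v : fo q i = dom u -> cod u = dom v ->
  rho_ob i (cmp v u) = rho_ob (rho_ob i u) v.
Proof.
move=> e e'.
have := rho_assoc_ob (exist _ (right_ob e, v) e').
rewrite (rho_obE (fo _ _)) (rho_obE (fo (pb_map (ra_tgt H) _) _)).
rewrite -(compE e') -(rho_obE (right_ob e)).
have -> : comp v u e' = snd
  (proj1_sig (fo (pb_map (functor_comp_id q) (arrow_comp_src B))
    (fo (pb_assoc q (arrow_src B) (arrow_tgt B) (arrow_src B))
      (exist _ (right_ob e, v) e')))).
  exact: comp_congr.
by apply.
Qed.
Lemma rho_mor_paste f m n (emn : sq_t m = sq_s n) : fm q f = sq_s m ->
  rho_mor f (paste emn) = rho_mor (rho_mor f m) n.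
Proof.
move=> e; have := rho_assoc_mor (exist _ (right_mor e, n) emn).
rewrite (rho_morE (fm _ _)) (rho_morE (fm (pb_map (ra_tgt H) _) _)).
rewrite -(rho_morE (right_mor e)).
have -> : paste emn = snd
  (proj1_sig (fm (pb_map (functor_comp_id q) (arrow_comp_src B))
    (fm (pb_assoc q (arrow_src B) (arrow_tgt B) (arrow_src B))
      (exist _ (right_mor e, n) emn)))).
  exact: paste_congr.
by apply.
Qed.
Lemma rho_cell_paste s x y (exy : lc_t x = lc_s y) : fc q s = lc_s x ->
  rho_cell s (paste_lc exy) = rho_cell (rho_cell s x) y.
Proof.
move=> e; have := rho_assoc_cell (exist _ (right_cell e, y) exy).
rewrite (rho_cellE (fc _ _)) (rho_cellE (fc (pb_map (ra_tgt H) _) _)).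
rewrite -(rho_cellE (right_cell e)).
have -> : paste_lc exy = snd
  (proj1_sig (fc (pb_map (functor_comp_id q) (arrow_comp_src B))
    (fc (pb_assoc q (arrow_src B) (arrow_tgt B) (arrow_src B))
      (exist _ (right_cell e, y) exy)))).
  exact: paste_lc_congr.
by apply.
Qed.

End CleavageOfAction.

(** * The split op-2-fibration of a right action *)

Section FibrationOfAction.
Variables (J B : two_category) (q : two_functor J B).
Variable rho : two_functor (right_pb q) J.
Hypothesis H : right_action rho.

Notation ro := (rho_ob rho).
Notation rm := (rho_mor rho).
Notation rc := (rho_cell rho).

Definition rho_lift_mor i u := rm (idm i) (from_id u).
Definition rho_lift_cell b s := rc (idc s) (to_unit_cell b).
Notation rl := rho_lift_mor.
Notation rlc := rho_lift_cell.

Lemma cl_mor_right_cleavage i u (e : fo q i = dom u) :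
  cl_mor (right_cleavage rho) e = rl i u.
Proof. by rewrite /= rho_morE. Qed.
Lemma cl_cell_right_cleavage b s (e : tgt b = fm q s) :
  cl_cell (right_cleavage rho) e = rlc b s.
Proof. by rewrite /= rho_cellE. Qed.

Section Mor.
Variables (i : ob J) (u : mor B).
Hypothesis e : fo q i = dom u.
Lemma over_from_id : fm q (idm i) = sq_s (from_id u).
Proof. by rewrite fm_idm e. Qed.
Lemma dom_rho_lift_mor : dom (rl i u) = i.
Proof. by rewrite /rho_lift_mor (dom_rho_mor rho over_from_id) /= dom_idm
  (rho_ob_unit H). Qed.
Lemma cod_rho_lift_mor : cod (rl i u) = ro i u.
Proof. by rewrite /rho_lift_mor (cod_rho_mor rho over_from_id) /= cod_idm. Qed.
Lemma fm_rho_lift_mor : fm q (rl i u) = u.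
Proof. by rewrite /rho_lift_mor (fm_rho_mor H over_from_id). Qed.

(** By associativity the left-hand side is rho at the pasting of the two
    degenerate squares of u, which is an identity. *)
Lemma rho_lift_mor_to_id : rm (rl i u) (to_id u) = idm (ro i u).
Proof.
have e1 : sq_t (from_id u) = sq_s (to_id u) by [].
rewrite /rho_lift_mor -(rho_mor_paste H e1 over_from_id) paste_from_to_id.
exact: rho_mor_id.
Qed.
End Mor.

Section Cell.
Variables (b : cell B) (s : mor J).
Hypothesis e : tgt b = fm q s.
Lemma over_to_unit : fc q (idc s) = lc_s (to_unit_cell b).
Proof. by rewrite fc_idc -e. Qed.
Lemma src_rho_lift_cell : src (rlc b s) = rm s (cell_sq b).
Proof. by rewrite /rho_lift_cell (src_rho_cell rho over_to_unit) src_idc. Qed.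
Lemma tgt_rho_lift_cell : tgt (rlc b s) = s.
Proof. by rewrite /rho_lift_cell (tgt_rho_cell rho over_to_unit) tgt_idc /=
  (rho_mor_unit H). Qed.
Lemma fc_rho_lift_cell : fc q (rlc b s) = b.
Proof. by rewrite /rho_lift_cell (fc_rho_cell H over_to_unit). Qed.

(** As for morphisms, from the triangle identity of b. *)
Lemma rho_lift_cell_from_unit : rc (rlc b s) (from_unit_cell b)
  = idc (rm s (cell_sq b)).
Proof.
have e1 : lc_t (to_unit_cell b) = lc_s (from_unit_cell b) by [].
rewrite /rho_lift_cell -(rho_cell_paste H e1 over_to_unit) paste_to_from_unit.
exact: rho_cell_idc.
Qed.
End Cell.

Lemma rho_lift_mor_idm i : rl i (idm (fo q i)) = idm i.
Proof. by rewrite /rho_lift_mor from_id_idm rho_mor_id ?dom_idm //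
  (rho_ob_unit H). Qed.

Lemma rho_lift_mor_comp i u v : fo q i = dom u -> cod u = dom v ->
  rl i (cmp v u) = cmp (rl (ro i u) v) (rl i u).
Proof.
move=> e e'; rewrite {2}/rho_lift_mor -rho_mor_id //.
have e1 : sq_t (sq_id u) = sq_s (from_id v) by rewrite /= e'.
have e2 : sq_cod (from_id u) = sq_dom (paste e1).
  by rewrite /= compE cmp_idl.
(* An identity at the object reached by u is rho at an identity square, so
   associativity moves the second lift back to i. *)
rewrite -(rho_mor_paste H e1); first by rewrite fm_idm e.
rewrite /rho_lift_mor -(from_id_comp e2) // -{1}(cmp_idl (b := i) (f := idm i))
  ?cod_idm //.
rewrite (rho_mor_cmp rho e2) ?dom_idm ?cod_idm //.
- exact: over_from_id.
- by rewrite fm_idm e.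
Qed.

Lemma rho_lift_cell_idc s : rlc (idc (fm q s)) s = idc s.
Proof. by rewrite /rho_lift_cell to_unit_idc rho_cell_idc // (rho_mor_unit H).
  Qed.

Lemma rho_lift_cell_vc b c s : tgt b = fm q s -> tgt c = src b ->
  rlc (vc c b) s = vc (rlc c (rm s (cell_sq b))) (rlc b s).
Proof.
move=> e e'; have es : fm q s = sq_s (cell_sq b) by rewrite /= e.
have ei : fc q (idc s) = lc_s (lc_idc (cell_sq b)) by rewrite fc_idc es.
have e1 : lc_t (lc_idc (cell_sq b)) = lc_s (to_unit_cell c) by rewrite /= e'.
have e2 : lc_tgt (paste_lc e1) = lc_src (to_unit_cell b).
  by rewrite /= paste_cell_unit.
rewrite {2}/rho_lift_cell -rho_cell_idc // -(rho_cell_paste H e1) //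
  /rho_lift_cell -(to_unit_vc e2) //.
rewrite -{1}(vc_idl (f := s) (s := idc s)) ?src_idc //.
rewrite (rho_cell_vc rho e2) ?src_idc ?tgt_idc //; exact: over_to_unit.
Qed.

Lemma rho_lift_cell_hc b d s t : tgt b = fm q s -> tgt d = fm q t ->
  cod s = dom t ->
  rlc (hc d b) (cmp t s) = hc (rlc d t) (rlc b s).
Proof.
move=> eb ed e.
have e' : cod (src b) = dom (src d).
  by rewrite cod_src dom_src eb ed fm_cod fm_dom e.
have e1 : sq_cod (lc_src (to_unit_cell b)) = sq_dom (lc_src (to_unit_cell d)).
  by rewrite /= e'.
rewrite /rho_lift_cell -(to_unit_hc e1) // -hc_idc //.
by rewrite (rho_cell_hc rho e1) ?src_idc //; apply: over_to_unit.
Qed.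

Section Om.
Variables (i : ob J) (u : mor B).
Hypothesis e : fo q i = dom u.

Lemma lower_composable v : cod u = dom v ->
  sq_cod (to_id u) = sq_dom (unit_sq v).
Proof. by move=> /= ->. Qed.

Section Mor1.
Variable v : mor B.
Hypothesis euv : cod u = dom v.
Let L := sq_comp (lower_composable euv).

Lemma lower_s : sq_s L = cmp v u.
Proof. by rewrite /= compE. Qed.
Lemma lower_t : sq_t L = v.
Proof. by rewrite /= compE euv cmp_idr. Qed.

Lemma om1_exists s : dom s = i -> cmp v u = fm q s ->
  dom (rm s L) = ro i u /\ cod (rm s L) = cod s /\ fm q (rm s L) = v /\
    cmp (rm s L) (rl i u) = s.
Proof.
move=> ds es; have eL : fm q s = sq_s L by rewrite lower_s.
have cs : fo q (cod s) = cod v by rewrite -fm_cod -es cod_cmp.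
split; [|split; [|split]].
- by rewrite (dom_rho_mor rho eL) ds.
- by rewrite (cod_rho_mor rho eL) /= (rho_ob_unit H).
- by rewrite (fm_rho_mor H eL) lower_t.
- have e2 : sq_cod (from_id u) = sq_dom L by [].
  rewrite /rho_lift_mor -(rho_mor_cmp rho e2) ?cod_idm //; first exact:
    over_from_id.
  by rewrite lower_sq_from_id // cmp_idr // (rho_mor_unit H).
Qed.

(** By the unit law w is the value of rho at w and the unit square of v,
    while rho at the lift and (u, id, id) is an identity. Functoriality
    combines the two, so w is a function of its composite with the lift. *)
Lemma om1_unique w : dom w = ro i u -> fm q w = v -> rm (cmp w (rl i u)) L = w.
Proof.
move=> dw ew; rewrite /L rho_mor_cmp.
- by rewrite fm_rho_lift_mor.
- by rewrite ew.
- by rewrite cod_rho_lift_mor.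
- by rewrite rho_lift_mor_to_id // (rho_mor_unit H) // cmp_idr.
Qed.
End Mor1.

Section Cell1.
Variable b : cell B.
Hypothesis eub : cod u = dom (src b).
Let Lc := lc_hcomp (x := lc_idc (to_id u)) (y := unit_cell b)
  (lower_composable eub).
Let eub' : cod u = dom (tgt b).
Proof. by rewrite -dom_src. Qed.

Lemma lower_lc_s : lc_s Lc = hc b (idc u).
Proof. by rewrite /= hcompE. Qed.
Lemma lower_lc_t : lc_t Lc = b.
Proof. by rewrite /= hcompE eub hc_idr. Qed.
Lemma lower_lc_tgt : lc_tgt Lc = sq_comp (lower_composable eub').
Proof. exact: sq_comp_congr. Qed.

Lemma om2_exists x : dom (src x) = i -> hc b (idc u) = fc q x ->
  src (rc x Lc) = rm (src x) (sq_comp (lower_composable eub)) /\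
      tgt (rc x Lc) = rm (tgt x) (sq_comp (lower_composable eub')) /\
      fc q (rc x Lc) = b /\
    hc (rc x Lc) (idc (rl i u)) = x.
Proof.
move=> dx ex; have eL : fc q x = lc_s Lc by rewrite lower_lc_s.
split; [|split; [|split]].
- by rewrite (src_rho_cell rho eL).
- by rewrite (tgt_rho_cell rho eL) lower_lc_tgt.
- by rewrite (fc_rho_cell H eL) lower_lc_t.
- have e2 : sq_cod (lc_src (lc_idc (from_id u))) = sq_dom (lc_src Lc) by [].
  rewrite /rho_lift_mor -rho_cell_idc; first exact: over_from_id.
  rewrite -(rho_cell_hc rho e2) ?src_idc ?cod_idm //.
    by rewrite fc_idc /= fm_idm e.
  by rewrite lower_lc_from_id // hc_idr // (rho_cell_unit H).
Qed.

(** The argument for morphisms, whiskered. *)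
Lemma om2_unique y : dom (src y) = ro i u -> fc q y = b ->
  rc (hc y (idc (rl i u))) Lc = y.
Proof.
move=> dy ey; rewrite /Lc rho_cell_hc.
- by rewrite fc_idc fm_rho_lift_mor.
- by rewrite ey.
- by rewrite src_idc cod_rho_lift_mor.
- rewrite rho_cell_idc ?fm_rho_lift_mor // rho_lift_mor_to_id //
  (rho_cell_unit H) // hc_idr //.
Qed.
End Cell1.
End Om.

Section Cc.
Variables (a b : cell B) (s : mor J).
Hypotheses (e : tgt b = fm q s) (ab : tgt a = src b).

Lemma raise_composable : lc_tgt (unit_cell a) = lc_src (from_unit_cell b).
Proof. by rewrite /= ab. Qed.
Let Rc := lc_vcomp raise_composable.

Lemma raise_s : lc_s Rc = vc a b.
Proof. by rewrite /= vcompE. Qed.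
Lemma raise_t : lc_t Rc = a.
Proof. by rewrite /= vcompE vc_idr. Qed.

Lemma cc_exists x : tgt x = s -> vc a b = fc q x ->
  src (rc x Rc) = src x /\ tgt (rc x Rc) = rm s (cell_sq b) /\
      fc q (rc x Rc) = a /\ vc (rc x Rc) (rlc b s) = x.
Proof.
move=> tx ex; have eR : fc q x = lc_s Rc by rewrite raise_s.
split; [|split; [|split]].
- by rewrite (src_rho_cell rho eR) /= (rho_mor_unit H) // -fc_src -ex src_vc.
- by rewrite (tgt_rho_cell rho eR) tx.
- by rewrite (fc_rho_cell H eR) raise_t.
- have e2 : lc_tgt Rc = lc_src (to_unit_cell b) by [].
  rewrite /rho_lift_cell -(rho_cell_vc rho e2) ?src_idc //; first exact:
    over_to_unit.
  by rewrite raise_to_unit // vc_idr // (rho_cell_unit H).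
Qed.

(** By the unit law y is the value of rho at y and the unit cell of a, and
    rho at the lift of b and [from_unit_cell b] is an identity. *)
Lemma cc_unique y : tgt y = rm s (cell_sq b) -> fc q y = a ->
  rc (vc y (rlc b s)) Rc = y.
Proof.
move=> ty ey; rewrite /Rc rho_cell_vc.
- by rewrite ey.
- by rewrite fc_rho_lift_cell.
- by rewrite src_rho_lift_cell.
- by rewrite (rho_cell_unit H) // rho_lift_cell_from_unit // vc_idr.
Qed.
End Cc.

Lemma right_action_fibration : split_op2fibration (right_cleavage rho).
Proof.
have P : forall i u (e : fo q i = dom u), push (right_cleavage rho) e = ro i u.
  by move=> i u e; rewrite /push cl_mor_right_cleavage cod_rho_lift_mor.
have Q : forall b s (e : tgt b = fm q s),
    pull (right_cleavage rho) e = rm s (cell_sq b).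
  by move=> b s e; rewrite /pull cl_cell_right_cleavage src_rho_lift_cell.
split.
- by move=> i u e; rewrite cl_mor_right_cleavage dom_rho_lift_mor.
- by move=> i u e; rewrite cl_mor_right_cleavage fm_rho_lift_mor.
- by move=> b s e; rewrite cl_cell_right_cleavage tgt_rho_lift_cell.
- by move=> b s e; rewrite cl_cell_right_cleavage fc_rho_lift_cell.
- move=> i u v e e' e1 e2 e3.
  by rewrite (compE e3) !cl_mor_right_cleavage (compE e') P rho_lift_mor_comp.
- by move=> i e; rewrite cl_mor_right_cleavage rho_lift_mor_idm.
- move=> b c s e e' e1 e2 e3.
  by rewrite (vcompE e3) !cl_cell_right_cleavage (vcompE e') Q rho_lift_cell_vc.
- move=> b d s t eb ed e e' e1 e2.
  by rewrite (hcompE e2) !cl_cell_right_cleavage (hcompE e') (compE e)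
    rho_lift_cell_hc.
- by move=> s e; rewrite cl_cell_right_cleavage rho_lift_cell_idc.
- move=> i u e s v ds /is_compP [euv ev].
  case: (om1_exists e euv ds (eq_sym ev)) => h1 [h2 [h3 h4]].
  exists (rm s (sq_comp (lower_composable euv))); split.
    split; first by rewrite P.
    split=> //; split=> //; rewrite cl_mor_right_cleavage.
    by apply: is_comp_cmp => //; rewrite cod_rho_lift_mor.
  move=> w [k1 [k2 [k3]]]; rewrite cl_mor_right_cleavage => /is_compP [k4 ->].
  by apply: om1_unique => //; rewrite k1 P.
- move=> i u e x b dx /is_hcompP [eub eb] v w [v1 [v2 [v3 v4]]]
  [w1 [w2 [w3 w4]]].
  rewrite src_idc in eub.
  case: (om2_exists e eub dx (eq_sym eb)) => h1 [h2 [h3 h4]].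
  rewrite cl_mor_right_cleavage in v4; case: (is_compP v4) => _ sx.
  rewrite cl_mor_right_cleavage in w4; case: (is_compP w4) => _ tx.
  rewrite sx om1_unique // in h1; first by rewrite v1 P.
  rewrite tx om1_unique // in h2; first by rewrite w1 P.
  exists (rc x (lc_hcomp (x := lc_idc (to_id u)) (y := unit_cell b)
  (lower_composable eub))); split.
    split=> //; split=> //; split=> //; rewrite cl_mor_right_cleavage.
    by apply: is_hcomp_hc => //; rewrite h1 v1 P src_idc cod_rho_lift_mor.
  move=> y [k1 [k2 [k3]]]; rewrite cl_mor_right_cleavage => /is_hcompP [k4 ->].
  by apply: om2_unique => //; rewrite k1 v1 P.
- move=> b s e x a tx /is_vcompP [ab eab].
  case: (cc_exists e ab tx (eq_sym eab)) => h1 [h2 [h3 h4]].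
  exists (rc x (lc_vcomp (raise_composable ab))); split.
    split=> //; split; first by rewrite Q.
    split=> //; rewrite cl_cell_right_cleavage; apply: is_vcomp_vc => //.
    by rewrite h2 src_rho_lift_cell.
  move=> y [k1 [k2 [k3]]]; rewrite cl_cell_right_cleavage => /is_vcompP [k4 ->].
  by apply: cc_unique => //; rewrite k2 Q.
Qed.

End FibrationOfAction.

(** * Reversal of squares *)

Section Coop.
Variable C : two_category.

(** The side condition is needed: on morphisms that do not compose the
    arbitrary values differ. *)
Lemma coop_cmp (g f : mor C) : cod f = dom g -> @cmp (coop C) f g = cmp g f.
Proof.
move=> e; have e' : @cod (coop C) g = @dom (coop C) f by [].
by rewrite -(compE e) -(@compE (coop C) _ _ e'); apply: (@comp_congr C).
Qed.
Lemma coop_vc (s t : cell C) : tgt s = src t -> @vc (coop C) t s = vc s t.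
Proof.
move=> e; have e' : @tgt (coop C) t = @src (coop C) s by [].
by rewrite -(vcompE e) -(@vcompE (coop C) _ _ e'); apply: (@vcomp_congr C).
Qed.
Lemma coop_hc (t s : cell C) : cod (src s) = dom (src t) ->
  @hc (coop C) s t = hc t s.
Proof.
move=> e; have e' : @cod (coop C) (@src (coop C) t)
  = @dom (coop C) (@src (coop C) s).
  by rewrite /= -cod_src -dom_src.
by rewrite -(hcompE e) -(@hcompE (coop C) _ _ e'); apply: (@hcomp_congr C).
Qed.

Lemma is_comp_coop (g f h : mor C) :
  is_comp g f h -> @is_comp (coop C) f g h.
Proof. by case=> e <-; exists (eq_sym e); apply: (@comp_congr C). Qed.
Lemma is_comp_uncoop (g f h : mor C) :
  @is_comp (coop C) f g h -> is_comp g f h.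
Proof. by case=> e <-; exists (eq_sym e). Qed.

(** A cell z : t o u0 => u1 o s, read after reversal, is the cell of a
    square from u1 to u0 in which s and t are exchanged. This identifies
    the lax arrow 2-category of the reversed 2-category with the reversed
    lax arrow 2-category, its two projections exchanged. *)
Definition co_sq (m : lax_square C) : lax_square (coop C) :=
  @LaxSquare (coop C) (sq_cod m) (sq_dom m) (sq_t m) (sq_s m) (sq_cell m)
    (is_comp_coop (sq_tgt m)) (is_comp_coop (sq_src m)).
Definition unco_sq (m : lax_square (coop C)) : lax_square C :=
  @LaxSquare C (sq_cod m) (sq_dom m) (sq_t m) (sq_s m) (sq_cell m)
    (is_comp_uncoop (sq_tgt m)) (is_comp_uncoop (sq_src m)).

Lemma co_sqK (m : lax_square C) : unco_sq (co_sq m) = m.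
Proof. exact: sq_ext. Qed.
Lemma unco_sqK (m : lax_square (coop C)) : co_sq (unco_sq m) = m.
Proof. exact: sq_ext. Qed.

Lemma co_lc_eq (x : lax_square_cell C) : exists e1 e2 e3 e4,
  @vcomp (coop C) (sq_cell (co_sq (lc_tgt x)))
    (@hcomp (coop C) (idc (sq_cod (co_sq (lc_tgt x)))) (lc_t x) e1) e2
  = @vcomp (coop C) (@hcomp (coop C) (lc_s x)
      (idc (sq_dom (co_sq (lc_tgt x)))) e3) (sq_cell (co_sq (lc_src x))) e4.
Proof.
have e := lc_eqE x; have d := lc_sq_dom x; have c := lc_sq_cod x.
apply: (@lc_eq_intro (coop C) (co_sq (lc_tgt x)) (co_sq (lc_src x))
  (lc_t x) (lc_s x)) => //=.
- exact: lc_t_tgt.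
- exact: lc_t_src.
- exact: lc_s_tgt.
- exact: lc_s_src.
- rewrite (@coop_hc (lc_t x) (idc (sq_dom (lc_tgt x)))); first by bd.
  rewrite (@coop_hc (idc (sq_cod (lc_tgt x))) (lc_s x)); first by bd.
  rewrite -d -c.
  rewrite !coop_vc; [bd|bd|].
  by rewrite e.
Qed.

Definition co_lc (x : lax_square_cell C) : lax_square_cell (coop C) :=
  @LaxSquareCell (coop C) (co_sq (lc_tgt x)) (co_sq (lc_src x))
    (lc_t x) (lc_s x) (eq_sym (lc_sq_cod x)) (eq_sym (lc_sq_dom x))
    (lc_t_tgt x) (lc_t_src x) (lc_s_tgt x) (lc_s_src x) (co_lc_eq x).

Lemma unco_lc_eq (x : lax_square_cell (coop C)) : exists e1 e2 e3 e4,
  @vcomp C (sq_cell (unco_sq (lc_tgt x)))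
    (@hcomp C (idc (sq_cod (unco_sq (lc_tgt x)))) (lc_t x) e1) e2
  = @vcomp C (@hcomp C (lc_s x)
      (idc (sq_dom (unco_sq (lc_tgt x)))) e3) (sq_cell (unco_sq (lc_src x))) e4.
Proof.
pose m0 := unco_sq (lc_src x); pose m1 := unco_sq (lc_tgt x).
have c : sq_dom m1 = sq_dom m0 := eq_sym (lc_sq_cod x).
have d : sq_cod m1 = sq_cod m0 := eq_sym (lc_sq_dom x).
have s1 : src (lc_s x : cell C) = sq_t m1 := lc_s_tgt x.
have s0 : tgt (lc_s x : cell C) = sq_t m0 := lc_s_src x.
have t1 : src (lc_t x : cell C) = sq_s m1 := lc_t_tgt x.
have t0 : tgt (lc_t x : cell C) = sq_s m0 := lc_t_src x.
apply: (@lc_eq_intro C m1 m0 (lc_t x) (lc_s x)) => //.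
have e : @vc (coop C) (sq_cell m0) (@hc (coop C) (idc (sq_dom m0)) (lc_s x))
   = @vc (coop C) (@hc (coop C) (lc_t x) (idc (sq_cod m0))) (sq_cell m1).
  exact: (lc_eqE x).
have h0 := sq_srcE m0; have h1 := sq_tgtE m0.
have h2 := sq_srcE m1; have h3 := sq_tgtE m1.
have k0 := sq_dom_t m0; have k1 := sq_cod_s m0.
have k2 := sq_dom_t m1; have k3 := sq_cod_s m1.
have g1 : cod (src (idc (sq_dom m0))) = dom (src (lc_s x : cell C)).
  by rewrite src_idc s1; congruence.
have g2 : cod (src (lc_t x : cell C)) = dom (src (idc (sq_cod m0))).
  by rewrite src_idc t1; congruence.
rewrite (coop_hc g1) (coop_hc g2) in e.
rewrite coop_vc in e.
  by rewrite (tgt_hc g1) tgt_idc s0 h0.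
rewrite coop_vc in e.
  by rewrite (src_hc g2) src_idc t1 h3 d.
by rewrite d c e.
Qed.

Definition unco_lc (x : lax_square_cell (coop C)) : lax_square_cell C :=
  @LaxSquareCell C (unco_sq (lc_tgt x)) (unco_sq (lc_src x))
    (lc_t x) (lc_s x) (eq_sym (lc_sq_cod x)) (eq_sym (lc_sq_dom x))
    (lc_t_tgt x) (lc_t_src x) (lc_s_tgt x) (lc_s_src x) (unco_lc_eq x).

Lemma co_lcK (x : lax_square_cell C) : unco_lc (co_lc x) = x.
Proof. by apply: lc_ext => //; apply: co_sqK. Qed.
Lemma unco_lcK (x : lax_square_cell (coop C)) : co_lc (unco_lc x) = x.
Proof. by apply: (@lc_ext (coop C)) => //; apply: unco_sqK. Qed.

Lemma co_sq_id (u : mor C) : co_sq (sq_id u) = @sq_id (coop C) u.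
Proof. exact: (@sq_ext (coop C)). Qed.
Lemma co_lc_idc (m : lax_square C) : co_lc (lc_idc m) = lc_idc (co_sq m).
Proof. exact: (@lc_ext (coop C)). Qed.
Lemma co_sq_comp (n m : lax_square C) (e : sq_cod m = sq_dom n)
  (e' : sq_cod (co_sq n) = sq_dom (co_sq m)) :
  co_sq (sq_comp e) = sq_comp e'.
Proof.
apply: (@sq_ext (coop C)) => //=; try apply: (@comp_congr C) => //.
by apply: (@vcomp_congr C); apply: (@hcomp_congr C).
Qed.
Lemma co_lc_vcomp (x y : lax_square_cell C) (e : lc_tgt x = lc_src y)
  (e' : lc_tgt (co_lc y) = lc_src (co_lc x)) :
  co_lc (lc_vcomp e) = lc_vcomp e'.
Proof. by apply: (@lc_ext (coop C)) => //=; apply: (@vcomp_congr C). Qed.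
Lemma co_lc_hcomp (y x : lax_square_cell C)
  (e : sq_cod (lc_src x) = sq_dom (lc_src y))
  (e' : sq_cod (lc_src (co_lc y)) = sq_dom (lc_src (co_lc x))) :
  co_lc (lc_hcomp e) = lc_hcomp e'.
Proof.
apply: (@lc_ext (coop C)) => /=; try exact: co_sq_comp;
  exact: (@hcomp_congr C).
Qed.
Lemma co_paste (m n : lax_square C) (e : sq_t m = sq_s n)
  (e' : sq_t (co_sq n) = sq_s (co_sq m)) :
  co_sq (paste e) = paste e'.
Proof.
apply: (@sq_ext (coop C)) => //=; try exact: (@comp_congr C).
by apply: (@vcomp_congr C); apply: (@hcomp_congr C).
Qed.
Lemma co_paste_lc (x y : lax_square_cell C) (e : lc_t x = lc_s y)
  (e' : lc_t (co_lc y) = lc_s (co_lc x)) :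
  co_lc (paste_lc e) = paste_lc e'.
Proof. by apply: (@lc_ext (coop C)) => //=; exact: co_paste. Qed.
Lemma co_unit_sq (s : mor C) : co_sq (unit_sq s) = @unit_sq (coop C) s.
Proof. exact: (@sq_ext (coop C)). Qed.
Lemma co_unit_cell (s : cell C) : co_lc (unit_cell s) = @unit_cell (coop C) s.
Proof. by apply: (@lc_ext (coop C)) => //=; exact: co_unit_sq. Qed.
Lemma co_to_id (u : mor C) : co_sq (to_id u) = @from_id (coop C) u.
Proof. exact: (@sq_ext (coop C)). Qed.
Lemma co_from_unit_cell (s : cell C) :
  co_lc (from_unit_cell s) = @to_unit_cell (coop C) s.
Proof.
apply: (@lc_ext (coop C)) => //=.
- by apply: (@sq_ext (coop C)) => //=; rewrite ?dom_src ?cod_src.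
- exact: co_unit_sq.
Qed.

End Coop.

(** * Left actions as right actions of the reversed 2-categories *)

Section LeftRight.
Variables (J A : two_category) (p : two_functor J A).

Let cop := functor_coop p.

Definition flip_ob (x : ob (left_pb p)) : ob (right_pb cop) :=
  exist _ (snd (proj1_sig x), fst (proj1_sig x)) (eq_sym (proj2_sig x)).
Definition flip_mor (x : mor (left_pb p)) : mor (right_pb cop) :=
  exist _ (snd (proj1_sig x), co_sq (fst (proj1_sig x)))
    (eq_sym (proj2_sig x)).
Definition flip_cell (x : cell (left_pb p)) : cell (right_pb cop) :=
  exist _ (snd (proj1_sig x), co_lc (fst (proj1_sig x)))
    (eq_sym (proj2_sig x)).

Definition unflip_ob (x : ob (right_pb cop)) : ob (left_pb p) :=
  exist _ (snd (proj1_sig x), fst (proj1_sig x)) (eq_sym (proj2_sig x)).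
Definition unflip_mor (x : mor (right_pb cop)) : mor (left_pb p) :=
  exist _ (unco_sq (snd (proj1_sig x)), fst (proj1_sig x))
    (eq_sym (proj2_sig x)).
Definition unflip_cell (x : cell (right_pb cop)) : cell (left_pb p) :=
  exist _ (unco_lc (snd (proj1_sig x)), fst (proj1_sig x))
    (eq_sym (proj2_sig x)).

Lemma flip_morK x : unflip_mor (flip_mor x) = x.
Proof. by apply: pb_eq => //; apply: co_sqK. Qed.
Lemma flip_cellK x : unflip_cell (flip_cell x) = x.
Proof. by apply: pb_eq => //; apply: co_lcK. Qed.
Lemma unflip_morK x : flip_mor (unflip_mor x) = x.
Proof. by apply: pb_eq => //; apply: unco_sqK. Qed.
Lemma unflip_cellK x : flip_cell (unflip_cell x) = x.
Proof. by apply: pb_eq => //; apply: unco_lcK. Qed.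

Lemma flip_idm a : flip_mor (idm a) = idm (flip_ob a).
Proof. by apply: pb_eq => //; apply: co_sq_id. Qed.
Lemma flip_idc f : flip_cell (idc f) = idc (flip_mor f).
Proof. by apply: pb_eq => //; apply: co_lc_idc. Qed.
Lemma flip_comp g f (e : cod f = dom g)
  (e' : cod (flip_mor g) = dom (flip_mor f)) :
  flip_mor (comp g f e) = comp (flip_mor f) (flip_mor g) e'.
Proof.
apply: pb_eq => /=; first exact: (@comp_congr J).
exact: co_sq_comp.
Qed.
Lemma flip_vcomp s t (e : tgt s = src t)
  (e' : tgt (flip_cell t) = src (flip_cell s)) :
  flip_cell (vcomp s t e) = vcomp (flip_cell t) (flip_cell s) e'.
Proof.
apply: pb_eq => /=; first exact: (@vcomp_congr J).
exact: co_lc_vcomp.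
Qed.
Lemma flip_hcomp t s (e : cod (src s) = dom (src t))
  (e' : cod (src (flip_cell t)) = dom (src (flip_cell s))) :
  flip_cell (hcomp t s e) = hcomp (flip_cell s) (flip_cell t) e'.
Proof.
apply: pb_eq => /=; first exact: (@hcomp_congr J).
exact: co_lc_hcomp.
Qed.

Section LeftOfRight.
Variable rho : two_functor (right_pb cop) (coop J).

(** Reversing morphisms and cells in the source and in the target of a
    2-functor leaves its values unchanged, so a right action for the
    reversed p is a left action for p. *)
Definition left_of_right : two_functor (left_pb p) J.
Proof.
refine (@TwoFunctor (left_pb p) J (fun x => fo rho (flip_ob x))
  (fun x => fm rho (flip_mor x)) (fun x => fc rho (flip_cell x))
  _ _ _ _ _ _ _ _ _).
- by move=> f; refine (eq_trans (@fm_cod _ _ rho (flip_mor f)) _);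
  congr (fo rho _); apply: pb_eq.
- by move=> f; refine (eq_trans (@fm_dom _ _ rho (flip_mor f)) _);
  congr (fo rho _); apply: pb_eq.
- by move=> f; refine (eq_trans (@fc_tgt _ _ rho (flip_cell f)) _);
  congr (fm rho _); apply: pb_eq.
- by move=> f; refine (eq_trans (@fc_src _ _ rho (flip_cell f)) _);
  congr (fm rho _); apply: pb_eq.
- by move=> a; rewrite flip_idm fm_idm.
- move=> g f e e'.
  have c : cod (flip_mor g) = dom (flip_mor f) by apply: pb_eq;
    [exact: (eq_sym (pb_snd e))|exact: (eq_sym (pb_fst e))].
  have c' : @cod (coop J) (fm rho (flip_mor g))
    = @dom (coop J) (fm rho (flip_mor f)) by exact: (eq_sym e').
  rewrite (flip_comp e c) (fm_comp rho c c'); exact: (@comp_congr J).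
- by move=> f; rewrite flip_idc fc_idc.
- move=> s t e e'.
  have c : tgt (flip_cell t) = src (flip_cell s) by apply: pb_eq;
    [exact: (eq_sym (pb_snd e))|exact:
    (f_equal (@co_sq A) (eq_sym (pb_fst e)))].
  have c' : @tgt (coop J) (fc rho (flip_cell t))
    = @src (coop J) (fc rho (flip_cell s)) by exact: (eq_sym e').
  rewrite (flip_vcomp e c) (fc_vcomp rho c c'); exact: (@vcomp_congr J).
- move=> t s e e'.
  have e2 : cod (tgt s) = dom (tgt t) by rewrite -cod_src -dom_src.
  have c : cod (src (flip_cell t)) = dom (src (flip_cell s)).
    by apply: pb_eq; [exact: (eq_sym (pb_snd e2))|exact: (eq_sym (pb_fst e2))].
  have c' : @cod (coop J) (@src (coop J) (fc rho (flip_cell t)))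
    = @dom (coop J) (@src (coop J) (fc rho (flip_cell s))).
    by rewrite !fc_src fm_cod fm_dom c.
  rewrite (flip_hcomp e c) (fc_hcomp rho c c'); exact: (@hcomp_congr J).
Defined.
End LeftOfRight.
End LeftRight.

Section RightOfLeft.
Variables (J A : two_category) (p : two_functor J A).

Notation cop := (functor_coop p).

Lemma unflip_idm a : unflip_mor (idm a) = idm (unflip_ob a :> ob (left_pb p)).
Proof.
rewrite -(flip_morK (idm _)) flip_idm; congr unflip_mor.
by congr (idm _); apply: pb_eq.
Qed.
Lemma unflip_idc (f : mor (right_pb cop)) :
  unflip_cell (idc f) = idc (unflip_mor f).
Proof. by rewrite -(flip_cellK (idc _)) flip_idc unflip_morK. Qed.
Lemma unflip_comp (g f : mor (right_pb cop)) (e : cod f = dom g)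
  (e' : cod (unflip_mor g) = dom (unflip_mor f)) :
  unflip_mor (comp g f e) = comp (unflip_mor f) (unflip_mor g) e'.
Proof.
rewrite -(flip_morK (comp _ _ e')).
have c : cod (flip_mor (unflip_mor f)) = dom (flip_mor (unflip_mor g)).
  by rewrite !unflip_morK.
rewrite (flip_comp e' c); congr unflip_mor.
by apply: comp_congr; rewrite unflip_morK.
Qed.
Lemma unflip_vcomp (s t : cell (right_pb cop)) (e : tgt s = src t)
  (e' : tgt (unflip_cell t) = src (unflip_cell s)) :
  unflip_cell (vcomp s t e) = vcomp (unflip_cell t) (unflip_cell s) e'.
Proof.
rewrite -(flip_cellK (vcomp _ _ e')).
have c : tgt (flip_cell (unflip_cell s)) = src (flip_cell (unflip_cell t)).
  by rewrite !unflip_cellK.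
rewrite (flip_vcomp e' c); congr unflip_cell.
by apply: vcomp_congr; rewrite unflip_cellK.
Qed.
Lemma unflip_hcomp (t s : cell (right_pb cop)) (e : cod (src s) = dom (src t))
  (e' : cod (src (unflip_cell t)) = dom (src (unflip_cell s))) :
  unflip_cell (hcomp t s e) = hcomp (unflip_cell s) (unflip_cell t) e'.
Proof.
rewrite -(flip_cellK (hcomp _ _ e')).
have c : cod (src (flip_cell (unflip_cell s)))
    = dom (src (flip_cell (unflip_cell t))).
  by rewrite !unflip_cellK.
rewrite (flip_hcomp e' c); congr unflip_cell.
by apply: hcomp_congr; rewrite unflip_cellK.
Qed.

Variable lam : two_functor (left_pb p) J.

Definition right_of_left : two_functor (right_pb cop) (coop J).
Proof.
refine (@TwoFunctor (right_pb cop) (coop J) (fun x => fo lam (unflip_ob x))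
  (fun x => fm lam (unflip_mor x)) (fun x => fc lam (unflip_cell x))
  _ _ _ _ _ _ _ _ _).
- by move=> f; refine (eq_trans (@fm_cod _ _ lam (unflip_mor f)) _);
  congr (fo lam _); apply: pb_eq.
- by move=> f; refine (eq_trans (@fm_dom _ _ lam (unflip_mor f)) _);
  congr (fo lam _); apply: pb_eq.
- by move=> f; refine (eq_trans (@fc_tgt _ _ lam (unflip_cell f)) _);
  congr (fm lam _); apply: pb_eq.
- by move=> f; refine (eq_trans (@fc_src _ _ lam (unflip_cell f)) _);
  congr (fm lam _); apply: pb_eq.
- by move=> a; rewrite unflip_idm fm_idm.
- move=> g f e e'.
  have c : cod (unflip_mor g) = dom (unflip_mor f) by apply: pb_eq;
    [exact: (eq_sym (pb_snd e))|exact: (eq_sym (pb_fst e))].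
  have c' : cod (fm lam (unflip_mor g)) = dom (fm lam (unflip_mor f)) by exact:
    (eq_sym e').
  rewrite (unflip_comp e c) (fm_comp lam c c'); exact: (@comp_congr J).
- by move=> f; rewrite unflip_idc fc_idc.
- move=> s t e e'.
  have c : tgt (unflip_cell t) = src (unflip_cell s) by apply: pb_eq;
    [exact: (f_equal (@unco_sq A) (eq_sym (pb_snd e)))|exact:
    (eq_sym (pb_fst e))].
  have c' : tgt (fc lam (unflip_cell t))
    = src (fc lam (unflip_cell s)) by exact: (eq_sym e').
  rewrite (unflip_vcomp e c) (fc_vcomp lam c c'); exact: (@vcomp_congr J).
- move=> t s e e'.
  have e2 : cod (tgt s) = dom (tgt t) by rewrite -cod_src -dom_src.
  have c : cod (src (unflip_cell t)) = dom (src (unflip_cell s)).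
    by apply: pb_eq; [exact: (eq_sym (pb_snd e2))|exact: (eq_sym (pb_fst e2))].
  have c' : cod (src (fc lam (unflip_cell t)))
    = dom (src (fc lam (unflip_cell s))).
    by rewrite !fc_src fm_cod fm_dom c.
  rewrite (unflip_hcomp e c) (fc_hcomp lam c c'); exact: (@hcomp_congr J).
Defined.
End RightOfLeft.

Section LeftAction.
Variables (J A : two_category) (p : two_functor J A).
Notation cop := (functor_coop p).

(** The part of the structure of an internal two-sided fibration that
    concerns p alone. *)
Record left_action (lam : two_functor (left_pb p) J) : Prop := LeftAction {
  la_src : p \of lam =2f arrow_src A \of pb_pr1 (arrow_tgt A) p;
  la_assoc :
    lam \of pb_map (arrow_comp_tgt A) (functor_comp_id p)
    =2f lam \of pb_map (functor_comp_id (arrow_tgt A)) la_src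
          \of pb_assoc (arrow_tgt A) (arrow_src A) (arrow_tgt A) p;
  la_unit : lam \of pb_pair (unit_left_subproof p) =2f functor_id J
}.

Section ToRight.
Variable lam : two_functor (left_pb p) J.
Hypothesis H : left_action lam.

Lemma lam_assoc_ob x :
  fo lam (fo (pb_map (arrow_comp_tgt A) (functor_comp_id p)) x)
  = fo lam (fo (pb_map (functor_comp_id (arrow_tgt A)) (la_src H))
     (fo (pb_assoc (arrow_tgt A) (arrow_src A) (arrow_tgt A) p) x)).
Proof. exact: (eq_fo (la_assoc H) x). Qed.
Lemma lam_assoc_mor x :
  fm lam (fm (pb_map (arrow_comp_tgt A) (functor_comp_id p)) x)
  = fm lam (fm (pb_map (functor_comp_id (arrow_tgt A)) (la_src H))
     (fm (pb_assoc (arrow_tgt A) (arrow_src A) (arrow_tgt A) p) x)).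
Proof. exact: (eq_fm (la_assoc H) x). Qed.
Lemma lam_assoc_cell x :
  fc lam (fc (pb_map (arrow_comp_tgt A) (functor_comp_id p)) x)
  = fc lam (fc (pb_map (functor_comp_id (arrow_tgt A)) (la_src H))
     (fc (pb_assoc (arrow_tgt A) (arrow_src A) (arrow_tgt A) p) x)).
Proof. exact: (eq_fc (la_assoc H) x). Qed.

Lemma right_of_left_over :
  cop \of right_of_left lam =2f arrow_tgt (coop A) \of pb_pr2 cop
    (arrow_src (coop A)).
Proof.
split=> x.
- exact: (eq_fo (la_src H) (unflip_ob x)).
- exact: (eq_fm (la_src H) (unflip_mor x)).
- exact: (eq_fc (la_src H) (unflip_cell x)).
Qed.

Lemma right_of_left_action : right_action (right_of_left lam).
Proof.
apply: (RightAction (ra_tgt := right_of_left_over)).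
(* Reversal also reverses the order of pasting, so the two sides of
   associativity correspond with n and m exchanged. *)
- split=> x.
  + pose x1 := fst (proj1_sig x).
    pose j := fst (proj1_sig x1); pose m := snd (proj1_sig x1).
    pose n := snd (proj1_sig x).
    have e1 : cod (n : mor A) = dom (m : mor A) := eq_sym (proj2_sig x).
    have e2 : cod (m : mor A) = fo p j := eq_sym (proj2_sig x1).
    refine (eq_trans (eq_trans _
      (lam_assoc_ob (exist _ (exist _ (n, m) e1, j) e2))) _).
    * refine (@f_equal _ _ (fo lam) (unflip_ob _) _ _).
      apply: pb_eq; [exact: (@comp_congr A)|exact: eq_refl].
    * refine (@f_equal _ _ (fo lam) _ (unflip_ob _) _).
      apply: pb_eq; first exact: eq_refl.
      refine (@f_equal _ _ (fo lam) (exist _ (m, j) _) (unflip_ob x1) _).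
      exact: pb_eq.
  + pose x1 := fst (proj1_sig x).
    pose j := fst (proj1_sig x1); pose m := snd (proj1_sig x1).
    pose n := snd (proj1_sig x).
    have e1 : sq_t (unco_sq n) = sq_s (unco_sq m) := eq_sym (proj2_sig x).
    have e2 : sq_t (unco_sq m) = fm p j := eq_sym (proj2_sig x1).
    refine (eq_trans (eq_trans _
      (lam_assoc_mor (exist _ (exist _ (unco_sq n, unco_sq m) e1, j) e2))) _).
    * refine (@f_equal _ _ (fm lam) (unflip_mor _) _ _).
      apply: pb_eq; [|exact: eq_refl].
      refine (eq_trans _ (co_sqK _)).
      refine (@f_equal _ _ (@unco_sq A) _ (co_sq (paste _)) _).
      rewrite (co_paste _ (n := unco_sq m) (m := unco_sq n) (eq_sym e1)).
      by apply: paste_congr; rewrite unco_sqK.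
    * refine (@f_equal _ _ (fm lam) _ (unflip_mor _) _).
      apply: pb_eq; first exact: eq_refl.
      refine (@f_equal _ _ (fm lam) (exist _ (unco_sq m, j) _) (unflip_mor x1)
        _).
      exact: pb_eq.
  + pose x1 := fst (proj1_sig x).
    pose j := fst (proj1_sig x1); pose m := snd (proj1_sig x1).
    pose n := snd (proj1_sig x).
    have e1 : lc_t (unco_lc n) = lc_s (unco_lc m) := eq_sym (proj2_sig x).
    have e2 : lc_t (unco_lc m) = fc p j := eq_sym (proj2_sig x1).
    refine (eq_trans (eq_trans _
      (lam_assoc_cell (exist _ (exist _ (unco_lc n, unco_lc m) e1, j) e2))) _).
    * refine (@f_equal _ _ (fc lam) (unflip_cell _) _ _).
      apply: pb_eq; [|exact: eq_refl].
      refine (eq_trans _ (co_lcK _)).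
      refine (@f_equal _ _ (@unco_lc A) _ (co_lc (paste_lc _)) _).
      rewrite (co_paste_lc _ (y := unco_lc m) (x := unco_lc n) (eq_sym e1)).
      by apply: paste_lc_congr; rewrite unco_lcK.
    * refine (@f_equal _ _ (fc lam) _ (unflip_cell _) _).
      apply: pb_eq; first exact: eq_refl.
      refine (@f_equal _ _ (fc lam) (exist _ (unco_lc m, j) _) (unflip_cell x1)
        _).
      exact: pb_eq.
- split=> x.
  + refine (eq_trans _ (eq_fo (la_unit H) x)).
    refine (@f_equal _ _ (fo lam) (unflip_ob _) _ _); exact: pb_eq.
  + refine (eq_trans _ (eq_fm (la_unit H) x)).
    refine (@f_equal _ _ (fm lam) (unflip_mor _) _ _).
    apply: pb_eq; last exact: eq_refl.
    refine (eq_trans _ (co_sqK _)).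
    refine (@f_equal _ _ (@unco_sq A) _ (co_sq (unit_sq _)) _).
    by rewrite co_unit_sq.
  + refine (eq_trans _ (eq_fc (la_unit H) x)).
    refine (@f_equal _ _ (fc lam) (unflip_cell _) _ _).
    apply: pb_eq; last exact: eq_refl.
    refine (eq_trans _ (co_lcK _)).
    refine (@f_equal _ _ (@unco_lc A) _ (co_lc (unit_cell _)) _).
    by rewrite co_unit_cell.
Qed.
End ToRight.

Section ToLeft.
Variable rho : two_functor (right_pb cop) (coop J).
Hypothesis H : right_action rho.
Notation lam := (left_of_right rho).

Lemma left_of_right_over :
  p \of lam =2f arrow_src A \of pb_pr1 (arrow_tgt A) p.
Proof.
split=> x.
- exact: (eq_fo (ra_tgt H) (flip_ob x)).
- exact: (eq_fm (ra_tgt H) (flip_mor x)).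
- exact: (eq_fc (ra_tgt H) (flip_cell x)).
Qed.

Lemma left_of_right_assoc_ob (n m : mor A) j
  (e1 : cod n = dom m) (e2 : cod m = fo p j) (e3 : cod (comp m n e1) = fo p j)
  (e4 : cod n = fo p (fo lam (exist _ (m, j) e2))) :
  fo lam (exist _ (comp m n e1, j) e3)
  = fo lam (exist _ (n, fo lam (exist _ (m, j) e2)) e4).
Proof.
have e1' : @cod (coop A) m = @dom (coop A) n := eq_sym e1.
have e2' : fo cop j = @dom (coop A) m := eq_sym e2.
have c : @cmp (coop A) n m = comp m n e1 by rewrite coop_cmp // compE.
have h := rho_ob_paste H e2' e1'; rewrite c in h.
refine (eq_trans (rho_obE rho (flip_ob (exist _ (comp m n e1, j) e3)))
  (eq_trans h _)).
have -> : rho_ob rho j m = fo lam (exist _ (m, j) e2)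
  := eq_sym (rho_obE rho (flip_ob (exist _ (m, j) e2))).
exact: (eq_sym (rho_obE rho (flip_ob (exist _ (n, _) e4)))).
Qed.

Lemma left_of_right_assoc_mor (n m : lax_square A) j
  (e1 : sq_t n = sq_s m) (e2 : sq_t m = fm p j) (e3 : sq_t (paste e1) = fm p j)
  (e4 : sq_t n = fm p (fm lam (exist _ (m, j) e2))) :
  fm lam (exist _ (paste e1, j) e3)
  = fm lam (exist _ (n, fm lam (exist _ (m, j) e2)) e4).
Proof.
have e1' : sq_t (co_sq m) = sq_s (co_sq n) := eq_sym e1.
have e2' : fm cop j = sq_s (co_sq m) := eq_sym e2.
have h := rho_mor_paste H e1' e2'; rewrite -(co_paste e1 e1') in h.
refine (eq_trans (rho_morE rho (flip_mor (exist _ (paste e1, j) e3)))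
  (eq_trans h _)).
have -> : rho_mor rho j (co_sq m) = fm lam (exist _ (m, j) e2)
  := eq_sym (rho_morE rho (flip_mor (exist _ (m, j) e2))).
exact: (eq_sym (rho_morE rho (flip_mor (exist _ (n, _) e4)))).
Qed.

Lemma left_of_right_assoc_cell (n m : lax_square_cell A) j
  (e1 : lc_t n = lc_s m) (e2 : lc_t m = fc p j) (e3 : lc_t (paste_lc e1)
    = fc p j)
  (e4 : lc_t n = fc p (fc lam (exist _ (m, j) e2))) :
  fc lam (exist _ (paste_lc e1, j) e3)
  = fc lam (exist _ (n, fc lam (exist _ (m, j) e2)) e4).
Proof.
have e1' : lc_t (co_lc m) = lc_s (co_lc n) := eq_sym e1.
have e2' : fc cop j = lc_s (co_lc m) := eq_sym e2.
have h := rho_cell_paste H e1' e2'; rewrite -(co_paste_lc e1 e1') in h.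
refine (eq_trans (rho_cellE rho (flip_cell (exist _ (paste_lc e1, j) e3)))
  (eq_trans h _)).
have -> : rho_cell rho j (co_lc m) = fc lam (exist _ (m, j) e2)
  := eq_sym (rho_cellE rho (flip_cell (exist _ (m, j) e2))).
exact: (eq_sym (rho_cellE rho (flip_cell (exist _ (n, _) e4)))).
Qed.

Lemma left_of_right_assoc :
  lam \of pb_map (arrow_comp_tgt A) (functor_comp_id p)
  =2f lam \of pb_map (functor_comp_id (arrow_tgt A)) left_of_right_over
          \of pb_assoc (arrow_tgt A) (arrow_src A) (arrow_tgt A) p.
Proof.
split=> -[[[[n m] e1] j] e2].
- have e3 : cod (comp m n e1) = fo p j by rewrite cod_comp.
  have e4 : cod n = fo p (fo lam (exist _ (m, j) e2)).
    exact: (eq_trans e1 (eq_sym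
      (eq_fo left_of_right_over (exist _ (m, j) e2)))).
  refine (eq_trans (@f_equal _ _ (fo lam) _ (exist _ (comp m n e1, j) e3) _)
    (eq_trans (left_of_right_assoc_ob e3 e4)
      (@f_equal _ _ (fo lam) (exist _ (n, fo lam (exist _ (m, j) e2)) e4) _
        _))).
  + by apply: pb_eq.
  + apply: pb_eq; first exact: eq_refl.
    refine (@f_equal _ _ (fo lam) _ (exist _ (m, j) _) _); exact: pb_eq.
- have e3 : sq_t (paste e1) = fm p j by [].
  have e4 : sq_t n = fm p (fm lam (exist _ (m, j) e2)).
    exact: (eq_trans e1 (eq_sym
      (eq_fm left_of_right_over (exist _ (m, j) e2)))).
  refine (eq_trans (@f_equal _ _ (fm lam) _ (exist _ (paste e1, j) e3) _)
    (eq_trans (left_of_right_assoc_mor e3 e4)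
      (@f_equal _ _ (fm lam) (exist _ (n, fm lam (exist _ (m, j) e2)) e4) _
        _))).
  + by apply: pb_eq.
  + apply: pb_eq; first exact: eq_refl.
    refine (@f_equal _ _ (fm lam) _ (exist _ (m, j) _) _); exact: pb_eq.
- have e3 : lc_t (paste_lc e1) = fc p j by [].
  have e4 : lc_t n = fc p (fc lam (exist _ (m, j) e2)).
    exact: (eq_trans e1 (eq_sym
      (eq_fc left_of_right_over (exist _ (m, j) e2)))).
  refine (eq_trans (@f_equal _ _ (fc lam) _ (exist _ (paste_lc e1, j) e3) _)
    (eq_trans (left_of_right_assoc_cell e3 e4)
      (@f_equal _ _ (fc lam) (exist _ (n, fc lam (exist _ (m, j) e2)) e4) _
        _))).
  + by apply: pb_eq.
  + apply: pb_eq; first exact: eq_refl.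
    refine (@f_equal _ _ (fc lam) _ (exist _ (m, j) _) _); exact: pb_eq.
Qed.

Lemma left_of_right_unit :
  lam \of pb_pair (unit_left_subproof p) =2f functor_id J.
Proof.
split=> x.
- refine (eq_trans (rho_obE rho
  (flip_ob (fo (pb_pair (unit_left_subproof p)) x))) _).
  exact: (rho_ob_unit H).
- refine (eq_trans (rho_morE rho
  (flip_mor (fm (pb_pair (unit_left_subproof p)) x)))
    (eq_trans _ (rho_mor_unit H (f := x) eq_refl))).
  refine (@f_equal _ _ (rho_mor rho x) (co_sq _) _ _); exact: co_unit_sq.
- refine (eq_trans (rho_cellE rho
  (flip_cell (fc (pb_pair (unit_left_subproof p)) x)))
    (eq_trans _ (rho_cell_unit H (s := x) eq_refl))).
  refine (@f_equal _ _ (rho_cell rho x) (co_lc _) _ _); exact: co_unit_cell.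
Qed.

Lemma left_of_right_action : left_action lam.
Proof. exact: (LeftAction left_of_right_assoc left_of_right_unit). Qed.
End ToLeft.
End LeftAction.

(** * The cleavage of a left action *)

Lemma cleavage_ext (J B : two_category) (q : two_functor J B)
  (R R' : cleavage q) : cleavage_eq R R' -> R = R'.
Proof.
case: R R' => [r1 r2] [r1' r2'] [/= h1 h2].
have -> : r1 = r1'.
  by do 3 (apply: functional_extensionality_dep => ?); apply: h1.
have -> // : r2 = r2'.
by do 3 (apply: functional_extensionality_dep => ?); apply: h2.
Qed.

Section LeftCleavage.
Variables (J A : two_category) (p : two_functor J A).
Notation cop := (functor_coop p).

(** Reversal exchanges the two degenerate squares of a morphism, and
    likewise of a cell. *)
Lemma right_cleavage_of_left (lam : two_functor (left_pb p) J) :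
  right_cleavage (right_of_left lam) = left_cleavage lam.
Proof.
apply: cleavage_ext; split=> [i u e|b s e].
- refine (@f_equal _ _ (fm lam) (unflip_mor _) _ _).
  apply: pb_eq; last exact: eq_refl.
  refine (eq_trans (@f_equal _ _ (@unco_sq A) (from_id _) _ _) (co_sqK _)).
  by rewrite co_to_id.
- refine (@f_equal _ _ (fc lam) (unflip_cell _) _ _).
  apply: pb_eq; last exact: eq_refl.
  refine (eq_trans (@f_equal _ _ (@unco_lc A) (to_unit_cell _) _ _) (co_lcK _)).
  by rewrite co_from_unit_cell.
Qed.

Lemma left_cleavage_of_right (rho : two_functor (right_pb cop) (coop J)) :
  left_cleavage (left_of_right rho) = right_cleavage rho.
Proof.
apply: cleavage_ext; split=> [i u e|b s e].
- refine (@f_equal _ _ (fm rho) (flip_mor _) _ _).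
  apply: pb_eq; first exact: eq_refl.
  exact: co_to_id.
- refine (@f_equal _ _ (fc rho) (flip_cell _) _ _).
  apply: pb_eq; first exact: eq_refl.
  exact: co_from_unit_cell.
Qed.

Lemma left_action_fibration (lam : two_functor (left_pb p) J) :
  left_action lam -> split_co2fibration (left_cleavage lam).
Proof.
move=> h; rewrite /split_co2fibration -right_cleavage_of_left.
exact: (right_action_fibration (right_of_left_action h)).
Qed.

End LeftCleavage.

(** * Commuting actions *)

Section LamRho.
Variables (A B J : two_category) (p : two_functor J A) (q : two_functor J B).
Variables (lam : two_functor (left_pb p) J) (rho : two_functor (right_pb q) J).
Hypothesis lq : q \of lam =2f q \of pb_pr2 (arrow_tgt A) p.
Hypothesis rp : p \of rho =2f p \of pb_pr1 q (arrow_src B).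

Definition actions_commute : Prop :=
  rho \of pb_map lq (functor_comp_id (arrow_src B))
    =2f lam \of pb_map (functor_comp_id (arrow_tgt A)) rp
          \of pb_assoc (arrow_tgt A) p q (arrow_src B).

Section FromCommute.
Hypothesis H : actions_commute.

Lemma commute_ob (u : mor A) (i : ob J) (v : mor B)
  (e1 : cod u = fo p i) (e2 : fo q i = dom v)
  (e3 : fo q (fo lam (exist _ (u, i) e1)) = dom v)
  (e4 : cod u = fo p (fo rho (exist _ (i, v) e2))) :
  fo rho (exist _ (fo lam (exist _ (u, i) e1), v) e3)
  = fo lam (exist _ (u, fo rho (exist _ (i, v) e2)) e4).
Proof.
refine (eq_trans (eq_trans (@f_equal _ _ (fo rho) _ _ _)
  (eq_fo H (exist _ (exist _ (u, i) e1, v) e2)))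
  (@f_equal _ _ (fo lam) _ _ _)).
- by apply: pb_eq.
- apply: pb_eq; first exact: eq_refl.
  refine (@f_equal _ _ (fo rho) (exist _ (i, v) _) _ _); exact: pb_eq.
Qed.
Lemma commute_mor (m : lax_square A) (f : mor J) (n : lax_square B)
  (e1 : sq_t m = fm p f) (e2 : fm q f = sq_s n)
  (e3 : fm q (fm lam (exist _ (m, f) e1)) = sq_s n)
  (e4 : sq_t m = fm p (fm rho (exist _ (f, n) e2))) :
  fm rho (exist _ (fm lam (exist _ (m, f) e1), n) e3)
  = fm lam (exist _ (m, fm rho (exist _ (f, n) e2)) e4).
Proof.
refine (eq_trans (eq_trans (@f_equal _ _ (fm rho) _ _ _)
  (eq_fm H (exist _ (exist _ (m, f) e1, n) e2)))
  (@f_equal _ _ (fm lam) _ _ _)).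
- by apply: pb_eq.
- apply: pb_eq; first exact: eq_refl.
  refine (@f_equal _ _ (fm rho) (exist _ (f, n) _) _ _); exact: pb_eq.
Qed.
Lemma commute_cell (x : lax_square_cell A) (s : cell J) (y : lax_square_cell B)
  (e1 : lc_t x = fc p s) (e2 : fc q s = lc_s y)
  (e3 : fc q (fc lam (exist _ (x, s) e1)) = lc_s y)
  (e4 : lc_t x = fc p (fc rho (exist _ (s, y) e2))) :
  fc rho (exist _ (fc lam (exist _ (x, s) e1), y) e3)
  = fc lam (exist _ (x, fc rho (exist _ (s, y) e2)) e4).
Proof.
refine (eq_trans (eq_trans (@f_equal _ _ (fc rho) _ _ _)
  (eq_fc H (exist _ (exist _ (x, s) e1, y) e2)))
  (@f_equal _ _ (fc lam) _ _ _)).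
- by apply: pb_eq.
- apply: pb_eq; first exact: eq_refl.
  refine (@f_equal _ _ (fc rho) (exist _ (s, y) _) _ _); exact: pb_eq.
Qed.
End FromCommute.

Lemma commute_intro :
  (forall u i v e1 e2 e3 e4,
    fo rho (exist _ (fo lam (exist _ (u, i) e1), v) e3)
    = fo lam (exist _ (u, fo rho (exist _ (i, v) e2)) e4)) ->
  (forall m f n e1 e2 e3 e4,
    fm rho (exist _ (fm lam (exist _ (m, f) e1), n) e3)
    = fm lam (exist _ (m, fm rho (exist _ (f, n) e2)) e4)) ->
  (forall x s y e1 e2 e3 e4,
    fc rho (exist _ (fc lam (exist _ (x, s) e1), y) e3)
    = fc lam (exist _ (x, fc rho (exist _ (s, y) e2)) e4)) ->
  actions_commute.
Proof.
move=> ho hm hc; split=> -[[[[u i] e1] v] e2].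
- have e3 := eq_trans (eq_fo lq (exist _ (u, i) e1)) e2.
  have e4 := eq_trans e1 (eq_sym (eq_fo rp (exist _ (i, v) e2))).
  refine (eq_trans (eq_trans (@f_equal _ _ (fo rho) _ _ _)
    (ho u i v e1 e2 e3 e4)) (@f_equal _ _ (fo lam) _ _ _)).
  + by apply: pb_eq.
  + apply: pb_eq; first exact: eq_refl.
    refine (@f_equal _ _ (fo rho) _ (exist _ (i, v) _) _); exact: pb_eq.
- have e3 := eq_trans (eq_fm lq (exist _ (u, i) e1)) e2.
  have e4 := eq_trans e1 (eq_sym (eq_fm rp (exist _ (i, v) e2))).
  refine (eq_trans (eq_trans (@f_equal _ _ (fm rho) _ _ _)
    (hm u i v e1 e2 e3 e4)) (@f_equal _ _ (fm lam) _ _ _)).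
  + by apply: pb_eq.
  + apply: pb_eq; first exact: eq_refl.
    refine (@f_equal _ _ (fm rho) _ (exist _ (i, v) _) _); exact: pb_eq.
- have e3 := eq_trans (eq_fc lq (exist _ (u, i) e1)) e2.
  have e4 := eq_trans e1 (eq_sym (eq_fc rp (exist _ (i, v) e2))).
  refine (eq_trans (eq_trans (@f_equal _ _ (fc rho) _ _ _)
    (hc u i v e1 e2 e3 e4)) (@f_equal _ _ (fc lam) _ _ _)).
  + by apply: pb_eq.
  + apply: pb_eq; first exact: eq_refl.
    refine (@f_equal _ _ (fc rho) _ (exist _ (i, v) _) _); exact: pb_eq.
Qed.
End LamRho.

(** * From commuting actions to compatible cleavages *)

Section VerticalArguments.
Variables (J B : two_category) (q : two_functor J B).
Variable rho : two_functor (right_pb q) J.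
Hypothesis H : right_action rho.
Notation ro := (rho_ob rho).
Notation rm := (rho_mor rho).
Notation rc := (rho_cell rho).
Notation rl := (rho_lift_mor rho).
Notation rlc := (rho_lift_cell rho).

Section Mor.
Variables (f : mor J) (v : mor B).
Hypothesis e : fm q f = idm (dom v).

(** The degenerate square of v factors through itself after an identity and
    before an identity. The two factorizations, with f put in the first or
    in the second factor, compute the same value of rho; this and the next
    lemma give the two sides of (cl). *)
Lemma rho_mor_from_id_cod : rm f (from_id v) = cmp (rl (cod f) v) f.
Proof.
have ec : fo q (cod f) = dom v by rewrite -fm_cod e cod_idm.
have e1 : sq_cod (unit_sq (idm (dom v))) = sq_dom (from_id v).
  by rewrite /= cod_idm.
have eu : fm q f = sq_s (unit_sq (idm (dom v))) by rewrite e.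
have es : sq_comp e1 = from_id v.
  have e2 : sq_cod (sq_id (idm (dom v))) = sq_dom (from_id v) by [].
  rewrite -[RHS](sq_comp_idr e2); apply: sq_comp_congr => //.
  by apply: sq_ext; rewrite /= ?dom_idm ?cod_idm.
rewrite -{1}(cmp_idl (f := f) (b := cod f)) // -es rho_mor_cmp ?dom_idm //.
  exact: over_from_id.
by rewrite (rho_mor_unit H).
Qed.

Lemma rho_mor_from_id_dom :
  rm f (from_id v) = cmp (rm f (sq_id v)) (rl (dom f) v).
Proof.
have ed : fo q (dom f) = dom v by rewrite -fm_dom e dom_idm.
have e1 : sq_cod (from_id v) = sq_dom (sq_id v) by [].
rewrite -{1}(cmp_idr (f := f) (a := dom f)) // -(sq_comp_idl e1) rho_mor_cmp
  ?cod_idm //.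
exact: over_from_id.
Qed.
End Mor.

Section Cell.
Variables (s : cell J) (b : cell B).
Hypothesis e : fc q s = idc (tgt b).

(** The same double evaluation for a cell, giving the two sides of the
    compatibility of the cell lifts of the two legs. *)
Lemma rho_cell_to_unit_tgt : rc s (to_unit_cell b) = vc (rlc b (src s)) s.
Proof.
have es : tgt b = fm q (src s) by rewrite -fc_src e src_idc.
have e1 : lc_tgt (to_unit_cell b) = lc_src (unit_cell (idc (tgt b))).
  by rewrite /= src_idc.
have eE : lc_vcomp e1 = to_unit_cell b.
  apply: lc_ext; rewrite //= ?tgt_idc // vcompE ?vc_idr //.
  by rewrite tgt_idc.
rewrite -{1}(vc_idl (s := s) (f := src s)) // -eE rho_cell_vc ?tgt_idc //.
  exact: over_to_unit.
by rewrite (rho_cell_unit H).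
Qed.

Lemma rho_cell_to_unit_src :
  rc s (to_unit_cell b) = vc (rc s (lc_idc (cell_sq b))) (rlc b (tgt s)).
Proof.
have et : tgt b = fm q (tgt s) by rewrite -fc_tgt e tgt_idc.
have e1 : lc_tgt (lc_idc (cell_sq b)) = lc_src (to_unit_cell b) by [].
have eE : lc_vcomp e1 = to_unit_cell b.
  by apply: lc_ext; rewrite //= vcompE vc_idl ?src_idc.
rewrite -{1}(vc_idr (s := s) (f := tgt s)) // -eE rho_cell_vc ?src_idc //.
exact: over_to_unit.
Qed.
End Cell.
End VerticalArguments.

Section TwoSidedOfActions.
Variables (A B J : two_category) (p : two_functor J A) (q : two_functor J B).
Variables (lam : two_functor (left_pb p) J) (rho : two_functor (right_pb q) J).
Hypotheses (la : left_action lam) (ra : right_action rho).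
Hypothesis lq : q \of lam =2f q \of pb_pr2 (arrow_tgt A) p.
Hypothesis rp : p \of rho =2f p \of pb_pr1 q (arrow_src B).
Hypothesis comm : actions_commute lq rp.

Notation ro := rho_ob.
Notation rm := rho_mor.
Notation rc := rho_cell.
Notation rl := rho_lift_mor.
Notation rlc := rho_lift_cell.
Notation rol := (right_of_left lam).
Notation HL := (right_of_left_action la).

Lemma commute_rho_ob i u v : fo p i = cod u -> fo q i = dom v ->
  ro rho (ro rol i u) v = ro rol (ro rho i v) u.
Proof.
move=> e1 e2.
have E1 : ro rol i u = fo lam (exist _ (u, i) (eq_sym e1))
  := eq_sym (rho_obE rol (exist _ (i, u) e1)).
have E2 : ro rho i v = fo rho (exist _ (i, v) e2)
  := eq_sym (rho_obE rho (exist _ (i, v) e2)).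
rewrite E1 E2.
have e3 := eq_trans (eq_fo lq (exist _ (u, i) (eq_sym e1))) e2.
have e4 := eq_trans (eq_fo rp (exist _ (i, v) e2)) e1.
refine (eq_trans (eq_sym (rho_obE rho (exist _ (_, v) e3))) _).
refine (eq_trans _ (rho_obE rol (exist _ (_, u) e4))).
exact (@commute_ob _ _ _ _ _ lam rho lq rp comm u i v (eq_sym e1) e2 e3
  (eq_sym e4)).
Qed.
Lemma commute_rho_mor f (m : lax_square (coop A)) n : fm p f = sq_s m ->
  fm q f = sq_s n ->
  rm rho (rm rol f m) n = rm rol (rm rho f n) m.
Proof.
move=> e1 e2.
have E1 : rm rol f m = fm lam (exist _ (unco_sq m, f) (eq_sym e1))
  := eq_sym (rho_morE rol (exist _ (f, m) e1)).
have E2 : rm rho f n = fm rho (exist _ (f, n) e2)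
  := eq_sym (rho_morE rho (exist _ (f, n) e2)).
rewrite E1 E2.
have e3 := eq_trans (eq_fm lq (exist _ (unco_sq m, f) (eq_sym e1))) e2.
have e4 := eq_trans (eq_fm rp (exist _ (f, n) e2)) e1.
refine (eq_trans (eq_sym (rho_morE rho (exist _ (_, n) e3))) _).
refine (eq_trans _ (rho_morE rol (exist _ (_, m) e4))).
exact (@commute_mor _ _ _ _ _ lam rho lq rp comm (unco_sq m) f n (eq_sym e1) e2
  e3 (eq_sym e4)).
Qed.
Lemma commute_rho_cell s (x : lax_square_cell (coop A)) y : fc p s = lc_s x ->
  fc q s = lc_s y ->
  rc rho (rc rol s x) y = rc rol (rc rho s y) x.
Proof.
move=> e1 e2.
have E1 : rc rol s x = fc lam (exist _ (unco_lc x, s) (eq_sym e1))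
  := eq_sym (rho_cellE rol (exist _ (s, x) e1)).
have E2 : rc rho s y = fc rho (exist _ (s, y) e2)
  := eq_sym (rho_cellE rho (exist _ (s, y) e2)).
rewrite E1 E2.
have e3 := eq_trans (eq_fc lq (exist _ (unco_lc x, s) (eq_sym e1))) e2.
have e4 := eq_trans (eq_fc rp (exist _ (s, y) e2)) e1.
refine (eq_trans (eq_sym (rho_cellE rho (exist _ (_, y) e3))) _).
refine (eq_trans _ (rho_cellE rol (exist _ (_, x) e4))).
exact (@commute_cell _ _ _ _ _ lam rho lq rp comm (unco_lc x) s y (eq_sym e1) e2
  e3 (eq_sym e4)).
Qed.

Lemma co_mor_left_cleavage i u (e : fo p i = cod u) :
  co_mor (left_cleavage lam) e = rl rol i u.
Proof. by rewrite -right_cleavage_of_left; exact: (cl_mor_right_cleavage rol e).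
  Qed.
Lemma co_cell_left_cleavage s a (e : src a = fm p s) :
  co_cell (left_cleavage lam) e = rlc rol a s.
Proof. by rewrite -right_cleavage_of_left; exact:
  (cl_cell_right_cleavage rol e). Qed.

Lemma vertical_lmor i u (e : fo p i = cod u) :
  fm q (rl rol i u) = idm (fo q i).
Proof.
rewrite -(co_mor_left_cleavage e) -fm_idm.
exact: (eq_fm lq (exist _ (to_id u, idm i) _)).
Qed.
Lemma vertical_lcell s a (e : src a = fm p s) :
  fc q (rlc rol a s) = idc (fm q s).
Proof.
rewrite -(co_cell_left_cleavage e) -fc_idc.
exact: (eq_fc lq (exist _ (from_unit_cell a, idc s) _)).
Qed.
Lemma vertical_rmor i u (e : fo q i = dom u) :
  fm p (rl rho i u) = idm (fo p i).
Proof.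
rewrite -(cl_mor_right_cleavage _ e) -fm_idm.
exact: (eq_fm rp (exist _ (idm i, from_id u) _)).
Qed.
Lemma vertical_rcell s b (e : tgt b = fm q s) :
  fc p (rlc rho b s) = idc (fm p s).
Proof.
rewrite -(cl_cell_right_cleavage _ e) -fc_idc.
exact: (eq_fc rp (exist _ (idc s, to_unit_cell b) _)).
Qed.

(** Both sides equal rho at the lift of u and the degenerate square of v.
    On the right this needs that rho at a value of lam is lam at a value of
    rho. *)
Lemma actions_cl i u v : fo p i = cod u -> fo q i = dom v ->
  @cmp J (rl rho i v) (rl rol i u)
  = @cmp J (rl rol (ro rho i v) u) (rl rho (ro rol i u) v).
Proof.
move=> e1 e2; have vl : fm q (rl rol i u) = idm (dom v).
  by rewrite vertical_lmor // e2.
have ci : cod (rl rol i u : mor J) = i := dom_rho_lift_mor HL e1.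
have di : dom (rl rol i u : mor J) = ro rol i u := cod_rho_lift_mor rol e1.
have r1 := rho_mor_from_id_cod ra vl; have r2 := rho_mor_from_id_dom rho vl.
rewrite ci in r1; rewrite di in r2; rewrite -r1 r2; congr (cmp _ _).
rewrite {1}/rho_lift_mor commute_rho_mor.
- by rewrite fm_idm e1.
- by rewrite fm_idm e2.
- by rewrite (rho_mor_id rho e2).
Qed.

Lemma actions_cc s a b : src a = fm p s -> tgt b = fm q s ->
  @vc J (rlc rho b s) (rlc rol a s)
  = @vc J (rlc rol a (rm rho s (cell_sq b)))
    (rlc rho b (rm rol s (@cell_sq (coop A) a))).
Proof.
move=> e1 e2; have vl : fc q (rlc rol a s) = idc (tgt b).
  by rewrite vertical_lcell // e2.
have ci : src (rlc rol a s : cell J) = s := tgt_rho_lift_cell HL e1.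
have di : tgt (rlc rol a s : cell J) = rm rol s (@cell_sq (coop A) a) :=
  src_rho_lift_cell rol e1.
have r1 := rho_cell_to_unit_tgt ra vl; have r2 := rho_cell_to_unit_src rho vl.
rewrite ci in r1; rewrite di in r2; rewrite -r1 r2; congr (vc _ _).
rewrite {1}/rho_lift_cell commute_rho_cell.
- by rewrite fc_idc -e1.
- by rewrite fc_idc -e2.
- by rewrite rho_cell_idc.
Qed.

Theorem two_sided_of_actions :
  two_sided_cleavage (left_cleavage lam) (right_cleavage rho).
Proof.
split.
- exact: left_action_fibration.
- exact: right_action_fibration.
- by move=> i u e; rewrite co_mor_left_cleavage; apply: vertical_lmor.
- by move=> s a e; rewrite co_cell_left_cleavage; apply: vertical_lcell.
- by move=> i u e; rewrite cl_mor_right_cleavage; apply: vertical_rmor.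
- by move=> s b e; rewrite cl_cell_right_cleavage; apply: vertical_rcell.
- move=> i u v eu ev ev' eu'.
  have P : forall i v (e : fo q i = dom v), push (right_cleavage rho) e
    = ro rho i v.
    by move=> k w e; rewrite /push cl_mor_right_cleavage cod_rho_lift_mor.
  have Q : forall i u (e : fo p i = cod u),
      co_pull (left_cleavage lam) e = ro rol i u.
    by move=> k w e; rewrite /co_pull co_mor_left_cleavage; exact:
      (cod_rho_lift_mor rol e).
  have E : push (right_cleavage rho) ev' = co_pull (left_cleavage lam) eu'.
    by rewrite (P _ _ ev') (Q _ _ eu') (P _ _ ev) (Q _ _ eu) commute_rho_ob.
  split=> //.
  have c1 : cod (co_mor (left_cleavage lam) eu)
      = dom (cl_mor (right_cleavage rho) ev).
    by rewrite cl_mor_right_cleavage co_mor_left_cleavage dom_rho_lift_mor //;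
      exact: (dom_rho_lift_mor HL eu).
  exists c1, E.
  rewrite (compE c1) (compE E) !cl_mor_right_cleavage !co_mor_left_cleavage
    (P _ _ ev) (Q _ _ eu).
  exact: actions_cl.
- move=> s a b ea eb ea' eb'.
  have P : forall b s (e : tgt b = fm q s),
      pull (right_cleavage rho) e = rm rho s (cell_sq b).
    by move=> c t e; rewrite /pull cl_cell_right_cleavage src_rho_lift_cell.
  have Q : forall a s (e : src a = fm p s),
      co_push (left_cleavage lam) e = rm rol s (@cell_sq (coop A) a).
    by move=> c t e; rewrite /co_push co_cell_left_cleavage; exact:
      (src_rho_lift_cell rol e).
  have E : co_push (left_cleavage lam) ea' = pull (right_cleavage rho) eb'.
    rewrite (P _ _ eb') (Q _ _ ea') (P _ _ eb) (Q _ _ ea) commute_rho_mor //.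
  split=> //.
  have c1 : tgt (cl_cell (right_cleavage rho) eb)
      = src (co_cell (left_cleavage lam) ea).
    by rewrite cl_cell_right_cleavage co_cell_left_cleavage tgt_rho_lift_cell
      //; symmetry; exact: (tgt_rho_lift_cell HL ea).
  exists c1, E.
  rewrite (vcompE c1) (vcompE E) !cl_cell_right_cleavage !co_cell_left_cleavage
    (P _ _ eb) (Q _ _ ea).
  exact: actions_cc.
Qed.

End TwoSidedOfActions.

(** * The dual lifts and the left action that they determine *)

Section CoCleavage.
Variables (J A : two_category) (p : two_functor J A) (L : co_cleavage p).
Hypothesis H : split_co2fibration L.

(** The lifts of the dual cleavage as morphisms and cells of J itself. What
    is known for split op-2-fibrations holds for them after translating
    compositions. *)
Definition colift_mor (i : ob J) (u : mor A) : mor J :=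
  @lift_mor _ _ (functor_coop p) L i u.
Definition colift_cell (a : cell A) (s : mor J) : cell J :=
  @lift_cell _ _ (functor_coop p) L a s.
Notation l1 := colift_mor.
Notation l2 := colift_cell.

Lemma cod_colift_mor i u : fo p i = cod u -> cod (l1 i u) = i.
Proof. exact: (dom_lift_mor H). Qed.
Lemma src_colift_cell a s : src a = fm p s -> src (l2 a s) = s.
Proof. exact: (tgt_lift_cell H). Qed.
Lemma dom_tgt_colift_cell a s : src a = fm p s -> dom (tgt (l2 a s)) = dom s.
Proof. exact: (cod_src_lift_cell H). Qed.
Lemma cod_tgt_colift_cell a s : src a = fm p s -> cod (tgt (l2 a s)) = cod s.
Proof. exact: (dom_src_lift_cell H). Qed.

Lemma colift_cell_wl a s t f : src a = fm p s -> f = fm p t -> cod s = dom t ->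
  hc (idc t) (l2 a s) = l2 (hc (idc f) a) (cmp t s).
Proof.
move=> ea ef e.
have e' : @cod (coop J) t = @dom (coop J) s := eq_sym e.
have ca : cod (src a) = dom (src (idc f)).
  by rewrite src_idc ea ef fm_cod fm_dom e.
have cl : cod (src (l2 a s)) = dom (src (idc t)).
  by rewrite src_idc src_colift_cell.
rewrite -(coop_hc ca) -(coop_hc cl) -(coop_cmp e).
exact: (@lift_cell_wr _ _ _ _ H a t s f ea ef e').
Qed.
Lemma colift_cell_wr a s t f : src a = fm p t -> f = fm p s -> cod s = dom t ->
  hc (l2 a t) (idc s) = l2 (hc a (idc f)) (cmp t s).
Proof.
move=> ea ef e.
have e' : @cod (coop J) t = @dom (coop J) s := eq_sym e.
have ca : cod (src (idc f)) = dom (src a).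
  by rewrite src_idc ea ef fm_cod fm_dom e.
have cl : cod (src (idc s)) = dom (src (l2 a t)).
  by rewrite src_idc src_colift_cell.
rewrite -(coop_hc ca) -(coop_hc cl) -(coop_cmp e).
exact: (@lift_cell_wl _ _ _ _ H a t s f ea ef e').
Qed.

Definition coact_mor (f : mor J) (m : lax_square A) : mor J :=
  @act_mor _ _ (functor_coop p) L f (co_sq m).
Definition coact_cell (s : cell J) (x : lax_square_cell A) : cell J :=
  @act_cell _ _ (functor_coop p) L s (co_lc x).
Definition comp_colift (f : mor J) (m : lax_square A) : mor J :=
  cmp f (l1 (dom f) (sq_dom m)).
Notation lm := coact_mor.
Notation lc := coact_cell.

Section Mor.
Variables (f : mor J) (m : lax_square A).
Hypothesis e : fm p f = sq_t m.
Let e' : fm (functor_coop p) f = sq_s (co_sq m) := e.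

Lemma coover_dom : fo p (dom f) = cod (sq_dom m).
Proof. exact: (over_cod e'). Qed.
Lemma coover_cod : fo p (cod f) = cod (sq_cod m).
Proof. exact: (over_dom e'). Qed.
Lemma comp_colift_composable : cod (l1 (dom f) (sq_dom m)) = dom f.
Proof. by rewrite cod_colift_mor // coover_dom. Qed.
Lemma coop_comp_lift : @comp_lift _ _ (functor_coop p) L f (co_sq m)
  = comp_colift f m.
Proof. exact: (coop_cmp comp_colift_composable). Qed.
Lemma fm_comp_colift : src (sq_cell m) = fm p (comp_colift f m).
Proof. by rewrite -coop_comp_lift; exact: (fm_comp_lift H e'). Qed.
Lemma dom_coact_mor : dom (lm f m) = dom (l1 (dom f) (sq_dom m)).
Proof. exact: (cod_act_mor H e'). Qed.
Lemma cod_coact_mor : cod (lm f m) = dom (l1 (cod f) (sq_cod m)).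
Proof. exact: (dom_act_mor H e'). Qed.
Lemma fm_coact_mor : fm p (lm f m) = sq_s m.
Proof. exact: (fm_act_mor H e'). Qed.
Lemma coact_mor_lift : cmp (l1 (cod f) (sq_cod m)) (lm f m)
  = tgt (l2 (sq_cell m) (comp_colift f m)).
Proof.
rewrite -coop_comp_lift -(@coop_cmp J) ?cod_coact_mor //.
exact: (act_mor_lift H e').
Qed.
Lemma coact_morE w :
  dom w = dom (l1 (dom f) (sq_dom m)) -> cod w = dom (l1 (cod f) (sq_cod m)) ->
  fm p w = sq_s m ->
  cmp (l1 (cod f) (sq_cod m)) w = tgt (l2 (sq_cell m) (comp_colift f m)) ->
  w = lm f m.
Proof.
move=> h1 h2 h3 h4; apply: (act_morE H e').
split; first exact: h2.
split; first exact: h1.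
split; first exact: h3.
rewrite coop_comp_lift; refine (eq_trans _ h4); exact: coop_cmp.
Qed.
End Mor.

Section Cell.
Variables (s : cell J) (x : lax_square_cell A).
Hypothesis e : fc p s = lc_t x.
Let e' : fc (functor_coop p) s = lc_s (co_lc x) := e.
Lemma coover_src : fm p (src s) = sq_t (lc_src x).
Proof. exact: (over_tgt e'). Qed.
Lemma coover_tgt : fm p (tgt s) = sq_t (lc_tgt x).
Proof. exact: (over_src e'). Qed.
Lemma src_coact_cell : src (lc s x) = lm (src s) (lc_src x).
Proof. exact: (tgt_act_cell H e'). Qed.
Lemma tgt_coact_cell : tgt (lc s x) = lm (tgt s) (lc_tgt x).
Proof. exact: (src_act_cell H e'). Qed.
Lemma fc_coact_cell : fc p (lc s x) = lc_s x.
Proof. exact: (fc_act_cell H e'). Qed.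

Let k0 := l1 (dom (src s)) (sq_dom (lc_src x)).
Let k1 := l1 (cod (src s)) (sq_cod (lc_src x)).

Lemma coact_cell_comp : cod k0 = dom (src s).
Proof. exact: (comp_colift_composable coover_src). Qed.

Lemma tgt_lift_comp_colift y : src y = lm (src s) (lc_src x) ->
  tgt (l2 (sq_cell (lc_src x)) (comp_colift (src s) (lc_src x)))
    = src (hc (idc k1) y) /\ cod (src y) = dom k1.
Proof.
move=> sy; have c : cod (src y)
  = dom k1 by rewrite sy (cod_coact_mor coover_src).
by split=> //; rewrite src_hc ?src_idc // sy (coact_mor_lift coover_src).
Qed.

(** Translation of the characterizing equation of [act_cell] for the
    reversed 2-functor; so is the next lemma, for the other side. *)
Lemma coact_cell_equiv y : src y = lm (src s) (lc_src x) ->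
  vc (l2 (sq_cell (lc_src x)) (comp_colift (src s) (lc_src x))) (hc (idc k1) y)
  = @vc (coop J) (@hc (coop J) y (idc (l1 (cod (tgt s)) (sq_cod (lc_tgt x)))))
     (l2 (sq_cell (lc_src x))
       (@comp_lift _ _ (functor_coop p) L (src s) (co_sq (lc_src x)))).
Proof.
move=> sy; case: (tgt_lift_comp_colift sy) => h1 h2.
rewrite (coop_comp_lift coover_src) -cod_src -lc_sq_cod -/k1.
by rewrite coop_hc ?src_idc // coop_vc.
Qed.

Lemma coact_cell_equiv' :
  vc (hc s (idc k0)) (l2 (sq_cell (lc_tgt x)) (comp_colift (tgt s) (lc_tgt x)))
  = @vc (coop J) (l2 (sq_cell (lc_tgt x))
    (@comp_lift _ _ (functor_coop p) L (tgt s) (co_sq (lc_tgt x))))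
     (@hc (coop J) (idc (l1 (dom (tgt s)) (sq_dom (lc_tgt x)))) s).
Proof.
have c := coact_cell_comp.
have d : dom (tgt s) = dom (src s) by rewrite dom_src.
have z : src (l2 (sq_cell (lc_tgt x)) (comp_colift (tgt s) (lc_tgt x)))
    = tgt (hc s (idc k0)).
  rewrite (src_colift_cell (fm_comp_colift coover_tgt)) tgt_hc ?src_idc //
    tgt_idc.
  by rewrite /comp_colift d -lc_sq_dom.
rewrite (coop_comp_lift coover_tgt) d -lc_sq_dom -/k0.
by rewrite (@coop_hc J s (idc k0)) ?src_idc // coop_vc.
Qed.

Lemma coact_cell_lift :
  vc (l2 (sq_cell (lc_src x)) (comp_colift (src s) (lc_src x)))
     (hc (idc k1) (lc s x))
  = vc (hc s (idc k0))
       (l2 (sq_cell (lc_tgt x)) (comp_colift (tgt s) (lc_tgt x))).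
Proof.
rewrite coact_cell_equiv ?src_coact_cell // coact_cell_equiv'.
exact: (act_cell_lift H e').
Qed.

Lemma coact_cellE y :
  src y = lm (src s) (lc_src x) -> tgt y = lm (tgt s) (lc_tgt x) ->
  fc p y = lc_s x ->
  vc (l2 (sq_cell (lc_src x)) (comp_colift (src s) (lc_src x))) (hc (idc k1) y)
  = vc (hc s (idc k0))
       (l2 (sq_cell (lc_tgt x)) (comp_colift (tgt s) (lc_tgt x))) ->
  y = lc s x.
Proof.
move=> h1 h2 h3; rewrite coact_cell_equiv // coact_cell_equiv' => h4.
by apply: (act_cellE H e'); split.
Qed.
End Cell.
End CoCleavage.

(** * From compatible cleavages to commuting actions *)

Section Cube.
Variable C : two_category.

(** Five faces of a cube of cells imply the sixth. In the application F and
    G are the left and the right action on s, and X is the right action on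
    F; their faces are the characterizing equations. The two remaining
    hypotheses say that lifts for the two legs commute at the source and at
    the target of s, and the conclusion is the equation that characterizes
    X as the left action on G, after whiskering and composing with lifts. *)
Lemma cube (s F G X a0 a1 b0 b1 A0 A1 B0 B1 : cell C)
  (l0 l1 k0 k1 m0 m1 n0 n1 : mor C) :
  cod l0 = dom (src s) -> cod (src s) = dom k1 ->
  cod (src F) = dom l1 -> cod l1 = dom k1 -> cod l0 = dom k0 ->
  cod k0 = dom (src G) -> cod m0 = dom (src G) -> cod n0 = dom m0 ->
  dom (src X) = cod n0 -> cod (src X) = dom m1 ->
  cod (src F) = dom n1 -> cod n1 = dom m1 ->
  src a0 = cmp (src s) l0 -> tgt a0 = cmp l1 (src F) ->
  src a1 = cmp (tgt s) l0 -> tgt a1 = cmp l1 (tgt F) ->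
  src b0 = cmp (src G) k0 -> tgt b0 = cmp k1 (src s) ->
  src b1 = cmp (tgt G) k0 -> tgt b1 = cmp k1 (tgt s) ->
  src A0 = cmp (src G) m0 -> tgt A0 = cmp m1 (src X) ->
  src A1 = cmp (tgt G) m0 -> tgt A1 = cmp m1 (tgt X) ->
  src B0 = cmp (src X) n0 -> tgt B0 = cmp n1 (src F) ->
  src B1 = cmp (tgt X) n0 -> tgt B1 = cmp n1 (tgt F) ->
  cmp m0 n0 = cmp k0 l0 -> cmp m1 n1 = cmp k1 l1 ->
  vc a0 (hc (idc l1) F) = vc (hc s (idc l0)) a1 ->
  vc (hc G (idc k0)) b1 = vc b0 (hc (idc k1) s) ->
  vc (hc X (idc n0)) B1 = vc B0 (hc (idc n1) F) ->
  vc (hc b0 (idc l0)) (hc (idc k1) a0)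
  = vc (hc A0 (idc n0)) (hc (idc m1) B0) ->
  vc (hc b1 (idc l0)) (hc (idc k1) a1)
  = vc (hc A1 (idc n0)) (hc (idc m1) B1) ->
  vc (hc (vc A0 (hc (idc m1) X)) (idc n0)) (hc (idc m1) B1)
  = vc (hc (vc (hc G (idc m0)) A1) (idc n0)) (hc (idc m1) B1).
Proof.
move=> c1 c2 c3 c4 c5 c6 c7 c8 c9 c10 c11 c12.
move=> sa0 ta0 sa1 ta1 sb0 tb0 sb1 tb1 sA0 tA0 sA1 tA1 sB0 tB0 sB1 tB1.
move=> em en HF HG HX H0 H1.
have h1 := dom_src s; have h2 := cod_src s.
have h3 := dom_src F; have h4 := cod_src F.
have h5 := dom_src G; have h6 := cod_src G.
have h7 := dom_src X; have h8 := cod_src X.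
transitivity (vc (hc b0 (idc l0)) (hc (idc k1) (vc (hc s (idc l0)) a1))).
- rewrite (wr_vc (f := n0)); [bnd|bnd|].
  rewrite vc_assoc; [bnd|bnd|].
  rewrite -(hc_assoc (t := idc m1) (s := X)); [bnd|bnd|].
  rewrite -(wl_vc (g := m1)); [bnd|bnd|].
  rewrite HX wl_vc; [bnd|bnd|].
  rewrite -vc_assoc; [bnd|bnd|].
  rewrite -H0 -wl_cmp; [bnd|bnd|].
  rewrite en wl_cmp; [bnd|bnd|].
  rewrite vc_assoc; [bnd|bnd|].
  rewrite -(wl_vc (g := k1)); [bnd|bnd|].
  by rewrite HF.
- rewrite (wr_vc (f := n0)); [bnd|bnd|].
  rewrite [RHS]vc_assoc; [bnd|bnd|].
  rewrite -H1 -(wr_cmp (s := G)); [bnd|bnd|].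
  rewrite em (wr_cmp (s := G)); [bnd|bnd|].
  rewrite -vc_assoc; [bnd|bnd|].
  rewrite -(wr_vc (f := l0)); [bnd|bnd|].
  rewrite HG (wr_vc (f := l0)); [bnd|bnd|].
  rewrite vc_assoc; [bnd|bnd|].
  rewrite (wl_vc (g := k1)); [bnd|bnd|].
  by rewrite hc_assoc //; bnd.
Qed.
End Cube.

Section ActionsOfTwoSided.
Variables (A B J : two_category) (p : two_functor J A) (q : two_functor J B).
Variables (L : co_cleavage p) (R : cleavage q).
Hypothesis H : two_sided_cleavage L R.
Let HL : split_co2fibration L := ts_f H.
Let HR : split_op2fibration R := ts_o H.

Notation r1 := (lift_mor R).
Notation r2 := (lift_cell R).
Notation l1 := (colift_mor L).
Notation l2 := (colift_cell L).
Notation comp_colift := (comp_colift L).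
Notation comp_lift := (comp_lift R).
Notation am := (act_mor R).
Notation ac := (act_cell R).
Notation lm := (coact_mor L).
Notation lc := (coact_cell L).

Lemma colift_morE i u (e : fo p i = cod u) : co_mor L e = l1 i u.
Proof. exact: (lift_morE L e). Qed.
Lemma colift_cellE s a (e : src a = fm p s) : co_cell L e = l2 a s.
Proof. exact: (lift_cellE L e). Qed.

Lemma fm_q_colift i u : fo p i = cod u -> fm q (l1 i u) = idm (fo q i).
Proof. by move=> e; rewrite -(colift_morE e) (ts_v_lmor H). Qed.
Lemma fc_q_colift a s : src a = fm p s -> fc q (l2 a s) = idc (fm q s).
Proof. by move=> e; rewrite -(colift_cellE e) (ts_v_lcell H). Qed.
Lemma fm_p_lift i v : fo q i = dom v -> fm p (r1 i v) = idm (fo p i).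
Proof. by move=> e; rewrite -(lift_morE R e) (ts_v_rmor H). Qed.
Lemma fc_p_lift b s : tgt b = fm q s -> fc p (r2 b s) = idc (fm p s).
Proof. by move=> e; rewrite -(lift_cellE R e) (ts_v_rcell H). Qed.

Lemma fo_q_colift i u : fo p i = cod u -> fo q (dom (l1 i u)) = fo q i.
Proof. by move=> e; rewrite -fm_dom fm_q_colift // dom_idm. Qed.
Lemma fo_p_lift i v : fo q i = dom v -> fo p (cod (r1 i v)) = fo p i.
Proof. by move=> e; rewrite -fm_cod fm_p_lift // cod_idm. Qed.

Lemma lift_colift_ob i u v : fo p i = cod u -> fo q i = dom v ->
  cod (r1 (dom (l1 i u)) v) = dom (l1 (cod (r1 i v)) u).
Proof.
move=> eu ev.
have ev' : fo q (co_pull L eu) = dom v.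
  by rewrite /co_pull colift_morE fo_q_colift.
have eu' : fo p (push R ev) = cod u.
  by rewrite /push lift_morE fo_p_lift.
case: (ts_cl H ev' eu') => h _.
by rewrite {1}/push {2}/co_pull (lift_morE R ev') (colift_morE eu') /push
  /co_pull
  (lift_morE R ev) (colift_morE eu) in h.
Qed.
Lemma lift_colift_mor i u v : fo p i = cod u -> fo q i = dom v ->
  cmp (r1 i v) (l1 i u)
  = cmp (l1 (cod (r1 i v)) u) (r1 (dom (l1 i u)) v).
Proof.
move=> eu ev.
have ev' : fo q (co_pull L eu) = dom v.
  by rewrite /co_pull colift_morE fo_q_colift.
have eu' : fo p (push R ev) = cod u.
  by rewrite /push lift_morE fo_p_lift.
case: (ts_cl H ev' eu') => _ [e1 [e2]].
rewrite (compE e1) (compE e2) (lift_morE R ev) (colift_morE eu).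
rewrite (lift_morE R ev') (colift_morE eu') /push /co_pull.
by rewrite (lift_morE R ev) (colift_morE eu).
Qed.
Lemma lift_colift_cell_mor s a b : src a = fm p s -> tgt b = fm q s ->
  tgt (l2 a (src (r2 b s))) = src (r2 b (tgt (l2 a s))).
Proof.
move=> ea eb.
have ea' : src a = fm p (pull R eb).
  by rewrite /pull lift_cellE -fc_src fc_p_lift // src_idc.
have eb' : tgt b = fm q (co_push L ea).
  by rewrite /co_push colift_cellE -fc_tgt fc_q_colift // tgt_idc.
case: (ts_cc H ea' eb') => h _.
by rewrite {2}/pull {1}/co_push (lift_cellE R eb') (colift_cellE ea') /pull
  /co_push
  (lift_cellE R eb) (colift_cellE ea) in h.
Qed.
Lemma lift_colift_cell s a b : src a = fm p s -> tgt b = fm q s ->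
  vc (r2 b s) (l2 a s)
  = vc (l2 a (src (r2 b s))) (r2 b (tgt (l2 a s))).
Proof.
move=> ea eb.
have ea' : src a = fm p (pull R eb).
  by rewrite /pull lift_cellE -fc_src fc_p_lift // src_idc.
have eb' : tgt b = fm q (co_push L ea).
  by rewrite /co_push colift_cellE -fc_tgt fc_q_colift // tgt_idc.
case: (ts_cc H ea' eb') => _ [e1 [e2]].
rewrite (vcompE e1) (vcompE e2) (lift_cellE R eb) (colift_cellE ea).
rewrite (lift_cellE R eb') (colift_cellE ea') /pull /co_push.
by rewrite (lift_cellE R eb) (colift_cellE ea).
Qed.

Definition rho_of : two_functor (right_pb q) J := action HR.
Definition lam_of : two_functor (left_pb p) J :=
  @left_of_right J A p (@action (coop J) (coop A) (functor_coop p) L HL).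

Lemma rho_of_vertical : p \of rho_of =2f p \of pb_pr1 q (arrow_src B).
Proof.
apply: action_vertical => [i u e|b s e].
- exact: (ts_v_rmor H).
- exact: (ts_v_rcell H).
Qed.

Lemma lam_of_vertical : q \of lam_of =2f q \of pb_pr2 (arrow_tgt A) p.
Proof.
have h := @action_vertical _ _ _ _ HL _ (functor_coop q)
  (fun i u e => ts_v_lmor H e) (fun b s e => ts_v_lcell H e).
split=> x.
- exact: (eq_fo h (flip_ob x)).
- exact: (eq_fm h (flip_mor x)).
- exact: (eq_fc h (flip_cell x)).
Qed.

Lemma fm_p_act_mor f n : fm q f = sq_s n -> fm p (am f n) = fm p f.
Proof. by move=> e; exact: (eq_fm rho_of_vertical (exist _ (f, n) e)). Qed.
Lemma fc_p_act_cell s y : fc q s = lc_s y -> fc p (ac s y) = fc p s.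
Proof. by move=> e; exact: (eq_fc rho_of_vertical (exist _ (s, y) e)). Qed.
Lemma fm_q_coact_mor f m : fm p f = sq_t m -> fm q (lm f m) = fm q f.
Proof.
by move=> e; exact: (eq_fm lam_of_vertical (exist _ (m, f) (eq_sym e))).
Qed.
Lemma fc_q_coact_cell s x : fc p s = lc_t x -> fc q (lc s x) = fc q s.
Proof.
by move=> e; exact: (eq_fc lam_of_vertical (exist _ (x, s) (eq_sym e))).
Qed.

(** Whiskering the lift of a cell by a vertical morphism gives a lift of
    the same cell; the lifts for the other leg are vertical in this sense. *)
Lemma lift_cell_wl_vertical b s k : tgt b = fm q s -> cod s = dom k ->
  fm q k = idm (fo q (cod s)) -> hc (idc k) (r2 b s) = r2 b (cmp k s).
Proof.
move=> eb e ek; rewrite (lift_cell_wl HR eb (eq_refl _)) // ek hc_idl //.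
by rewrite cod_src eb fm_cod.
Qed.
Lemma lift_cell_wr_vertical b s k : tgt b = fm q s -> cod k = dom s ->
  fm q k = idm (fo q (dom s)) -> hc (r2 b s) (idc k) = r2 b (cmp s k).
Proof.
move=> eb e ek; rewrite (lift_cell_wr HR eb (eq_refl _)) // ek hc_idr //.
by rewrite dom_src eb fm_dom.
Qed.
Lemma colift_cell_wl_vertical a s k : src a = fm p s -> cod s = dom k ->
  fm p k = idm (fo p (cod s)) -> hc (idc k) (l2 a s) = l2 a (cmp k s).
Proof.
move=> ea e ek; rewrite (colift_cell_wl HL ea (eq_refl _)) // ek hc_idl //.
by rewrite ea fm_cod.
Qed.
Lemma colift_cell_wr_vertical a s k : src a = fm p s -> cod k = dom s ->
  fm p k = idm (fo p (dom s)) -> hc (l2 a s) (idc k) = l2 a (cmp s k).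
Proof.
move=> ea e ek; rewrite (colift_cell_wr HL ea (eq_refl _)) // ek hc_idr //.
by rewrite ea fm_dom.
Qed.

Section Cross.
Variables (f : mor J) (m : lax_square A) (n : lax_square B).
Hypotheses (e1 : fm p f = sq_t m) (e2 : fm q f = sq_s n).

(** The morphism f between the two lifts. Pulling it back along the cell of
    n and pushing it forward along the cell of m, in either order, yields
    the two iterated actions on f up to composition with lifts. *)
Definition through : mor J :=
  cmp (r1 (cod f) (sq_cod n)) (cmp f (l1 (dom f) (sq_dom m))).

Let F := lm f m.
Let G := am f n.
Let eF : fm q F = sq_s n.
Proof. by rewrite /F fm_q_coact_mor. Qed.
Let eG : fm p G = sq_t m.
Proof. by rewrite /G fm_p_act_mor. Qed.
Let pd : fo p (dom f) = cod (sq_dom m) := coover_dom e1.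
Let pc : fo p (cod f) = cod (sq_cod m) := coover_cod e1.
Let qd : fo q (dom f) = dom (sq_dom n) := over_dom e2.
Let qc : fo q (cod f) = dom (sq_cod n) := over_cod e2.

Let l0 := l1 (dom f) (sq_dom m).
Let k0 := r1 (cod f) (sq_cod n).
Let l0' := l1 (dom G) (sq_dom m).
Let l1' := l1 (cod G) (sq_cod m).
Let k0' := r1 (dom F) (sq_dom n).

Let dG : dom G = cod (r1 (dom f) (sq_dom n)) := dom_act_mor HR e2.
Let cG : cod G = cod k0 := cod_act_mor HR e2.
Let dF : dom F = dom l0 := dom_coact_mor HL e1.
Let cF : cod F = dom (l1 (cod f) (sq_cod m)) := cod_coact_mor HL e1.

Let cl0 : cod l0 = dom f := comp_colift_composable HL e1.
Let ck0 : cod f = dom k0 := comp_lift_composable HR e2.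

Lemma throughE : through = cmp (comp_lift f n) l0.
Proof. by rewrite /through cmp_assoc. Qed.

Lemma fm_p_through : src (sq_cell m) = fm p through.
Proof.
rewrite /through fm_cmp ?cod_cmp // fm_p_lift // cmp_idl.
  by rewrite fm_cod cod_cmp.
exact: (fm_comp_colift HL e1).
Qed.
Lemma fm_q_through : tgt (sq_cell n) = fm q through.
Proof.
rewrite throughE fm_cmp ?(dom_comp_lift HR e2) // fm_q_colift // cmp_idr.
  by rewrite fm_dom (dom_comp_lift HR e2).
exact: (fm_comp_lift HR e2).
Qed.

Lemma colift_through :
  l2 (sq_cell m) through = hc (idc k0) (l2 (sq_cell m) (comp_colift f m)).
Proof.
rewrite colift_cell_wl_vertical ?cod_cmp ?fm_p_lift //.
exact: (fm_comp_colift HL e1).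
Qed.
Lemma lift_through :
  r2 (sq_cell n) through = hc (r2 (sq_cell n) (comp_lift f n)) (idc l0).
Proof.
rewrite throughE lift_cell_wr_vertical ?(dom_comp_lift HR e2) ?fm_q_colift //.
exact: (fm_comp_lift HR e2).
Qed.

Let cl1' : cod (comp_lift F n) = dom l1'.
Proof. by rewrite (cod_comp_lift HR eF) cF /l1' cG lift_colift_ob. Qed.
Let ck0' : cod k0' = dom (comp_colift G m).
Proof.
rewrite dom_cmp ?(comp_colift_composable HL eG) //.
by rewrite dG /k0' dF lift_colift_ob.
Qed.
Let pcG : fo p (cod G) = cod (sq_cod m) := coover_cod eG.
Let pdG : fo p (dom G) = cod (sq_dom m) := coover_dom eG.
Let qcF : fo q (cod F) = dom (sq_cod n) := over_cod eF.
Let qdF : fo q (dom F) = dom (sq_dom n) := over_dom eF.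

(** The compatibility of morphism lifts, at the codomain and at the domain
    of f. *)
Lemma colift_lift_cod : cmp l1' (r1 (cod F) (sq_cod n))
  = cmp k0 (l1 (cod f) (sq_cod m)).
Proof. by rewrite /l1' cG cF -lift_colift_mor. Qed.
Lemma colift_lift_dom : cmp l0' k0' = cmp (r1 (dom f) (sq_dom n)) l0.
Proof. by rewrite /l0' /k0' dG dF -lift_colift_mor. Qed.

Lemma comp_lift_through : cmp l1' (comp_lift F n)
  = tgt (l2 (sq_cell m) through).
Proof.
have ea := fm_comp_colift HL e1; have ka := comp_lift_composable HR eF.
rewrite colift_through tgt_hc ?tgt_idc ?src_idc ?(src_colift_cell HL ea)
  ?cod_cmp //.
rewrite -(coact_mor_lift HL e1) {1}/comp_lift cmp_assoc //.
  by rewrite -cl1' (cod_comp_lift HR eF).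
rewrite colift_lift_cod cmp_assoc // cod_colift_mor //.
Qed.

Lemma comp_colift_through : cmp (comp_colift G m) k0'
  = src (r2 (sq_cell n) through).
Proof.
have ea := fm_comp_lift HR e2; have ka := comp_colift_composable HL eG.
rewrite lift_through src_hc ?src_idc ?(dom_src_lift_cell HR ea)
  ?(dom_comp_lift HR e2) //.
rewrite -(act_mor_lift HR e2) /comp_colift -cmp_assoc //.
  by rewrite ck0' dom_cmp.
rewrite colift_lift_dom cmp_assoc //.
  by rewrite dom_lift_mor.
Qed.

Lemma lift_comp_lift_through :
  r2 (sq_cell n) (tgt (l2 (sq_cell m) through))
  = hc (idc l1') (r2 (sq_cell n) (comp_lift F n)).
Proof.
rewrite lift_cell_wl_vertical ?comp_lift_through //.
  exact: (fm_comp_lift HR eF).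
by rewrite fm_q_colift // cl1' fo_q_colift.
Qed.
Lemma colift_comp_colift_through :
  l2 (sq_cell m) (src (r2 (sq_cell n) through))
  = hc (l2 (sq_cell m) (comp_colift G m)) (idc k0').
Proof.
rewrite colift_cell_wr_vertical ?comp_colift_through //.
  exact: (fm_comp_colift HL eG).
by rewrite fm_p_lift // -ck0' fo_p_lift.
Qed.

(** The compatibility of cell lifts at [through], each of the four lifts
    being a whiskering of a lift that occurs in the characterizing
    equations of the actions. *)
Lemma cross_square :
  vc (hc (r2 (sq_cell n) (comp_lift f n)) (idc l0))
     (hc (idc k0) (l2 (sq_cell m) (comp_colift f m)))
  = vc (hc (l2 (sq_cell m) (comp_colift G m)) (idc k0'))
       (hc (idc l1') (r2 (sq_cell n) (comp_lift F n))).
Proof.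
rewrite -lift_through -colift_through -colift_comp_colift_through.
rewrite -lift_comp_lift_through.
apply: lift_colift_cell; [exact: fm_p_through|exact: fm_q_through].
Qed.

(** The left-hand side has the property that characterizes values of the
    left action: after cancelling a lift by (om1) this property becomes the
    equation between iterated lifts of [through]. *)
Lemma act_coact_mor : am F n = lm G m.
Proof.
have ea := fm_comp_colift HL eG.
have cX : cod (am F n) = dom l1'.
  by rewrite (cod_act_mor HR eF) -cl1' (cod_comp_lift HR eF).
apply: (coact_morE HL eG) => //.
- by rewrite (dom_act_mor HR eF) -/k0' ck0' dom_cmp //
  (comp_colift_composable HL eG).
- by rewrite fm_p_act_mor // (fm_coact_mor HL e1).
- apply: (om1_inj HR qdF).
  + by rewrite dom_cmp // (dom_act_mor HR eF).
  + rewrite dom_tgt_colift_cell // -/k0' ck0' //.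
  + rewrite cod_cmp // cod_tgt_colift_cell // cod_cmp
    ?(comp_colift_composable HL eG) //.
    by rewrite cod_colift_mor.
  + rewrite fm_cmp // fm_q_colift // cmp_idl.
      by rewrite fm_cod cX fo_q_colift.
    rewrite -fc_tgt fc_q_colift // tgt_idc fm_cmp
      ?(comp_colift_composable HL eG) //.
    rewrite fm_q_colift // cmp_idr ?fm_dom //.
    by rewrite (fm_act_mor HR eF) (fm_act_mor HR e2).
  + rewrite -cmp_assoc // ?(act_mor_lift_composable HR eF) //.
    rewrite (act_mor_lift HR eF).
    have d1 := fm_comp_lift HR eF.
    have -> : cmp l1' (src (r2 (sq_cell n) (comp_lift F n)))
      = src (r2 (sq_cell n) (tgt (l2 (sq_cell m) through))).
      by rewrite lift_comp_lift_through src_hc ?src_idc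
        ?(cod_src_lift_cell HR d1).
    have -> : cmp (tgt (l2 (sq_cell m) (comp_colift G m))) k0'
      = tgt (l2 (sq_cell m) (src (r2 (sq_cell n) through))).
      rewrite colift_comp_colift_through tgt_hc ?tgt_idc ?src_idc //.
      by rewrite (src_colift_cell HL ea) ck0'.
    rewrite lift_colift_cell_mor //; [exact: fm_p_through|exact: fm_q_through].
Qed.
End Cross.

Section CrossCell.
Variables (s : cell J) (x : lax_square_cell A) (y : lax_square_cell B).
Hypotheses (e1 : fc p s = lc_t x) (e2 : fc q s = lc_s y).

Let F := lc s x.
Let G := ac s y.

(** The same strategy for cells: (om2) and the cartesian property of cell
    lifts cancel the two lifts, and the remaining equation is a face of a
    cube. *)
Lemma act_coact_cell : ac F y = lc G x.
Proof.
have eF : fc q F = lc_s y by rewrite /F fc_q_coact_cell.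
have eG : fc p G = lc_t x by rewrite /G fc_p_act_cell.
have s1 := coover_src e1; have t1 := coover_tgt e1.
have s2 := over_src e2; have t2 := over_tgt e2.
have sF : src F = lm (src s) (lc_src x) := src_coact_cell HL e1.
have tF : tgt F = lm (tgt s) (lc_tgt x) := tgt_coact_cell HL e1.
have sG : src G = am (src s) (lc_src y) := src_act_cell HR e2.
have tG : tgt G = am (tgt s) (lc_tgt y) := tgt_act_cell HR e2.
have sX := src_act_cell HR eF; have tX := tgt_act_cell HR eF.
have eF0 := over_src eF; have eF1 := over_tgt eF.
have eG0 := coover_src eG; have eG1 := coover_tgt eG.
have xsX : src (ac F y) = lm (src G) (lc_src x).
  by rewrite sX sF act_coact_mor // sG.
have xtX : tgt (ac F y) = lm (tgt G) (lc_tgt x).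
  by rewrite tX tF act_coact_mor // tG.
apply: (coact_cellE HL eG) => //.
  by rewrite fc_p_act_cell // (fc_coact_cell HL e1).
have ds : dom (tgt s) = dom (src s) by rewrite dom_src.
have cs : cod (tgt s) = cod (src s) by rewrite cod_src.
have dF : dom (tgt F) = dom (src F) by rewrite dom_src.
have cF : cod (tgt F) = cod (src F) by rewrite cod_src.
have dG : dom (tgt G) = dom (src G) by rewrite dom_src.
have cG : cod (tgt G) = cod (src G) by rewrite cod_src.
have dx := lc_sq_dom x; have cx := lc_sq_cod x.
have dy := lc_sq_dom y; have cy := lc_sq_cod y.
have S0 := cross_square s1 s2.
have S1 := cross_square t1 t2.
have E0 := lift_comp_lift_through t1 t2.
have HF := coact_cell_lift HL e1.
have HG := act_cell_lift HR e2.
have HX := act_cell_lift HR eF.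
have D0 := colift_lift_dom s1 s2; have C0 := colift_lift_cod s1 s2.
rewrite -sF -sG in S0 D0 C0; rewrite -tF -tG -dx -dy -cx -cy ds cs dF cG in S1.
rewrite -tF -tG -cx cG in E0.
set X := ac F y in sX tX xsX xtX HX *.
set l0 := l1 (dom (src s)) (sq_dom (lc_src x)) in S0 S1 D0 HF.
set l1s := l1 (cod (src s)) (sq_cod (lc_src x)) in C0 HF.
set k0 := r1 (dom (src s)) (sq_dom (lc_src y)) in D0 HG.
set k1 := r1 (cod (src s)) (sq_cod (lc_src y)) in S0 S1 C0 HG.
set m0 := l1 (dom (src G)) (sq_dom (lc_src x)) in D0 *.
set m1 := l1 (cod (src G)) (sq_cod (lc_src x)) in S0 S1 C0 E0 *.
set n0 := r1 (dom (src F)) (sq_dom (lc_src y)) in S0 S1 D0 HX *.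
set n1 := r1 (cod (src F)) (sq_cod (lc_src y)) in C0 HX *.
have c1 : cod l0 = dom (src s) := comp_colift_composable HL s1.
have c2 : cod (src s) = dom k1 := comp_lift_composable HR s2.
have c3 : cod (src F) = dom l1s by rewrite sF (cod_coact_mor HL s1).
have c4 : cod l1s = dom k1 by rewrite cod_colift_mor // (coover_cod s1).
have c5 : cod l0 = dom k0 by rewrite c1 (dom_lift_mor HR (over_dom s2)).
have c6 : cod k0 = dom (src G) by rewrite sG (act_mor_lift_composable HR s2).
have c7 : cod m0 = dom (src G) := comp_colift_composable HL eG0.
have c8 : cod n0 = dom m0.
  rewrite /n0 /m0 -c6 sF (dom_coact_mor HL s1) lift_colift_ob //.
    exact: (coover_dom s1).
  exact: (over_dom s2).
have c9 : dom (src X) = cod n0 by rewrite sX (dom_act_mor HR eF0).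
have c10 : cod (src X) = dom m1 by rewrite xsX (cod_coact_mor HL eG0).
have c11 : cod (src F) = dom n1 := comp_lift_composable HR eF0.
have c12 : cod n1 = dom m1 by rewrite -c10 sX (cod_act_mor HR eF0).
have qX : fc q X = lc_t y := fc_act_cell HR eF.
have qG : fc q G = lc_t y := fc_act_cell HR e2.
have sA0 : src (l2 (sq_cell (lc_src x)) (comp_colift (src G) (lc_src x)))
  = cmp (src G) m0 := src_colift_cell HL (fm_comp_colift HL eG0).
have tA0 : tgt (l2 (sq_cell (lc_src x)) (comp_colift (src G) (lc_src x)))
  = cmp m1 (src X) by rewrite -(coact_mor_lift HL eG0) xsX.
have sA1 : src (l2 (sq_cell (lc_tgt x)) (comp_colift (tgt G) (lc_tgt x)))
  = cmp (tgt G) m0.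
  by rewrite (src_colift_cell HL (fm_comp_colift HL eG1)) /comp_colift dG -dx.
have tA1 : tgt (l2 (sq_cell (lc_tgt x)) (comp_colift (tgt G) (lc_tgt x)))
  = cmp m1 (tgt X) by rewrite -(coact_mor_lift HL eG1) xtX cG -cx.
have sB1 : src (r2 (sq_cell (lc_tgt y)) (comp_lift (tgt F) (lc_tgt y)))
  = cmp (tgt X) n0 by rewrite -(act_mor_lift HR eF1) tX dF -dy.
have sB0 : src (r2 (sq_cell (lc_src y)) (comp_lift (src F) (lc_src y)))
  = cmp (src X) n0 by rewrite -(act_mor_lift HR eF0) sX.
(* The equation to prove, whiskered by the lift n0 and followed by the cell
   lift that [cc_inj] cancels. *)
have K : vc (hc (vc (l2 (sq_cell (lc_src x)) (comp_colift (src G) (lc_src x)))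
    (hc (idc m1) X)) (idc n0))
    (hc (idc m1) (r2 (sq_cell (lc_tgt y)) (comp_lift (tgt F) (lc_tgt y))))
  = vc (hc (vc (hc G (idc m0))
    (l2 (sq_cell (lc_tgt x)) (comp_colift (tgt G) (lc_tgt x)))) (idc n0))
    (hc (idc m1) (r2 (sq_cell (lc_tgt y)) (comp_lift (tgt F) (lc_tgt y)))).
{ apply: cube HF HG HX S0 S1 => //.
  + exact: (src_colift_cell HL (fm_comp_colift HL s1)).
  + by rewrite -(coact_mor_lift HL s1) sF.
  + by rewrite (src_colift_cell HL (fm_comp_colift HL t1)) /comp_colift ds -dx.
  + by rewrite -(coact_mor_lift HL t1) -tF cs -cx.
  + by rewrite -(act_mor_lift HR s2) sG.
  + exact: (tgt_lift_cell HR (fm_comp_lift HR s2)).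
  + by rewrite -(act_mor_lift HR t2) -tG ds -dy.
  + by rewrite (tgt_lift_cell HR (fm_comp_lift HR t2)) /comp_lift cs -cy.
  + exact: (tgt_lift_cell HR (fm_comp_lift HR eF0)).
  + by rewrite (tgt_lift_cell HR (fm_comp_lift HR eF1)) /comp_lift cF -cy.
}
have h7 := dom_src X; have h8 := cod_src X.
have h5 := dom_src G; have h6 := cod_src G.
have eT : tgt (sq_cell (lc_tgt y))
    = fm q (tgt (l2 (sq_cell (lc_tgt x))
      (through (tgt s) (lc_tgt x) (lc_tgt y)))).
  rewrite -fc_tgt fc_q_colift ?tgt_idc; first exact: fm_p_through.
  exact: fm_q_through.
(* Lifts for p are vertical, so both sides lie over the right-hand
   component of y. *)
have Q : fc q (vc (l2 (sq_cell (lc_src x)) (comp_colift (src G) (lc_src x)))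
    (hc (idc m1) X))
  = fc q (vc (hc G (idc m0))
    (l2 (sq_cell (lc_tgt x)) (comp_colift (tgt G) (lc_tgt x)))).
{ have q0 : fm q (comp_colift (src G) (lc_src x)) = src (lc_t y).
    rewrite fm_cmp // fm_q_colift ?(coover_dom eG0) // cmp_idr ?fm_dom //.
    by rewrite -fc_src qG.
  have q1 : fm q (comp_colift (tgt G) (lc_tgt x)) = tgt (lc_t y).
    rewrite fm_cmp ?(comp_colift_composable HL eG1) // fm_q_colift
      ?(coover_dom eG1) //.
    by rewrite cmp_idr ?fm_dom // -fc_tgt qG.
  rewrite !fc_vc; [bnd|bnd|].
  rewrite !fc_hc; [bnd|bnd|].
  rewrite !fc_q_colift; [exact: (fm_comp_colift HL eG0)|exact:
    (fm_comp_colift HL eG1)|].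
  rewrite q0 q1 !fc_idc !fm_q_colift ?(coover_dom eG0) ?(coover_cod eG0) //.
  rewrite qX qG hc_idl; first by rewrite -qG fc_src fm_cod.
  rewrite hc_idr; first by rewrite -qG fc_src fm_dom.
  by rewrite vc_idl ?vc_idr. }
apply: (om2_inj HR (over_dom eF0)) => //; rewrite -/n0; [bnd|bnd|bnd|].
apply: (cc_inj HR eT); rewrite ?E0 //; [bnd|bnd|bnd|].
by rewrite !fc_hc ?Q //; bnd.
Qed.
End CrossCell.

Lemma actions_commute_of_two_sided :
  actions_commute lam_of_vertical rho_of_vertical.
Proof.
apply: commute_intro => /=.
- move=> u i v e1 e2 _ _; exact: (lift_colift_ob (eq_sym e1) e2).
- move=> m f n e1 e2 _ _; exact: (act_coact_mor (eq_sym e1) e2).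
- move=> x s y e1 e2 _ _; exact: (act_coact_cell (eq_sym e1) e2).
Qed.

Theorem two_sided_actions :
  exists (lam : two_functor (left_pb p) J) (rho : two_functor (right_pb q) J),
    internal_two_sided_fibration lam rho
    /\ cleavage_eq (left_cleavage lam) L
    /\ cleavage_eq (right_cleavage rho) R.
Proof.
have ra := action_right_action HR.
have la : left_action lam_of.
  exact: (left_of_right_action (action_right_action HL)).
exists lam_of, rho_of; split; [|split].
- exact: (InternalTwoSidedFibration (la_assoc la) (la_unit la) (ra_assoc ra)
    (ra_unit ra) actions_commute_of_two_sided).
- rewrite /lam_of left_cleavage_of_right.
  exact: (right_cleavage_action HL).
- exact: (right_cleavage_action HR).
Qed.

End ActionsOfTwoSided.

(** * The characterization *)

Theorem theorem6p1 (A B J : two_category)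
  (p : two_functor J A) (q : two_functor J B) :
  ((exists (lam : two_functor (left_pb p) J) (rho : two_functor (right_pb q) J),
      internal_two_sided_fibration lam rho)
   <-> (exists (L : co_cleavage p) (R : cleavage q), two_sided_cleavage L R))
  /\ (forall (lam : two_functor (left_pb p) J)
             (rho : two_functor (right_pb q) J),
        internal_two_sided_fibration lam rho ->
        two_sided_cleavage (left_cleavage lam) (right_cleavage rho))
  /\ (forall (L : co_cleavage p) (R : cleavage q),
        two_sided_cleavage L R ->
        exists (lam : two_functor (left_pb p) J)
               (rho : two_functor (right_pb q) J),
          internal_two_sided_fibration lam rho
          /\ cleavage_eq (left_cleavage lam) L
          /\ cleavage_eq (right_cleavage rho) R).
Proof.
have fwd : forall (lam : two_functor (left_pb p) J)
    (rho : two_functor (right_pb q) J),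
    internal_two_sided_fibration lam rho ->
    two_sided_cleavage (left_cleavage lam) (right_cleavage rho).
  move=> lam rho [ls lq rp rt lass lun rass run lr].
  exact: (two_sided_of_actions (LeftAction lass lun) (RightAction rass run) lr).
split; [split|split=> //].
- by move=> [lam [rho h]]; exists (left_cleavage lam), (right_cleavage rho);
  apply: fwd.
- move=> [L [R h]]; case: (two_sided_actions h) => lam [rho [h' _]].
  by exists lam, rho.
- exact: two_sided_actions.
Qed.
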